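(* Assume $\mathrm{RP1}$, $\mathrm{RP2}$, $\mathrm{RT4}$ (defined in the context). Let $\varepsilon>0$, $\alpha>0$, $\mathbf{p}\in\mathcal{S}^*$ with $\lVert\mathbf{p}\rVert=1$, and let $\mathbf{DA}\in\{\mathbf{GJK}^*,\mathbf{G},\mathbf{SA}\}$. If $T^*<+\infty$, then the semi-analytical algorithm $\mathbf{S}_\varepsilon(\mathbf{p};\alpha)$ (described in the context) terminates in a finite number of iterations, and its outputs $T^*_{\mathbf{S}}[\varepsilon,\alpha,\mathbf{p}]$ (time) and $\boldsymbol{p}^*_{\mathbf{S}}[\varepsilon,\alpha,\mathbf{p}]$ (support vector) satisfy $$\mathbf{p}^*=\lim_{\varepsilon\to+0}\boldsymbol{p}^*_{\mathbf{S}}[\varepsilon,\alpha,\mathbf{p}],\qquad T^*=\lim_{\varepsilon\to+0}T^*_{\mathbf{S}}[\varepsilon,\alpha,\mathbf{p}].$$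
   Context: **Spaces and contact functions.** $n\in\mathbb{N}$, $\mathcal{S}=\mathbb{R}^{n\times1}$ (columns), $\mathcal{S}^*=\mathbb{R}^{1\times n}$ (rows), with Euclidean norms. For a nonempty strictly convex compact set $\mathcal{M}\subset\mathcal{S}$ and $\mathbf{p}\in\mathcal{S}^*\setminus\{\boldsymbol 0\}$, the contact point $\boldsymbol{s}_{\mathcal{M}}(\mathbf{p})$ is the unique maximizer of $\mathbf{s}\mapsto\mathbf{p}\mathbf{s}$ over $\mathcal{M}$ (singletons count as strictly convex). **Plant.** $\dot{\boldsymbol{s}}=\boldsymbol{A}(t)\boldsymbol{s}+\boldsymbol{u}$, $\boldsymbol{s}(0)=\mathbf{s}_0\in\mathcal{S}$, where $\boldsymbol{A}:\mathbb{R}\to\mathbb{R}^{n\times n}$ is measurable with fundamental matrix $\boldsymbol{\Phi}$ ($\dot{\boldsymbol{\Phi}}=\boldsymbol{A}\boldsymbol{\Phi}$, $\boldsymbol{\Phi}(0)=\mathbf{I}$), which is continuous with continuous derivative and nonsingular for all $t\ge0$. $\mathcal{U}\subset\mathcal{S}$ is a (nonempty) compact set, and $\mathcal{A}$ is the set of measurable functions $\boldsymbol{u}$ on $[0,\infty)$ with values in $\mathcal{U}$. The absolutely continuous solution is $\boldsymbol{s}(t;\boldsymbol{u})=\boldsymbol{\Phi}(t)\mathbf{s}_0+\boldsymbol{\Phi}(t)\int_0^t\boldsymbol{\Phi}(\tau)^{-1}\boldsymbol{u}(\tau)\,\mathrm{d}\tau$. The reachable set is $\mathcal{R}(t)=\{\boldsymbol{s}(t;\boldsymbol{u}):\boldsymbol{u}\in\mathcal{A}\}$.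 **Target.** $\mathcal{G}:\mathbb{R}\to2^{\mathcal{S}}$. $T^*=\inf_{\boldsymbol{u}\in\mathcal{A}}\inf\{t\ge0:\boldsymbol{s}(t;\boldsymbol{u})\in\mathcal{G}(t)\}$, with $\inf\varnothing=+\infty$. **Assumptions.** - $\mathrm{RP1}$ (normality): for all $t\ge 0$ and $\boldsymbol{u}_1,\boldsymbol{u}_2\in\mathcal{A}$, if $\boldsymbol{s}(t;\boldsymbol{u}_1)=\boldsymbol{s}(t;\boldsymbol{u}_2)\in\partial\mathcal{R}(t)$ then $\boldsymbol{u}_1=\boldsymbol{u}_2$ a.e. on $[0,t]$. (Under $\mathrm{RP1}$, $\mathcal{R}(t)$ is a strictly convex compact set.) - $\mathrm{RP2}$ (speed limit): there is $v_{\mathcal{R}}>0$ with $\lVert\boldsymbol{A}(t)\boldsymbol{s}(t;\boldsymbol{u})+\boldsymbol{u}(t)\rVert\le v_{\mathcal{R}}$ for all $\boldsymbol{u}\in\mathcal{A}$, $t\ge0$. - $\mathrm{RT4}$: each $\mathcal{G}(t)$ is a strictly convex compact set; $\mathcal{G}$ is a continuous mapping and $t\mapsto\boldsymbol{s}_{\mathcal{G}(t)}(\mathbf{p})$ is continuous and differentiable for every $\mathbf{p}\ne\boldsymbol0$, with derivative $\boldsymbol{v}_{\mathcal{G}(t)}(\mathbf{p})=\frac{\partial}{\partial t}\boldsymbol{s}_{\mathcal{G}(t)}(\mathbf{p})$; and there is $v_{\mathcal{G}}\ge0$ with $\lVert\boldsymbol{v}_{\mathcal{G}(t)}(\mathbf{p})\rVert\le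 v_{\mathcal{G}}$ for all $t$ and all $\mathbf{p}\neq\boldsymbol0$. **Distance estimates.** For $t\ge0$, $\mathbf{p}\ne\boldsymbol0$: $\rho_{\mathrm{lower}}(t,\mathbf{p})=\frac{\mathbf{p}}{\lVert\mathbf{p}\rVert}(\boldsymbol{s}_{\mathcal{G}(t)}(-\mathbf{p})-\boldsymbol{s}_{\mathcal{R}(t)}(\mathbf{p}))$, $\rho_{\mathrm{upper}}(t,\mathbf{p})=\lVert\boldsymbol{s}_{\mathcal{G}(t)}(-\mathbf{p})-\boldsymbol{s}_{\mathcal{R}(t)}(\mathbf{p})\rVert$, $\delta=\rho_{\mathrm{upper}}-\rho_{\mathrm{lower}}$. When $T^*<+\infty$, $\mathbf{p}^*$ denotes the unique solution of $\delta(T^*,\mathbf{p})=0$, $\lVert\mathbf{p}\rVert=1$, $\mathbf{p}\in\mathcal{S}^*$. **Simple boosting-time function.** $f(T,\mathbf{p})=T+\frac{\rho_{\mathrm{lower}}(T,\mathbf{p})}{v_{\mathcal{G}}+v_{\mathcal{R}}}$ if $\rho_{\mathrm{lower}}(T,\mathbf{p})\ge0$, and $f(T,\mathbf{p})=T$ otherwise. **Auxiliary notation.** $\boldsymbol{w}(t,\mathbf{p})=\boldsymbol{s}_{\mathcal{R}(t)}(\mathbf{p})-\boldsymbol{s}_{\mathcal{G}(t)}(-\mathbf{p})$. $\mathrm{Johnson}(\mathcal{V})$, for a finite $\mathcal{V}\subset\mathcal{S}$ with $\mathrm{card}\,\mathcal{V}\le n+1$, returns $(\mathbf{s},\tilde{\mathcal{V}})$,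 where $\mathbf{s}$ is the point of $\mathrm{conv}(\mathcal{V})$ nearest to $\boldsymbol0$ and $\tilde{\mathcal{V}}\subset\mathcal{V}$ satisfies $\mathbf{s}\in\mathrm{conv}(\tilde{\mathcal{V}})$, with $\mathrm{card}\,\tilde{\mathcal{V}}\le n$ if $\boldsymbol0\notin\mathrm{conv}(\mathcal{V})$. Also $\boldsymbol{q}(t,\mathbf{p})=\left(\frac{\boldsymbol{s}_{\mathcal{G}(t)}(-\mathbf{p})-\boldsymbol{s}_{\mathcal{R}(t)}(\mathbf{p})}{\lVert\boldsymbol{s}_{\mathcal{G}(t)}(-\mathbf{p})-\boldsymbol{s}_{\mathcal{R}(t)}(\mathbf{p})\rVert}\right)^\top-\mathbf{p}$ and $\xi'(\gamma;t,\mathbf{p})=\boldsymbol{q}(t,\mathbf{p})\big(\boldsymbol{s}_{\mathcal{G}(t)}(-(\mathbf{p}+\gamma\boldsymbol{q}(t,\mathbf{p})))-\boldsymbol{s}_{\mathcal{R}(t)}(\mathbf{p}+\gamma\boldsymbol{q}(t,\mathbf{p}))\big)$. **Distance algorithms.** - $\mathbf{GJK}_\varepsilon(t,\mathbf{p})\in\mathcal{S}$: set $\mathbf{s}\leftarrow\boldsymbol{w}(t,\mathbf{p})$, $\mathcal{V}\leftarrow\{\mathbf{s}\}$; while $\lVert\mathbf{s}\rVert>\varepsilon$ and $\lVert\mathbf{s}\rVert-\rho_{\mathrm{lower}}(t,-\mathbf{s}^\top)>\varepsilon$ do: $\mathcal{V}\leftarrow\mathcal{V}\cup\{\boldsymbol{w}(t,-\mathbf{s}^\top)\}$;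 $(\mathbf{s},\mathcal{V})\leftarrow\mathrm{Johnson}(\mathcal{V})$. Return $\mathbf{s}$. - $\mathbf{GJK}^*_\alpha(t,\mathbf{p})\in\mathcal{S}^*$: set $\mathcal{V}\leftarrow\{\boldsymbol{w}(t,\mathbf{p})\}$; while $\delta(t,\mathbf{p})>\alpha\rho_{\mathrm{lower}}(t,\mathbf{p})$ do: $(\mathbf{s},\mathcal{V})\leftarrow\mathrm{Johnson}(\mathcal{V})$; $\mathbf{p}\leftarrow-\mathbf{s}^\top/\lVert\mathbf{s}\rVert$; $\mathcal{V}\leftarrow\mathcal{V}\cup\{\boldsymbol{w}(t,\mathbf{p})\}$. Return $\mathbf{p}$. - $\mathbf{G}_\alpha(t,\mathbf{p})\in\mathcal{S}^*$: set $\mathbf{s}\leftarrow\boldsymbol{w}(t,\mathbf{p})$; while $\delta(t,\mathbf{p})>\alpha\rho_{\mathrm{lower}}(t,\mathbf{p})$ do: $\mathbf{p}\leftarrow-\mathbf{s}^\top/\lVert\mathbf{s}\rVert$; $\tilde{\mathbf{s}}\leftarrow\mathbf{s}-\boldsymbol{w}(t,\mathbf{p})$; $\mathbf{s}\leftarrow\mathbf{s}-\tilde{\mathbf{s}}\min\left(1,\frac{\mathbf{s}^\top\tilde{\mathbf{s}}}{\lVert\tilde{\mathbf{s}}\rVert^2}\right)$ ($\mathbf{s}$ is left unchanged if $\tilde{\mathbf{s}}=\boldsymbol0$). Return $\mathbf{p}$. - $\mathbf{SA}_\alpha(t,\mathbf{p};\gamma)\in\mathcal{S}^*$: while $\delta(t,\mathbf{p})>\alpha\rho_{\mathrm{lower}}(t,\mathbf{p})$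 do: (while $\xi'(\gamma;t,\mathbf{p})<0$ do $\gamma\leftarrow\gamma/2$); $\mathbf{p}\leftarrow\frac{\mathbf{p}+\gamma\boldsymbol{q}(t,\mathbf{p})}{\lVert\mathbf{p}+\gamma\boldsymbol{q}(t,\mathbf{p})\rVert}$. Return $\mathbf{p}$. **Semi-analytical algorithm $\mathbf{S}_\varepsilon(\mathbf{p};\alpha)$.** Set $t\leftarrow0$, $\gamma\leftarrow1$. If $\lVert\mathbf{GJK}_\varepsilon(t,\mathbf{p})\rVert>\varepsilon$, then: set $\mathbf{p}\leftarrow-\mathbf{GJK}_\varepsilon(t,\mathbf{p})^\top/\lVert\mathbf{GJK}_\varepsilon(t,\mathbf{p})\rVert$; while $\rho_{\mathrm{upper}}(t,\mathbf{p})>\varepsilon$ do: $t\leftarrow f(t,\mathbf{p})$; $\mathbf{p}\leftarrow\mathbf{DA}_\alpha(t,\mathbf{p};\gamma)$. Return $(t,\mathbf{p})$. (The argument $\gamma$ is used only when $\mathbf{DA}=\mathbf{SA}$.) An iteration is one pass of a while-loop.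
   Formalization: The limit of the support vectors is stated only for T* > 0: if T* = 0 the algorithm returns the initial p for every ε, so that limit is p, which need not be p* (n=1, A=0, s_0=0, U=[-1,1], G=[0,1], p=-1); termination and the time limit are kept for all T* < +∞. *)

(* Defs.v *)
From HB Require Import structures.
From mathcomp Require Import all_boot all_order all_algebra finmap.
From mathcomp Require Import all_classical all_reals all_analysis.
Import Order.TTheory GRing.Theory Num.Theory.
Import numFieldNormedType.Exports.

Set Implicit Arguments.
Unset Strict Implicit.
Unset Printing Implicit Defensive.

Local Open Scope classical_set_scope.
Local Open Scope ring_scope.

(* The library norm `|x| on matrices is the sup norm, so the Euclidean norm is
   defined here; both induce the same topology, hence limits, continuity,
   derivatives, compactness and interiors are the library ones. *)
Definition enorm (R : realType) (m k : nat) (x : 'M[R]_(m, k)) : R :=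
  Num.sqrt (\sum_i \sum_j x i j ^+ 2).

(* The scalar p s of a row p and a column s. *)
Definition pairing (R : realType) (n : nat) (p : 'rV[R]_n) (s : 'cV[R]_n) : R :=
  (p *m s) 0 0.

(* Singletons satisfy this vacuously. *)
Definition strictly_convex (R : realType) (n : nat) (M : set 'cV[R]_n) : Prop :=
  forall x y, M x -> M y -> x <> y ->
  forall l : R, 0 < l -> l < 1 -> interior M (l *: x + (1 - l) *: y).

(* The maximizer of s |-> p s over M; it is unique when M is nonempty, compact
   and strictly convex and p != 0 (unspecified choice, or 0, otherwise). *)
Definition contact (R : realType) (n : nat) (M : set 'cV[R]_n) (p : 'rV[R]_n) :
    'cV[R]_n :=
  xget 0 [set s | M s /\ forall s', M s' -> pairing p s' <= pairing p s].

Definition hausdorff_continuous (R : realType) (n : nat)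
    (G : R -> set 'cV[R]_n) : Prop :=
  forall (t e : R), 0 < e -> \forall t' \near t,
    (forall x, G t' x -> exists2 y, G t y & enorm (x - y) < e) /\
    (forall y, G t y -> exists2 x, G t' x & enorm (x - y) < e).

(* Phi is of class C^1 on [0, +oo[ with Phi' = A Phi there: continuity of Phi
   and A Phi up to 0 makes the one-sided derivative at 0 equal A(0) Phi(0). *)
Definition fundamental_matrix (R : realType) (n : nat) (A Phi : R -> 'M[R]_n) :
    Prop :=
  [/\ Phi 0 = 1%:M,
      {within `[0, +oo[, continuous Phi},
      {within `[0, +oo[, continuous (fun t => A t *m Phi t)},
      forall t : R, 0 < t -> is_derive t (1 : R) Phi (A t *m Phi t) &
      forall t : R, 0 <= t -> Phi t \in unitmx].

(* Functions on [0, +oo[ are represented by functions on R whose values at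
   negative times are irrelevant. *)
Definition controls (R : realType) (n : nat) (U : set 'cV[R]_n) :
    set (R -> 'cV[R]_n) :=
  [set u : R -> 'cV[R]_n |
           (forall i, measurable_fun (`[0, +oo[%classic : set R) (fun t : R => u t i 0)) /\
           forall t : R, 0 <= t -> U (u t)].

Definition trajectory (R : realType) (n : nat) (Phi : R -> 'M[R]_n)
    (s0 : 'cV[R]_n) (u : R -> 'cV[R]_n) (t : R) : 'cV[R]_n :=
  Phi t *m s0 +
  Phi t *m \col_i \int[lebesgue_measure]_(tau in (`[0, t]%classic : set R))
                     ((invmx (Phi tau) *m u tau) i 0).

Definition reachable (R : realType) (n : nat) (Phi : R -> 'M[R]_n)
    (s0 : 'cV[R]_n) (U : set 'cV[R]_n) (t : R) : set 'cV[R]_n :=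
  [set trajectory Phi s0 u t | u in controls U].

Definition optimal_time (R : realType) (n : nat) (Phi : R -> 'M[R]_n)
    (s0 : 'cV[R]_n) (U : set 'cV[R]_n) (G : R -> set 'cV[R]_n) : \bar R :=
  ereal_inf
    [set ereal_inf
       [set t%:E | t in [set t | 0 <= t /\ G t (trajectory Phi s0 u t)]]
    | u in controls U].

Definition RP1 (R : realType) (n : nat) (Phi : R -> 'M[R]_n)
    (s0 : 'cV[R]_n) (U : set 'cV[R]_n) : Prop :=
  forall (t : R) (u1 u2 : R -> 'cV[R]_n), 0 <= t ->
    controls U u1 -> controls U u2 ->
    trajectory Phi s0 u1 t = trajectory Phi s0 u2 t ->
    (closure (reachable Phi s0 U t) `\` interior (reachable Phi s0 U t))
      (trajectory Phi s0 u1 t) ->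
    {ae lebesgue_measure, forall tau : R, `[0, t]%classic tau -> u1 tau = u2 tau}.

Definition RP2 (R : realType) (n : nat) (A Phi : R -> 'M[R]_n)
    (s0 : 'cV[R]_n) (U : set 'cV[R]_n) (vR : R) : Prop :=
  0 < vR /\
  forall (u : R -> 'cV[R]_n) (t : R), controls U u -> 0 <= t ->
    enorm (A t *m trajectory Phi s0 u t + u t) <= vR.

Definition RT4 (R : realType) (n : nat) (G : R -> set 'cV[R]_n) (vG : R) : Prop :=
  [/\ forall t, [/\ G t !=set0, compact (G t) & strictly_convex (G t)],
      hausdorff_continuous G,
      forall p : 'rV[R]_n, p <> 0 ->
        continuous (fun t => contact (G t) p) /\
        forall t, derivable (fun t => contact (G t) p) t 1,
      0 <= vG &
      forall (p : 'rV[R]_n) (t : R), p <> 0 ->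
        enorm (derive1 (fun t => contact (G t) p) t) <= vG].

(* Here and below, Q stands for the map t |-> reachable set. *)
Definition wpoint (R : realType) (n : nat) (Q G : R -> set 'cV[R]_n)
    (t : R) (p : 'rV[R]_n) : 'cV[R]_n :=
  contact (Q t) p - contact (G t) (- p).

Definition rho_lower (R : realType) (n : nat) (Q G : R -> set 'cV[R]_n)
    (t : R) (p : 'rV[R]_n) : R :=
  pairing ((enorm p)^-1 *: p) (contact (G t) (- p) - contact (Q t) p).

Definition rho_upper (R : realType) (n : nat) (Q G : R -> set 'cV[R]_n)
    (t : R) (p : 'rV[R]_n) : R :=
  enorm (contact (G t) (- p) - contact (Q t) p).

Definition delta (R : realType) (n : nat) (Q G : R -> set 'cV[R]_n)
    (t : R) (p : 'rV[R]_n) : R :=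
  rho_upper Q G t p - rho_lower Q G t p.

Definition boost (R : realType) (n : nat) (Q G : R -> set 'cV[R]_n) (vR vG : R)
    (t : R) (p : 'rV[R]_n) : R :=
  if 0 <= rho_lower Q G t p then t + rho_lower Q G t p / (vG + vR) else t.

Definition conv_hull (R : realType) (n : nat) (V : {fset 'cV[R]_n}) :
    set 'cV[R]_n :=
  [set s | exists lam : 'cV[R]_n -> R,
     [/\ forall v, v \in V -> 0 <= lam v,
         \sum_(v <- V) lam v = 1 &
         s = \sum_(v <- V) lam v *: v]].

Definition johnson_spec (R : realType) (n : nat)
    (J : {fset 'cV[R]_n} -> 'cV[R]_n * {fset 'cV[R]_n}) : Prop :=
  forall V : {fset 'cV[R]_n}, V != fset0 -> (#|` V| <= n.+1)%N ->
    [/\ conv_hull V (J V).1,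
        forall s, conv_hull V s -> enorm (J V).1 <= enorm s,
        ((J V).2 `<=` V)%fset,
        conv_hull (J V).2 (J V).1 &
        ~ conv_hull V 0 -> (#|` (J V).2| <= n)%N].

(* Big-step semantics of a while loop: [while g b x y] holds when the loop with
   guard g and body b, started in state x, stops after finitely many iterations
   in state y. Bodies are relations since they may contain loops themselves. *)
Inductive while (S : Type) (g : S -> Prop) (b : S -> S -> Prop) : S -> S -> Prop :=
| while_stop x : ~ g x -> while g b x x
| while_iter x y z : g x -> b x y -> while g b y z -> while g b x z.

Definition dir (R : realType) (n : nat) (s : 'cV[R]_n) : 'rV[R]_n :=
  - ((enorm s)^-1 *: s^T).

(* GJK_eps(t, p); loop state (s, V). *)
Definition GJK (R : realType) (n : nat) (Q G : R -> set 'cV[R]_n)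
    (J : {fset 'cV[R]_n} -> 'cV[R]_n * {fset 'cV[R]_n})
    (eps t : R) (p : 'rV[R]_n) (out : 'cV[R]_n) : Prop :=
  exists V : {fset 'cV[R]_n},
    while
      (fun x => enorm x.1 > eps /\
                enorm x.1 - rho_lower Q G t (- x.1^T) > eps)
      (fun x y => y = J (wpoint Q G t (- x.1^T) |` x.2)%fset)
      (wpoint Q G t p, [fset wpoint Q G t p]%fset) (out, V).

Definition da_guard (R : realType) (n : nat) (Q G : R -> set 'cV[R]_n)
    (alpha t : R) (p : 'rV[R]_n) : Prop :=
  delta Q G t p > alpha * rho_lower Q G t p.

(* GJK*_alpha(t, p); loop state (p, V). *)
Definition GJKstar (R : realType) (n : nat) (Q G : R -> set 'cV[R]_n)
    (J : {fset 'cV[R]_n} -> 'cV[R]_n * {fset 'cV[R]_n})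
    (alpha t : R) (p out : 'rV[R]_n) : Prop :=
  exists V : {fset 'cV[R]_n},
    while
      (fun x => da_guard Q G alpha t x.1)
      (fun x y => let sV := J x.2 in
         y = (dir sV.1, (wpoint Q G t (dir sV.1) |` sV.2)%fset))
      (p, [fset wpoint Q G t p]%fset) (out, V).

(* If s~ = 0 then this is s, by the convention x / 0 = 0. *)
Definition gilbert_update (R : realType) (n : nat) (s st : 'cV[R]_n) : 'cV[R]_n :=
  s - Num.min 1 (pairing s^T st / enorm st ^+ 2) *: st.

(* G_alpha(t, p); loop state (p, s). *)
Definition Gilbert (R : realType) (n : nat) (Q G : R -> set 'cV[R]_n)
    (alpha t : R) (p out : 'rV[R]_n) : Prop :=
  exists s : 'cV[R]_n,
    while
      (fun x => da_guard Q G alpha t x.1)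
      (fun x y =>
         y = (dir x.2, gilbert_update x.2 (x.2 - wpoint Q G t (dir x.2))))
      (p, wpoint Q G t p) (out, s).

Definition qdir (R : realType) (n : nat) (Q G : R -> set 'cV[R]_n)
    (t : R) (p : 'rV[R]_n) : 'rV[R]_n :=
  let d := contact (G t) (- p) - contact (Q t) p in
  ((enorm d)^-1 *: d)^T - p.

Definition xi' (R : realType) (n : nat) (Q G : R -> set 'cV[R]_n)
    (gamma t : R) (p : 'rV[R]_n) : R :=
  let q := qdir Q G t p in
  pairing q (contact (G t) (- (p + gamma *: q)) - contact (Q t) (p + gamma *: q)).

(* SA_alpha(t, p; gamma); loop state (p, gamma). *)
Definition SteepestAscent (R : realType) (n : nat) (Q G : R -> set 'cV[R]_n)
    (alpha t gamma : R) (p out : 'rV[R]_n) : Prop :=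
  exists gamma' : R,
    while
      (fun x => da_guard Q G alpha t x.1)
      (fun x y =>
         while (fun c => xi' Q G c t x.1 < 0) (fun c c' => c' = c / 2) x.2 y.2 /\
         let p' := x.1 + y.2 *: qdir Q G t x.1 in
         y.1 = (enorm p')^-1 *: p')
      (p, gamma) (out, gamma').

Inductive distance_algorithm : Set := DA_GJKstar | DA_G | DA_SA.

Definition run_DA (R : realType) (n : nat) (da : distance_algorithm)
    (Q G : R -> set 'cV[R]_n)
    (J : {fset 'cV[R]_n} -> 'cV[R]_n * {fset 'cV[R]_n})
    (alpha t gamma : R) (p out : 'rV[R]_n) : Prop :=
  match da with
  | DA_GJKstar => GJKstar Q G J alpha t p out
  | DA_G => Gilbert Q G alpha t p out
  | DA_SA => SteepestAscent Q G alpha t gamma p out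
  end.

(* S_eps(p; alpha) terminates with output out = (time, support vector). The step
   gamma = 1 is passed by value: a distance algorithm returns only a vector. *)
Definition semi_analytical (R : realType) (n : nat) (da : distance_algorithm)
    (Q G : R -> set 'cV[R]_n)
    (J : {fset 'cV[R]_n} -> 'cV[R]_n * {fset 'cV[R]_n})
    (vR vG eps alpha : R) (p : 'rV[R]_n) (out : R * 'rV[R]_n) : Prop :=
  exists2 s : 'cV[R]_n, GJK Q G J eps 0 p s &
    if eps < enorm s then
      while
        (fun x => rho_upper Q G x.1 x.2 > eps)
        (fun x y => y.1 = boost Q G vR vG x.1 x.2 /\
                    run_DA da Q G J alpha y.1 1 x.2 y.2)
        (0, dir s) out
    else out = (0, p).

(* Main.v *)
Require Import Defs.
From HB Require Import structures.
From mathcomp Require Import all_boot all_order all_algebra finmap.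
From mathcomp Require Import all_classical all_reals all_analysis.
From mathcomp Require Import measurable_realfun.
From mathcomp Require Import ring lra.
Import Order.TTheory GRing.Theory Num.Theory.
Import numFieldNormedType.Exports.

Set Implicit Arguments.
Unset Strict Implicit.
Unset Printing Implicit Defensive.

Local Open Scope classical_set_scope.
Local Open Scope ring_scope.

(** The relative position of the two bodies at time [t] is the difference
    [W t = R t - G t] of the reachable set and the target: the target is hit at
    [t] iff [0] is in [W t], [wpoint] is the contact map of [W t], and for a unit
    vector [p] the number [rho_lower t p = - p (w t p)] is the signed distance
    from [0] to a half-space that contains [W t], so that it bounds the distance
    between the bodies from below ([rho_lower_le]). Three facts on [W] suffice for the
    algorithm: for all [t >= 0], [W t] is convex and compact, each direction has
    a unique maximizer, and the support function [p (w t p)] is Lipschitz in [t]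
    with constant [vG + vR].

    - The distance algorithms terminate while [0] is not in [W t]. A pass of
      Gilbert or GJK from a point [s] of [W t] is a Frank-Wolfe step: the squared
      norm drops by an amount controlled by the gap [s^T (s - w (dir s))]. This
      gap is bounded below as long as the guard holds, because the guard is
      false near the point of minimal norm ([guard_gap]), by continuity of the
      contact map. For steepest ascent, concavity of [- p (w t p)] along
      the search ray and uniform continuity of the contact map on the sphere give a
      gain of [rho_lower] that is bounded below
      ([SteepestAscent_terminates]).
    - A boosted time never passes the optimal time [T], by the Lipschitz bound
      and [0] in [W T] ([boost_le]). The guard being false at the end of a
      distance computation, the next boost advances the time by at least a
      fixed amount as long as [rho_upper > eps]; hence the outer loop stops
      ([outer_loop]). It stops where the distance is at most [eps]; since the
      distance is bounded below on each [[0, T - e]], the final time tends to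
      [T], and the final direction, for which [rho_lower] is at least [- eps],
      tends to the only direction with [rho_lower T p = 0]
      ([semi_analytical_limit]).

    The difficult hypotheses on [W] are those on the reachable set, which is not
    assumed to be convex or closed, [U] being only compact. Two controls can be
    exchanged on a measurable set of times. Lyapunov's theorem
    ([lyapunov_fraction]), proved here by successive halvings, provides a set on
    which this moves the endpoint by a prescribed fraction: the reachable set is
    convex ([reachable_convex]). A measurable selection
    ([measurable_selection]) gives in each direction a control that maximizes
    the costate pointwise, hence a maximizer of the reachable set. Two
    maximizing controls agree almost everywhere: otherwise exchanging them on
    two complementary halves would give two different controls with the same
    boundary endpoint, against normality ([maximizing_control_unique]). So the
    pointwise maximizer is itself unique almost everywhere ([extremal_ae]), the
    contact point depends continuously on the direction, and each supporting
    hyperplane meets the closure of the reachable set at one reachable point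
    ([face_singleton]). A point of the closure lies on a segment between a
    reachable point and such a contact point, so the reachable set is closed
    ([reachable_closed]). Finally the speed limit, applied to controls that are
    changed at a single time, bounds the right growth of every linear functional
    along a trajectory ([speed_local]) and makes trajectories Lipschitz
    ([traj_lipschitz]). *)

(** * The Euclidean norm and the pairing *)

Section Euclid.
Context {R : realType}.
Implicit Types (m n k : nat).

Lemma pairingE n (p : 'rV[R]_n) (s : 'cV[R]_n) :
  pairing p s = \sum_i p 0 i * s i 0.
Proof. by rewrite /pairing mxE. Qed.

Lemma pairingDr n (p : 'rV[R]_n) (s s' : 'cV[R]_n) :
  pairing p (s + s') = pairing p s + pairing p s'.
Proof. by rewrite /pairing mulmxDr mxE. Qed.

Lemma pairingDl n (p p' : 'rV[R]_n) (s : 'cV[R]_n) :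
  pairing (p + p') s = pairing p s + pairing p' s.
Proof. by rewrite /pairing mulmxDl mxE. Qed.

Lemma pairingNr n (p : 'rV[R]_n) (s : 'cV[R]_n) :
  pairing p (- s) = - pairing p s.
Proof. by rewrite /pairing mulmxN mxE. Qed.

Lemma pairingNl n (p : 'rV[R]_n) (s : 'cV[R]_n) :
  pairing (- p) s = - pairing p s.
Proof. by rewrite /pairing mulNmx mxE. Qed.

Lemma pairingBr n (p : 'rV[R]_n) (s s' : 'cV[R]_n) :
  pairing p (s - s') = pairing p s - pairing p s'.
Proof. by rewrite pairingDr pairingNr. Qed.

Lemma pairingBl n (p p' : 'rV[R]_n) (s : 'cV[R]_n) :
  pairing (p - p') s = pairing p s - pairing p' s.
Proof. by rewrite pairingDl pairingNl. Qed.

Lemma pairingZr n (a : R) (p : 'rV[R]_n) (s : 'cV[R]_n) :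
  pairing p (a *: s) = a * pairing p s.
Proof. by rewrite /pairing -scalemxAr mxE. Qed.

Lemma pairingZl n (a : R) (p : 'rV[R]_n) (s : 'cV[R]_n) :
  pairing (a *: p) s = a * pairing p s.
Proof. by rewrite /pairing -scalemxAl mxE. Qed.

Lemma pairing0r n (p : 'rV[R]_n) : pairing p 0 = 0.
Proof. by rewrite /pairing mulmx0 mxE. Qed.

Lemma pairing0l n (s : 'cV[R]_n) : pairing 0 s = 0.
Proof. by rewrite /pairing mul0mx mxE. Qed.

Lemma pairing_trC n (x y : 'cV[R]_n) : pairing x^T y = pairing y^T x.
Proof. by rewrite !pairingE; apply: eq_bigr => i _; rewrite !mxE mulrC. Qed.

Lemma enorm_ge0 m k (x : 'M[R]_(m, k)) : 0 <= enorm x.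
Proof. exact: sqrtr_ge0. Qed.

Lemma enorm_sqE m k (x : 'M[R]_(m, k)) :
  enorm x ^+ 2 = \sum_i \sum_j x i j ^+ 2.
Proof.
by rewrite sqr_sqrtr// sumr_ge0// => i _; apply: sumr_ge0 => j _; exact: sqr_ge0.
Qed.

Lemma enorm_tr m k (x : 'M[R]_(m, k)) : enorm x^T = enorm x.
Proof.
rewrite /enorm exchange_big; congr Num.sqrt; apply: eq_bigr => i _.
by apply: eq_bigr => j _; rewrite mxE.
Qed.

Lemma enorm_sq n (x : 'cV[R]_n) : enorm x ^+ 2 = pairing x^T x.
Proof.
rewrite enorm_sqE pairingE; apply: eq_bigr => i _.
by rewrite big_ord1 mxE expr2.
Qed.

Lemma enorm_sq_row n (p : 'rV[R]_n) : enorm p ^+ 2 = pairing p p^T.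
Proof. by rewrite -enorm_tr enorm_sq trmxK. Qed.

Lemma coord_le_enorm m k (x : 'M[R]_(m, k)) i j : `|x i j| <= enorm x.
Proof.
rewrite -[leLHS]sqrtr_sqr ler_wsqrtr//.
rewrite (bigD1 i)//= (bigD1 j)//= -addrA lerDl addr_ge0//.
  by apply: sumr_ge0 => ? _; exact: sqr_ge0.
by apply: sumr_ge0 => ? _; apply: sumr_ge0 => ? _; exact: sqr_ge0.
Qed.

Lemma enorm0 m k : enorm (0 : 'M[R]_(m, k)) = 0.
Proof.
rewrite /enorm big1 ?sqrtr0// => i _; rewrite big1// => j _.
by rewrite mxE expr0n.
Qed.

Lemma enorm_eq0 m k (x : 'M[R]_(m, k)) : (enorm x == 0) = (x == 0).
Proof.
apply/eqP/eqP => [x0|->]; last exact: enorm0.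
apply/matrixP => i j; rewrite mxE; apply/eqP; rewrite -normr_le0 -x0.
exact: coord_le_enorm.
Qed.

Lemma enorm_gt0 m k (x : 'M[R]_(m, k)) : (0 < enorm x) = (x != 0).
Proof. by rewrite lt_def enorm_ge0 andbT enorm_eq0. Qed.

Lemma enormZ m k (a : R) (x : 'M[R]_(m, k)) : enorm (a *: x) = `|a| * enorm x.
Proof.
apply/eqP; rewrite -(eqrXn2 (_ : 0 < 2)%N) ?mulr_ge0 ?enorm_ge0//.
rewrite exprMn !enorm_sqE real_normK ?num_real// mulr_sumr; apply/eqP.
apply: eq_bigr => i _; rewrite mulr_sumr; apply: eq_bigr => j _.
by rewrite mxE exprMn.
Qed.

Lemma enormN m k (x : 'M[R]_(m, k)) : enorm (- x) = enorm x.
Proof. by rewrite -scaleN1r enormZ normrN1 mul1r. Qed.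

Lemma enormBC m k (x y : 'M[R]_(m, k)) : enorm (x - y) = enorm (y - x).
Proof. by rewrite -opprB enormN. Qed.

(** Expanding the square of [|s|^2 x - (x.s) s] avoids dividing by [|s|]. *)
Lemma cauchy_schwarz n (p : 'rV[R]_n) (s : 'cV[R]_n) :
  pairing p s <= enorm p * enorm s.
Proof.
have [->|s0] := eqVneq s 0; first by rewrite pairing0r enorm0 mulr0.
have sp : 0 < enorm s ^+ 2 by rewrite exprn_gt0// enorm_gt0.
have key : pairing p s ^+ 2 <= (enorm p * enorm s) ^+ 2.
  rewrite exprMn -(ler_pM2r sp) -subr_ge0.
  have := sqr_ge0 (enorm (enorm s ^+ 2 *: p^T - pairing p s *: s)).
  have tr : (enorm s ^+ 2 *: p^T - pairing p s *: s)^T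
          = enorm s ^+ 2 *: p - pairing p s *: s^T.
    by apply/matrixP => i j; rewrite !mxE.
  rewrite [X in 0 <= X -> _]enorm_sq tr.
  rewrite !(pairingDl, pairingDr, pairingNl, pairingNr, pairingZl, pairingZr).
  rewrite (pairing_trC s) trmxK -enorm_sq -enorm_sq_row.
  set a := enorm s; set b := enorm p; set c := pairing p s.
  by congr (_ <= _); ring.
apply: le_trans (ler_norm _) _.
by rewrite -(ler_pXn2r (_ : 0 < 2)%N) ?nnegrE ?mulr_ge0 ?enorm_ge0// real_normK ?num_real.
Qed.

Lemma cauchy_schwarz_norm n (p : 'rV[R]_n) (s : 'cV[R]_n) :
  `|pairing p s| <= enorm p * enorm s.
Proof.
rewrite ler_norml cauchy_schwarz andbT lerNl -pairingNr.
by rewrite (le_trans (cauchy_schwarz _ _))// enormN.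
Qed.

Lemma enormD_col n (x y : 'cV[R]_n) : enorm (x + y) <= enorm x + enorm y.
Proof.
rewrite -(ler_pXn2r (_ : 0 < 2)%N) ?nnegrE ?addr_ge0 ?enorm_ge0//.
rewrite enorm_sq linearD /= pairingDl !pairingDr sqrrD -!enorm_sq.
rewrite (pairing_trC y) addrA -subr_ge0.
have := cauchy_schwarz x^T y; rewrite enorm_tr; lra.
Qed.

Lemma enormD_row n (x y : 'rV[R]_n) : enorm (x + y) <= enorm x + enorm y.
Proof. by rewrite -enorm_tr linearD /= (le_trans (enormD_col _ _))// !enorm_tr. Qed.

Lemma enormB_col n (x y : 'cV[R]_n) : enorm (x - y) <= enorm x + enorm y.
Proof. by rewrite (le_trans (enormD_col _ _))// enormN. Qed.

Lemma enorm_lip_row n (x y : 'rV[R]_n) : `|enorm x - enorm y| <= enorm (x - y).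
Proof.
rewrite ler_norml; apply/andP; split.
  by have := enormD_row x (y - x); rewrite addrC subrK enormBC; lra.
by have := enormD_row y (x - y); rewrite addrC subrK; lra.
Qed.

Lemma enorm_lip_col n (x y : 'cV[R]_n) : `|enorm x - enorm y| <= enorm (x - y).
Proof. by rewrite -(enorm_tr x) -(enorm_tr y) (le_trans (enorm_lip_row _ _))// -linearB/= enorm_tr. Qed.

Lemma enorm_unit m k (x : 'M[R]_(m, k)) : x != 0 -> enorm ((enorm x)^-1 *: x) = 1.
Proof.
by move=> x0; rewrite enormZ ger0_norm ?invr_ge0 ?enorm_ge0// mulVf// enorm_eq0.
Qed.

Lemma enorm_le_norm m k (x : 'M[R]_(m, k)) :
  enorm x <= Num.sqrt (m * k)%:R * `|x|.
Proof.
have h i j : `|x i j| <= `|x|.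
  rewrite [leRHS]/Num.Def.normr/= mx_normrE.
  by apply/bigmax_geP; right; exists (i, j).
rewrite -(ler_pXn2r (_ : 0 < 2)%N) ?nnegrE ?mulr_ge0 ?sqrtr_ge0 ?enorm_ge0//.
rewrite enorm_sqE exprMn sqr_sqrtr ?ler0n//.
apply: (@le_trans _ _ (\sum_(i < m) \sum_(j < k) `|x| ^+ 2)).
  apply: ler_sum => i _; apply: ler_sum => j _.
  by rewrite -[leLHS]real_normK ?num_real// ler_pXn2r ?nnegrE.
under eq_bigr do rewrite sumr_const.
by rewrite sumr_const !card_ord -mulrnA mulr_natl mulnC.
Qed.

Lemma norm_le_enorm m k (x : 'M[R]_(m, k)) : `|x| <= enorm x.
Proof.
rewrite [leLHS]/Num.Def.normr/= mx_normrE; apply/bigmax_leP; split.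
  exact: enorm_ge0.
by move=> [i j] _; exact: coord_le_enorm.
Qed.

(** By equivalence of the Euclidean norm with the sup norm, which defines the
    topology of matrices. *)
Lemma nbhs_enormP m k (x : 'M[R]_(m, k)) (P : set 'M[R]_(m, k)) :
  nbhs x P <-> exists2 e : R, 0 < e & forall y, enorm (y - x) < e -> P y.
Proof.
split=> [/nbhs_normP[e /= e0 xP]|[e e0 xP]].
  exists e => // y xy; apply: xP => /=.
  by rewrite distrC (le_lt_trans (norm_le_enorm _)).
apply/(@nbhs_normP _ (matrix R m k)); pose c : R := Num.sqrt (m * k)%:R.
have c1 : 0 < c + 1 by rewrite ltr_wpDl// sqrtr_ge0.
exists (e / (c + 1)) => /=; first by rewrite divr_gt0.
move=> y /=; rewrite ltr_pdivlMr// => xy; apply: xP.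
rewrite enormBC (le_lt_trans (enorm_le_norm _))// (le_lt_trans _ xy)//.
by rewrite mulrC ler_wpM2l// lerDl.
Qed.

Lemma continuous_lip m k (f : 'M[R]_(m, k) -> R) (c : R) :
  (forall x y, `|f x - f y| <= c * enorm (x - y)) -> continuous f.
Proof.
move=> fc x P /nbhs_ballP[e /= e0 eP]; apply/nbhs_enormP.
exists (e / (`|c| + 1)); first by rewrite divr_gt0// ltr_wpDl.
move=> y; rewrite ltr_pdivlMr ?ltr_wpDl// => xy; apply: eP; rewrite /ball/=.
rewrite (le_lt_trans (fc _ _))// enormBC (le_lt_trans _ xy)// mulrC.
by rewrite ler_wpM2l ?enorm_ge0// (le_trans (ler_norm _))// lerDl.
Qed.

Lemma pairing_continuous n (p : 'rV[R]_n) : continuous (pairing p).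
Proof.
apply: (@continuous_lip _ _ _ (enorm p)) => x y.
by rewrite -pairingBr cauchy_schwarz_norm.
Qed.

Lemma enorm_continuous_col n : continuous (@enorm R n 1).
Proof. by apply: (@continuous_lip _ _ _ 1) => x y; rewrite mul1r enorm_lip_col. Qed.

Lemma enorm_continuous_row n : continuous (@enorm R 1 n).
Proof. by apply: (@continuous_lip _ _ _ 1) => x y; rewrite mul1r enorm_lip_row. Qed.

Lemma dist_continuous n (a : 'cV[R]_n) : continuous (fun s : 'cV[R]_n => enorm (s - a)).
Proof.
apply: (@continuous_lip _ _ _ 1) => x y; rewrite mul1r.
by rewrite (le_trans (enorm_lip_col _ _))// opprB addrA subrK.
Qed.

Lemma trmx_continuous m k : continuous (@trmx R m k).
Proof.
move=> x P /nbhs_enormP[e e0 xP]; apply/nbhs_enormP; exists e => // y xy.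
by apply: xP; rewrite -linearB/= enorm_tr.
Qed.

Lemma compact_enorm_bounded n (W : set 'cV[R]_n) : compact W ->
  exists2 D : R, 0 < D & forall s, W s -> enorm s <= D.
Proof.
move=> cW; have [[s0 Ws0]|W0] := pselect (W !=set0); last first.
  by exists 1 => // s Ws; exfalso; apply: W0; exists s.
have cn : {within W, continuous (@enorm R n 1)}.
  by apply: continuous_subspaceT; exact: enorm_continuous_col.
have [|s _ sm] := compact_EVT_max _ cW cn; first by exists s0.
exists (enorm s + 1); first by rewrite ltr_wpDl ?enorm_ge0.
by move=> s' Ws'; rewrite (le_trans (sm _ _)) ?inE// lerDl.
Qed.

(** Columns inherit the Heine-Borel property from rows through transposition. *)
Lemma compact_col n (W : set 'cV[R]_n) (D : R) :
  closed W -> (forall s, W s -> enorm s <= D) -> compact W.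
Proof.
move=> cW bW; have -> : W = trmx @` [set p : 'rV[R]_n | W p^T].
  apply/seteqP; split=> [s Ws|_ [p /= Wp <-]//].
  by exists s^T; rewrite /= trmxK.
apply: continuous_compact.
  by apply: continuous_subspaceT; exact: trmx_continuous.
apply: bounded_closed_compact; last first.
  rewrite [X in closed X](_ : _ = trmx @^-1` W)//.
  by apply: closed_comp => // x _; exact: trmx_continuous.
exists D; split; first exact: num_real.
move=> M DM p /= Wp; rewrite (le_trans (norm_le_enorm _))// -enorm_tr.
by rewrite (le_trans (bW _ Wp))// ltW.
Qed.

Lemma sphere_compact n : compact [set p : 'rV[R]_n | enorm p = 1].
Proof.
apply: bounded_closed_compact.
  exists 1; split; first exact: num_real.
  by move=> M M1 p /= p1; rewrite (le_trans (norm_le_enorm _))// p1 ltW.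
rewrite [X in closed X](_ : _ = (@enorm R 1 n) @^-1` [set 1])//.
apply: closed_comp => [x _|]; first exact: enorm_continuous_row.
exact: closed_eq.
Qed.

End Euclid.

(** * Convex bodies and support maps *)

Section Bodies.
Context {R : realType} {n : nat}.
Implicit Types (W : set 'cV[R]_n) (w : 'rV[R]_n -> 'cV[R]_n) (p : 'rV[R]_n).

Definition convex_body W : Prop :=
  compact W /\
  forall x y (l : R), W x -> W y -> 0 <= l <= 1 -> W (l *: x + (1 - l) *: y).

Definition support_map W w : Prop :=
  forall p, p != 0 ->
    [/\ W (w p), forall s, W s -> pairing p s <= pairing p (w p) &
        forall s, W s -> pairing p s = pairing p (w p) -> s = w p].

Lemma dist_sqD (x y : 'cV[R]_n) :
  enorm (x + y) ^+ 2 = enorm x ^+ 2 + 2 * pairing x^T y + enorm y ^+ 2.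
Proof.
by rewrite !enorm_sq linearD/= !(pairingDl, pairingDr) (pairing_trC y); ring.
Qed.

(** The variational inequality of the nearest point comes from moving towards
    [s] along the segment, a vanishing fraction [l] of the way. *)
Lemma nearest_point W (z : 'cV[R]_n) : convex_body W -> W !=set0 ->
  exists2 s0, W s0 & forall s, W s -> 0 <= pairing (s0 - z)^T (s - s0).
Proof.
move=> [cW vW] W0.
have cd : {within W, continuous (fun s => enorm (s - z))}.
  by apply: continuous_subspaceT; exact: dist_continuous.
have [s0 /set_mem Ws0 min0] := compact_EVT_min W0 cW cd.
exists s0 => // s Ws; rewrite leNgt; apply/negP => a0.
set a := pairing _ _ in a0; set b := enorm (s - s0) ^+ 2.
have b0 : 0 <= b by rewrite sqr_ge0.
have bp : 0 < b.
  rewrite lt_def b0 andbT; apply/eqP => bz.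
  suff ss0 : s - s0 = 0 by move: a0; rewrite /a ss0 pairing0r ltxx.
  by apply/eqP; rewrite -enorm_eq0 -sqrf_eq0 -/b bz.
pose l : R := Num.min 1 (- a / b).
have l0 : 0 < l by rewrite lt_min ltr01 divr_gt0// oppr_gt0.
have l1 : l <= 1 by rewrite ge_min lexx.
have lb : l * b <= - a by rewrite -ler_pdivlMr// ge_min lexx orbT.
have := min0 (l *: s + (1 - l) *: s0) (mem_set (vW _ _ _ Ws Ws0 _)).
rewrite ltW//= l1 => /(_ isT).
have -> : l *: s + (1 - l) *: s0 - z = (s0 - z) + l *: (s - s0).
  by apply/matrixP => i j; rewrite !mxE; ring.
rewrite -(ler_pXn2r (_ : 0 < 2)%N) ?nnegrE ?enorm_ge0//.
rewrite [leRHS]dist_sqD pairingZr enormZ exprMn real_normK ?num_real// -/a -/b.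
rewrite -addrA lerDl; nra.
Qed.

(** The direction from the nearest point to [z] separates, by the variational
    inequality at the nearest point; the gap is the distance to the body. *)
Lemma separation W (z : 'cV[R]_n) : convex_body W -> W !=set0 -> ~ W z ->
  exists2 p, enorm p = 1 &
    exists2 c : R, 0 < c & forall s, W s -> pairing p s + c <= pairing p z.
Proof.
move=> bW W0 nWz; have [s0 Ws0 h] := nearest_point z bW W0.
have zs0 : z - s0 != 0.
  by rewrite subr_eq0; apply/eqP => zs; apply: nWz; rewrite zs.
have ez : 0 < enorm (z - s0) by rewrite enorm_gt0.
exists ((enorm (z - s0))^-1 *: (z - s0)^T).
  by rewrite -(enorm_tr (z - s0)) enorm_unit// -enorm_eq0 enorm_tr enorm_eq0.
exists (enorm (z - s0)) => // s Ws.
rewrite !pairingZl -subr_ge0.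
have -> : (enorm (z - s0))^-1 * pairing (z - s0)^T z -
    ((enorm (z - s0))^-1 * pairing (z - s0)^T s + enorm (z - s0)) =
    (enorm (z - s0))^-1 * pairing (s0 - z)^T (s - s0).
  have -> : pairing (s0 - z)^T (s - s0) = pairing (z - s0)^T z - pairing (z - s0)^T s
     - enorm (z - s0) ^+ 2.
    rewrite enorm_sq -(opprB z s0) linearN /= pairingNl !pairingBr; ring.
  by field; rewrite gt_eqF.
by rewrite mulr_ge0 ?h// invr_ge0 ltW.
Qed.

(** A maximizer for a nearby [p'] that is far from [w0] would lose at least the
    gap [g] between the maximum of [p] and its maximum on the part of [W] away
    from [w0]. *)
Lemma maximizer_stable W p (w0 : 'cV[R]_n) (e : R) : compact W -> W w0 ->
  (forall s, W s -> pairing p s <= pairing p w0) ->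
  (forall s, W s -> pairing p s = pairing p w0 -> s = w0) -> 0 < e ->
  exists2 d : R, 0 < d & forall p' s', W s' ->
    (forall s, W s -> pairing p' s <= pairing p' s') ->
    enorm (p' - p) < d -> enorm (s' - w0) < e.
Proof.
move=> cW Ww0 maxp unip e0.
have [D D0 bD] := compact_enorm_bounded cW.
pose F := W `&` [set s | e <= enorm (s - w0)].
have [[s1 Fs1]|F0] := pselect (F !=set0); last first.
  exists 1 => // p' s' Ws' _ _; rewrite ltNge; apply/negP => far.
  by apply: F0; exists s'.
have cF : compact F.
  apply: compact_closedI => //.
  rewrite [X in closed X](_ : _ = (fun s : 'cV[R]_n => enorm (s - w0)) @^-1`
     [set x | e <= x])//.
  by apply: closed_comp => [x _|]; [exact: dist_continuous|exact: closed_ge].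
have cp : {within F, continuous (pairing p)}.
  by apply: continuous_subspaceT; exact: pairing_continuous.
have [s2 /set_mem[Ws2 es2] max2] :=
  compact_EVT_max (ex_intro _ s1 Fs1) cF cp.
have gap : 0 < pairing p w0 - pairing p s2.
  rewrite subr_gt0 lt_neqAle maxp// andbT; apply/eqP => /(unip _ Ws2) s2E.
  by move: es2; rewrite /= s2E subrr enorm0 leNgt e0.
set g := _ - _ in gap; exists (g / (2 * D)); first by rewrite divr_gt0// mulr_gt0.
move=> p' s' Ws' maxp' pp'; rewrite ltNge; apply/negP => far.
have := max2 _ (mem_set (conj Ws' far)).
have := maxp' _ Ww0.
have : `|pairing (p' - p) (s' - w0)| < g.
  rewrite (le_lt_trans (cauchy_schwarz_norm _ _))//.
  have : enorm (s' - w0) <= 2 * D.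
    by rewrite (le_trans (enormB_col _ _))// mulr_natl mulr2n lerD// bD.
  move=> h; rewrite (le_lt_trans (ler_wpM2l _ h)) ?enorm_ge0//.
  by rewrite -ltr_pdivlMr// mulr_gt0.
rewrite pairingBl !pairingBr /g => /(le_lt_trans (ler_norm _)); lra.
Qed.

Lemma support_continuous W w : compact W -> support_map W w ->
  forall p e, p != 0 -> 0 < e ->
  exists2 d : R, 0 < d &
    forall p', p' != 0 -> enorm (p' - p) < d -> enorm (w p' - w p) < e.
Proof.
move=> cW sW p e p0 e0; have [Wp maxp unip] := sW _ p0.
have [d d0 hd] := maximizer_stable cW Wp maxp unip e0; exists d => // p' p'0.
by have [Wp' maxp' _] := sW _ p'0; exact: hd.
Qed.

(** Compactness of the sphere makes the continuity uniform. Only [p] is a unit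
    vector: steepest ascent evaluates the map at nearby directions before it
    normalizes them. *)
Lemma support_uniform W w : compact W -> support_map W w ->
  forall e, 0 < e ->
  exists2 d : R, 0 < d &
    forall p p', enorm p = 1 -> p' != 0 -> enorm (p' - p) < d ->
      enorm (w p' - w p) < e.
Proof.
move=> cW sW e e0.
have unz p : enorm p = 1 -> p != 0.
  by move=> p1; rewrite -enorm_eq0 p1 oner_neq0.
have := @sphere_compact R n; rewrite compact_near_coveringP => /(_ R 0^'+
  (fun d p => enorm p = 1 -> forall p', p' != 0 -> enorm (p' - p) < d ->
      enorm (w p' - w p) < e)) [].
  move=> p /= p1.
  have e2 : 0 < e / 2 by rewrite divr_gt0.
  have [d d0 wd] := support_continuous cW sW (unz _ p1) e2.
  have dd : 0 < d / 2 by rewrite divr_gt0.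
  near=> q d' => q1 p' p'0 qp'.
  have qp : enorm (q - p) < d / 2.
    near: q; apply/nbhs_enormP; exists (d / 2) => //.
  have d'd : d' < d / 2 by near: d'; exact: nbhs_right_lt.
  have -> : w p' - w q = (w p' - w p) - (w q - w p).
    by rewrite opprB addrA subrK.
  rewrite (le_lt_trans (enormB_col _ _))// (splitr e) ltrD//; apply: wd => //.
  - have -> : p' - p = (p' - q) + (q - p) by rewrite addrA subrK.
    by rewrite (le_lt_trans (enormD_row _ _))// (splitr d) ltrD// (lt_trans qp').
  - exact: unz.
  - by rewrite (lt_trans qp)// ltr_pdivrMr// ltr_pMr// ltr1n.
move=> d /= d0 h; exists (d / 2); first by rewrite divr_gt0.
move=> p p' p1; apply: (h (d / 2)) => //=.
- by rewrite sub0r normrN gtr0_norm; lra.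
- by rewrite divr_gt0.
Unshelve. all: by end_near. Qed.

End Bodies.

(** * While loops *)

Section Loops.
Context {R : realType}.

Lemma while_det (S : Type) (g : S -> Prop) (b : S -> S -> Prop) x y z :
  (forall x y z, b x y -> b x z -> y = z) ->
  while g b x y -> while g b x z -> y = z.
Proof.
move=> bdet wy; elim: wy z => [{}x ngx z wz|{}x x' {}y gx bx _ IH z wz].
  by inversion wz.
inversion wz as [|? x'' ? _ bx' wz']; first by subst.
by apply: IH; rewrite (bdet _ _ _ bx bx').
Qed.

(** The measure has to drop only when the loop goes on after the pass: nothing
    can be said of the gain of a pass that ends where the guard fails. *)
Lemma while_terminates (S : Type) (g : S -> Prop) (b : S -> S -> Prop)
    (I : S -> Prop) (m : S -> R) (c : R) : 0 < c ->
  (forall x, I x -> 0 <= m x) ->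
  (forall x, I x -> g x ->
    exists2 y, b x y & I y /\ (g y -> m y + c <= m x)) ->
  forall x, I x -> exists2 y, while g b x y & I y /\ ~ g y.
Proof.
move=> c0 m0 step x Ix.
have [N] : exists N : nat, g x -> m x < N%:R * c.
  exists (Num.bound (m x / c)) => _; rewrite -ltr_pdivrMr//.
  by rewrite archi_boundP// divr_ge0 ?m0// ltW.
elim: N x Ix => [|N IH] x Ix mN.
  have [gx|ngx] := pselect (g x); last by exists x => //; exact: while_stop.
  by have := mN gx; rewrite mul0r ltNge m0.
have [gx|ngx] := pselect (g x); last by exists x => //; exact: while_stop.
have [y bxy [Iy my]] := step x Ix gx.
have [|z wz hz] := IH y Iy.
  by move=> gy; have := my gy; have := mN gx; rewrite -natr1 mulrDl; lra.
by exists z => //; exact: while_iter bxy wz.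
Qed.

End Loops.

(** * Convex hulls of finite sets *)

Section ConvexHull.
Context {R : realType} {n : nat}.
Implicit Types (W : set 'cV[R]_n) (V : {fset 'cV[R]_n}).

Lemma conv_hull1 (v : 'cV[R]_n) : conv_hull [fset v]%fset v.
Proof.
by exists (fun=> 1); split => [//||]; rewrite big_seq_fset1// scale1r.
Qed.

(** Points are added one at a time, with the partial sums renormalized to total
    weight 1; a vanishing partial weight means that all its terms vanish. *)
Lemma conv_hull_sub W V : convex_body W -> (forall v, v \in V -> W v) ->
  conv_hull V `<=` W.
Proof.
move=> [_ vW] VW s [lam [lam0 lam1 ->]].
have key (r : seq 'cV[R]_n) : (forall v, v \in r -> 0 <= lam v /\ W v) ->
    0 < \sum_(v <- r) lam v ->
    W ((\sum_(v <- r) lam v)^-1 *: \sum_(v <- r) lam v *: v).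
  elim: r => [_|v r IH hr]; first by rewrite big_nil ltxx.
  rewrite !big_cons; have [lv Wv] := hr v (mem_head _ _).
  have hr' u : u \in r -> 0 <= lam u /\ W u by move=> ur; apply: hr; rewrite inE ur orbT.
  set S := \sum_(u <- r) lam u; set T := \sum_(u <- r) lam u *: u => ST.
  have S0 : 0 <= S by rewrite /S big_seq; apply: sumr_ge0 => u /hr'[].
  have [Sz|Snz] := eqVneq S 0.
    have Tz : T = 0.
      have : S == 0 by rewrite Sz.
      rewrite /S big_seq psumr_eq0 => [/allP lamz|u /hr'[]//].
      rewrite /T big_seq big1// => u ur.
      by have := lamz _ ur; rewrite ur => /eqP ->; rewrite scale0r.
    move: ST; rewrite Sz Tz !addr0 => lvp.
    by rewrite scalerA mulVf ?gt_eqF// scale1r.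
  have Sp : 0 < S by rewrite lt_def Snz.
  have := vW v (S^-1 *: T) (lam v / (lam v + S)) Wv (IH hr' Sp).
  have lv1 : 0 <= lam v / (lam v + S) <= 1.
    by rewrite divr_ge0 ?(ltW ST)//= ler_pdivrMr// mul1r lerDl.
  move=> /(_ lv1); congr W.
  have e1 : 1 - lam v / (lam v + S) = S / (lam v + S) by field; rewrite gt_eqF.
  by rewrite e1 scalerA mulrAC mulfV// mul1r scalerDr !scalerA [_^-1 * _]mulrC.
have := key V; rewrite lam1 invr1 scale1r; apply => // v vV.
by split; [exact: lam0|exact: VW].
Qed.

(** Weights of a point of [conv_hull V'] are extended by 0 to [V]. *)
Lemma conv_hull_segment V V' v s (l : R) : (V' `<=` V)%fset -> v \in V ->
  conv_hull V' s -> 0 <= l <= 1 -> conv_hull V (l *: s + (1 - l) *: v).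
Proof.
move=> V'V vV [lam [lam0 lam1 ->]] /andP[l0 l1].
pose mu x := if x \in V' then lam x else 0.
pose nu x : R := (x == v)%:R.
have sumV (T : nmodType) (F : 'cV[R]_n -> T) :
    (forall x, x \notin V' -> F x = 0) -> \sum_(x <- V) F x = \sum_(x <- V') F x.
  by move=> F0; apply/esym/big_fset_incl => // x _ /F0.
have sumv (T : nmodType) (F : 'cV[R]_n -> T) :
    (forall x, x != v -> F x = 0) -> \sum_(x <- V) F x = F v.
  move=> F0; rewrite -(big_fset_incl _ (_ : [fset v] `<=` V)%fset) ?big_seq_fset1//.
    by rewrite fsub1set.
  by move=> x _; rewrite inE => /F0.
have eV' (T : nmodType) (F : R -> 'cV[R]_n -> T) :
    \sum_(x <- V') F (mu x) x = \sum_(x <- V') F (lam x) x.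
  by rewrite [LHS]big_seq [RHS]big_seq; apply: eq_bigr => x xV'; rewrite /mu xV'.
exists (fun x => l * mu x + (1 - l) * nu x); split.
- move=> x xV; rewrite addr_ge0// mulr_ge0 ?subr_ge0//.
  by rewrite /mu; case: ifP => // /lam0.
- rewrite big_split/= -!mulr_sumr (sumv _ nu) => [|x /negbTE]; last first.
    by rewrite /nu => ->.
  rewrite (sumV _ mu) => [|x /negbTE xV']; last by rewrite /mu xV'.
  by rewrite (eV' _ (fun a _ => a)) lam1 /nu eqxx !mulr1 subrKC.
- under [RHS]eq_bigr do rewrite scalerDl -!scalerA.
  rewrite big_split/= -!scaler_sumr.
  rewrite (sumv _ (fun x => nu x *: x)) => [|x /negbTE]; last first.
    by rewrite /nu => ->; rewrite scale0r.
  rewrite (sumV _ (fun x => mu x *: x)) => [|x /negbTE xV']; last first.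
    by rewrite /mu xV' scale0r.
  by rewrite (eV' _ (fun a x => a *: x)) /nu eqxx scale1r.
Qed.

End ConvexHull.

(** * Distance estimates at a fixed time, and GJK *)

Section FixedTime.
Context {R : realType} {n : nat}.
Variables (Q G : R -> set 'cV[R]_n) (t : R) (W : set 'cV[R]_n).
Local Notation w := (wpoint Q G t).
Hypotheses (bW : convex_body W) (sW : support_map W w).
Implicit Types (p : 'rV[R]_n) (s : 'cV[R]_n).

Lemma rho_lowerE p : rho_lower Q G t p = - ((enorm p)^-1 * pairing p (w p)).
Proof. by rewrite /rho_lower /wpoint pairingZl -mulrN -pairingNr opprB. Qed.

Lemma rho_lower_unit p : enorm p = 1 -> rho_lower Q G t p = - pairing p (w p).
Proof. by move=> p1; rewrite rho_lowerE p1 invr1 mul1r. Qed.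

Lemma rho_upperE p : rho_upper Q G t p = enorm (w p).
Proof. by rewrite /rho_upper /wpoint enormBC. Qed.

Lemma unit_neq0 p : enorm p = 1 -> p != 0.
Proof. by move=> p1; rewrite -enorm_eq0 p1 oner_neq0. Qed.

Lemma enorm_dir s : s != 0 -> enorm (dir s) = 1.
Proof. by move=> s0; rewrite /dir enormN -linearZ/= enorm_tr enorm_unit. Qed.

Lemma dir_neq0 s : s != 0 -> dir s != 0.
Proof. by move=> /enorm_dir/unit_neq0. Qed.

Lemma pairing_dir s s' : pairing (dir s) s' = - ((enorm s)^-1 * pairing s^T s').
Proof. by rewrite /dir pairingNl pairingZl. Qed.

(** [rho_lower] is the signed distance to a half-space that contains [W]. *)
Lemma rho_lower_le s p : W s -> p != 0 -> rho_lower Q G t p <= enorm s.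
Proof.
move=> Ws p0; have [_ maxp _] := sW p0.
have pp : 0 < enorm p by rewrite enorm_gt0.
rewrite rho_lowerE -mulrN mulrC ler_pdivrMr//.
have := maxp _ Ws; have := cauchy_schwarz_norm p s.
by rewrite ler_norml => /andP[]; rewrite mulrC; lra.
Qed.

Lemma rho_lower_le_upper p : p != 0 -> rho_lower Q G t p <= rho_upper Q G t p.
Proof. by move=> p0; rewrite rho_upperE rho_lower_le//; have [] := sW p0. Qed.

Lemma dir_support s s' : s != 0 -> W s' ->
  pairing s^T (w (dir s)) <= pairing s^T s'.
Proof.
move=> s0 Ws'; have [_ /(_ _ Ws') + _] := sW (dir_neq0 s0).
by rewrite !pairing_dir lerN2 ler_pM2l// invr_gt0 enorm_gt0.
Qed.

(** With [a = s^T (s - v)] and [b = |s - v|^2], the squared norm at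
    [s - l (s - v)] is [|s|^2 - 2 l a + l^2 b]; the update takes the best [l] in
    [[0, 1]], which is [min 1 (a / b)]. *)
Lemma drop_conv s v (c B : R) : 0 < c -> 0 < B ->
  c <= pairing s^T (s - v) -> enorm (s - v) ^+ 2 <= B ->
  enorm (gilbert_update s (s - v)) ^+ 2 + Num.min c (c ^+ 2 / B) <= enorm s ^+ 2.
Proof.
move=> c0 B0; rewrite /gilbert_update.
set a := pairing _ _; set b := enorm _ ^+ 2 => ca bB.
have b0 : 0 < b.
  rewrite lt_def sqr_ge0 andbT; apply/eqP => /eqP; rewrite sqrf_eq0 enorm_eq0.
  by move=> /eqP sv; move: ca; rewrite /a sv pairing0r leNgt c0.
have E (l : R) : enorm (s - l *: (s - v)) ^+ 2 = enorm s ^+ 2 - 2 * l * a + l ^+ 2 * b.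
  rewrite dist_sqD pairingNr pairingZr enormN enormZ exprMn.
  by rewrite real_normK ?num_real// -/a -/b; ring.
rewrite E; have [ab|ab] := leP 1 (a / b).
  have : b <= a by rewrite ler_pdivlMr// mul1r in ab.
  by have : Num.min c (c ^+ 2 / B) <= c by [rewrite ge_min lexx]; lra.
have -> : enorm s ^+ 2 - 2 * (a / b) * a + (a / b) ^+ 2 * b = enorm s ^+ 2 - a ^+ 2 / b.
  by field; rewrite gt_eqF.
have : Num.min c (c ^+ 2 / B) <= c ^+ 2 / B by rewrite ge_min lexx orbT.
suff : c ^+ 2 / B <= a ^+ 2 / b by lra.
apply: ler_pM; rewrite ?sqr_ge0 ?invr_ge0 ?(ltW B0)//.
  by rewrite ler_pXn2r ?nnegrE ?(ltW c0)// (le_trans (ltW c0)).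
by rewrite lef_pV2.
Qed.

Lemma gilbert_update_conv s v : 0 <= pairing s^T (s - v) ->
  exists2 l : R, 0 <= l <= 1 &
    gilbert_update s (s - v) = l *: s + (1 - l) *: v.
Proof.
move=> a0; pose l := Num.min 1 (pairing s^T (s - v) / enorm (s - v) ^+ 2).
exists (1 - l).
  rewrite subr_ge0 ge_min lexx/= lerBlDr lerDl le_min ler01/=.
  by rewrite divr_ge0// sqr_ge0.
by rewrite /gilbert_update -/l; apply/matrixP => i j; rewrite !mxE; ring.
Qed.

(** A Frank-Wolfe step from [s] gains an amount that depends on the gap [c]
    only, since the diameter of the body bounds [s - v]. To prove termination it
    is then enough to bound the gap below. *)
Lemma body_drop : exists2 B : R, 0 < B & forall c s v, 0 < c -> W s -> W v ->
  c <= pairing s^T (s - v) ->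
  enorm (gilbert_update s (s - v)) ^+ 2 + Num.min c (c ^+ 2 / B) <= enorm s ^+ 2.
Proof.
have [D D0 bD] := compact_enorm_bounded bW.1.
exists ((2 * D) ^+ 2); first by rewrite exprn_gt0// mulr_gt0.
move=> c s v c0 Ws Wv cs; apply: drop_conv => //.
  by rewrite exprn_gt0// mulr_gt0.
have D2 : 0 <= 2 * D by rewrite mulr_ge0// ltW.
rewrite ler_pXn2r ?nnegrE ?enorm_ge0//.
by rewrite (le_trans (enormB_col _ _))// mulr_natl mulr2n lerD// bD.
Qed.

(** The hull contains the segment from [s] to [v], so its point of minimal norm
    is at least as good as the result of a line search on this segment. *)
Lemma johnson_drop J (V V' : {fset 'cV[R]_n}) s v : johnson_spec J ->
  (V' `<=` V)%fset -> v \in V -> (#|` V| <= n.+1)%N ->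
  conv_hull V' s -> 0 <= pairing s^T (s - v) ->
  enorm (J V).1 <= enorm (gilbert_update s (s - v)).
Proof.
move=> hJ V'V vV cV hs a0; have [l l01 ->] := gilbert_update_conv a0.
have [|_ + _ _ _] := hJ V _ cV.
  by apply/fset0Pn; exists v.
by apply; apply: conv_hull_segment hs l01.
Qed.

(** A pass that starts with [|s|] and the lower estimate more than [eps] apart
    has a gap of at least [eps^2], hence a uniform drop. The invariant counts the
    vertices: after a pass with [|s| > eps] the hull does not contain [0] and at
    most [n] vertices are kept, so that adding one stays within the [n + 1] that
    [johnson_spec] covers. *)
Lemma GJK_terminates J eps p : johnson_spec J -> 0 < eps -> enorm p = 1 ->
  exists2 s, GJK Q G J eps t p s &
    W s /\ (eps < enorm s -> enorm s - rho_lower Q G t (- s^T) <= eps).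
Proof.
move=> hJ e0 p1; have [B B0 drop] := body_drop.
pose g (x : 'cV[R]_n * {fset 'cV[R]_n}) :=
  enorm x.1 > eps /\ enorm x.1 - rho_lower Q G t (- x.1^T) > eps.
have n0 : (0 < n)%N.
  case: (n) p p1 => // q q1; suff q0 : q = 0 by move: q1; rewrite q0 enorm0 => /esym/eqP; rewrite oner_eq0.
  by apply/matrixP => i [].
pose I (x : 'cV[R]_n * {fset 'cV[R]_n}) := [/\ forall v, v \in x.2 -> W v,
  conv_hull x.2 x.1 & eps < enorm x.1 -> (#|` x.2| <= n)%N].
pose c := eps ^+ 2; have c0 : 0 < c by rewrite exprn_gt0.
have [||| |[s V] ws [Is ngs]] := @while_terminates R _ g
  (fun x y => y = J (wpoint Q G t (- x.1^T) |` x.2)%fset) I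
  (fun x => enorm x.1 ^+ 2) (Num.min c (c ^+ 2 / B)) _ _ _ (w p, [fset w p]%fset).
- by rewrite lt_min c0 divr_gt0// exprn_gt0.
- by move=> x _; rewrite sqr_ge0.
- move=> [s V] [/= VW hs cV] [/= es es']; exists (J (w (- s^T) |` V)%fset) => //.
  have s0 : s != 0 by rewrite -enorm_gt0 (lt_trans e0).
  have sT0 : - s^T != 0 by rewrite oppr_eq0 -enorm_eq0 enorm_tr enorm_eq0.
  have [Ww _ _] := sW sT0.
  have V1W v : v \in (w (- s^T) |` V)%fset -> W v.
    by rewrite in_fset1U => /orP[/eqP ->//|/VW].
  have cV1 : (#|` (w (- s^T) |` V)%fset| <= n.+1)%N.
    rewrite cardfsU1 (leq_trans (leq_add (leq_b1 _) (cV es)))//.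
  have V10 : (w (- s^T) |` V)%fset != fset0.
    by apply/fset0Pn; exists (w (- s^T)); rewrite fset1U1.
  have [h1 h2 h3 h4 h5] := hJ _ V10 cV1.
  have Ws : W s by exact: (conv_hull_sub bW VW).
  split.
    split => [v /(fsubsetP h3)/V1W//|//|eJ]; apply: h5 => hz.
    by have := h2 _ hz; rewrite enorm0 leNgt (lt_trans e0).
  move=> _; have cs : c <= pairing s^T (s - w (- s^T)).
    move: es'; rewrite rho_lowerE enormN enorm_tr pairingNl mulrN opprK.
    rewrite pairingBr -enorm_sq /c => es'.
    have sp : 0 < enorm s by rewrite enorm_gt0.
    rewrite -(ler_pM2l (_ : 0 < (enorm s)^-1)) ?invr_gt0// mulrBr.
    rewrite (expr2 (enorm s)) mulKf ?gt_eqF// (le_trans _ (ltW es'))//.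
    by rewrite ler_pdivrMl// expr2 ler_pM2r// ltW.
  apply: le_trans (drop c s (w (- s^T)) c0 Ws Ww cs); rewrite lerD2r.
  rewrite ler_pXn2r ?nnegrE ?enorm_ge0//.
  apply: (johnson_drop hJ _ _ cV1 hs); rewrite ?fset1U1 ?fsubsetU1//.
  exact: le_trans (ltW c0) cs.
- have [Ww _ _] := sW (unit_neq0 p1); split=> /= [v||_].
  + by rewrite inE => /eqP ->.
  + exact: conv_hull1.
  + by rewrite cardfs1.
exists s; first by exists V.
split; first by have [/= VW hs _] := Is; exact: (conv_hull_sub bW VW).
move=> es; rewrite leNgt; apply/negP => es'; exact: ngs.
Qed.

End FixedTime.

(** * Termination of the distance algorithms *)

Section DistanceAlgorithms.
Context {R : realType} {n : nat}.
Variables (Q G : R -> set 'cV[R]_n) (t : R) (W : set 'cV[R]_n) (alpha : R).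
Local Notation w := (wpoint Q G t).
Hypotheses (bW : convex_body W) (sW : support_map W w) (W0 : ~ W 0).
Hypothesis (alpha0 : 0 < alpha).
Implicit Types (p : 'rV[R]_n) (s : 'cV[R]_n).

Lemma body_neq0 s : W s -> s != 0.
Proof. by move=> Ws; apply/eqP => s0; apply: W0; rewrite -s0. Qed.

Lemma da_guardE p : enorm p = 1 ->
  da_guard Q G alpha t p <-> 0 < enorm (w p) + (1 + alpha) * pairing p (w p).
Proof.
move=> p1; rewrite /da_guard /delta rho_upperE rho_lower_unit//.
by split; lra.
Qed.

Lemma dir_lip s s' (d : R) : 0 < d -> d <= enorm s -> s' != 0 ->
  enorm (dir s - dir s') <= 2 / d * enorm (s - s').
Proof.
move=> d0 ds s'0; have s0 : 0 < enorm s by exact: lt_le_trans ds.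
have -> : dir s - dir s' = ((enorm s)^-1 *: (s' - s))^T
    + (((enorm s - enorm s') / enorm s / enorm s') *: s')^T.
  have s'p : enorm s' != 0 by rewrite enorm_eq0.
  apply/matrixP => i j; rewrite !mxE; field.
  by rewrite (gt_eqF s0) s'p.
rewrite (le_trans (enormD_row _ _))// !enorm_tr !enormZ enormBC !normrM !normfV.
have s'p : enorm s' != 0 by rewrite enorm_eq0.
rewrite !(ger0_norm (enorm_ge0 _)) divfK// [_^-1 * _]mulrC -mulrDl [leRHS]mulrAC.
apply: ler_pM; rewrite ?addr_ge0 ?enorm_ge0 ?invr_ge0 ?enorm_ge0//.
  by have := enorm_lip_col s s'; lra.
by rewrite lef_pV2.
Qed.

(** Far from the point of minimal norm the gap [<s, s - w>] is large; near it
    the guard is false, by continuity of the support map. *)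
Lemma guard_gap : W !=set0 -> exists2 c : R, 0 < c & forall s, W s ->
  da_guard Q G alpha t (dir s) -> c <= pairing s^T (s - w (dir s)).
Proof.
move=> Wn0; have [s0 Ws0 h0] := nearest_point 0 bW Wn0.
rewrite subr0 in h0.
have s0n0 := body_neq0 Ws0.
set d := enorm s0; have d0 : 0 < d by rewrite enorm_gt0.
have ds s : W s -> d <= enorm s.
  move=> Ws; have := h0 _ Ws; rewrite pairingBr -enorm_sq subr_ge0 => h.
  have := le_trans h (cauchy_schwarz _ _).
  by rewrite enorm_tr expr2 ler_pM2l.
have p0n := enorm_dir s0n0; have p0n0 := unit_neq0 p0n.
set p0 := dir s0 in p0n p0n0.
have wp0 : w p0 = s0.
  have [Ww maxp unip] := sW p0n0; apply/esym/unip => //.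
  apply/eqP; rewrite eq_le maxp//= !pairing_dir lerN2 ler_pM2l ?invr_gt0//.
  by have := h0 _ Ww; rewrite pairingBr subr_ge0.
have pp0 : pairing p0 s0 = - d.
  by rewrite pairing_dir -enorm_sq expr2 mulKf// gt_eqF.
have [D D0 bD] := compact_enorm_bounded bW.1.
(* The guard is false at [p] when [|w p| <= d + e] and [p (w p) <= - d + 2 e],
   provided that [(d + e) + (1 + alpha) (2 e - d) <= 0]. *)
pose e := alpha * d / (4 + 2 * alpha).
have a0 := alpha0; have a4 : 0 < 4 + 2 * alpha by lra.
have e0 : 0 < e by rewrite divr_gt0// mulr_gt0.
have [d1 d10 wc] := support_continuous bW.1 sW p0n0 e0.
pose r := d / 2 * Num.min d1 (e / D).
have r0 : 0 < r by rewrite mulr_gt0 ?divr_gt0// lt_min d10 divr_gt0.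
have far s : W s -> da_guard Q G alpha t (dir s) -> r <= enorm (s - s0).
  move=> Ws; rewrite leNgt => gs; apply/negP => ssr.
  have sn0 := body_neq0 Ws; have p1 := enorm_dir sn0.
  set p := dir s in p1 gs *.
  have pp : enorm (p - p0) < Num.min d1 (e / D).
    rewrite (le_lt_trans (dir_lip d0 (ds _ Ws) s0n0))//.
    by rewrite -ltr_pdivlMl ?divr_gt0// invf_div.
  move: pp; rewrite lt_min => /andP[/(wc _ (unit_neq0 p1)) ww].
  rewrite wp0 in ww; rewrite ltr_pdivlMr// => pD.
  have [Ww _ _] := sW (unit_neq0 p1).
  move/(da_guardE p1): gs; apply/negP; rewrite -leNgt.
  have h1 : enorm (w p) <= d + e.
    by have := enorm_lip_col (w p) s0; rewrite ler_norml => /andP[_]; rewrite -/d; lra.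
  have h2 : pairing p (w p) <= - d + 2 * e.
    have -> : pairing p (w p) = pairing p0 s0 + pairing p0 (w p - s0) +
        pairing (p - p0) (w p).
      by rewrite pairingBr pairingBl; ring.
    rewrite pp0; have := cauchy_schwarz p0 (w p - s0); rewrite p0n mul1r.
    have := cauchy_schwarz (p - p0) (w p).
    have := ler_wpM2l (enorm_ge0 (p - p0)) (bD _ Ww); lra.
  have : (1 + alpha) * pairing p (w p) <= (1 + alpha) * (- d + 2 * e).
    by rewrite ler_pM2l//; lra.
  have eE : (4 + 2 * alpha) * e = alpha * d.
    by rewrite /e mulrC divfK// gt_eqF//; lra.
  by lra.
exists (r ^+ 2); first by rewrite exprn_gt0.
move=> s Ws gs; have sn0 := body_neq0 Ws.
have rs : r ^+ 2 <= enorm (s - s0) ^+ 2.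
  by rewrite ler_pXn2r ?nnegrE ?enorm_ge0 ?(ltW r0)//; exact: far.
have := dir_support sW sn0 Ws0; rewrite pairingBr.
have d2 : pairing s0^T s0 = d ^+ 2 by rewrite -enorm_sq.
have := h0 _ Ws; rewrite pairingBr d2.
move: rs; rewrite dist_sqD enormN -/d pairingNr -enorm_sq (pairing_trC s0); lra.
Qed.

(** A drop at [s] is to be expected only when the guard holds at [dir s], that
    is, when the loop goes on after the pass that produces this direction. *)
Lemma guard_drop : W !=set0 -> exists2 c : R, 0 < c & forall s, W s ->
  da_guard Q G alpha t (dir s) ->
  0 <= pairing s^T (s - w (dir s)) /\
  enorm (gilbert_update s (s - w (dir s))) ^+ 2 + c <= enorm s ^+ 2.
Proof.
move=> Wn0; have [c c0 hc] := guard_gap Wn0; have [B B0 drop] := body_drop bW.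
exists (Num.min c (c ^+ 2 / B)).
  by rewrite lt_min c0 divr_gt0// exprn_gt0.
move=> s Ws gs; have cs := hc _ Ws gs; split; first exact: le_trans (ltW c0) cs.
by apply: drop => //; have [] := sW (dir_neq0 (body_neq0 Ws)).
Qed.

Lemma gap_ge0 s : W s -> 0 <= pairing s^T (s - w (dir s)).
Proof.
move=> Ws; have s0 := body_neq0 Ws.
by rewrite pairingBr subr_ge0 (dir_support sW).
Qed.

Lemma Gilbert_terminates p : enorm p = 1 ->
  exists2 p', Gilbert Q G alpha t p p' &
    enorm p' = 1 /\ ~ da_guard Q G alpha t p'.
Proof.
move=> p1; have [Ww _ _] := sW (unit_neq0 p1).
have [c c0 hc] := guard_drop (ex_intro _ _ Ww).
have [||| |[p' s'] wp' [[p'1 _] ngp']] := @while_terminates R _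
  (fun x => da_guard Q G alpha t x.1)
  (fun x y => y = (dir x.2, gilbert_update x.2 (x.2 - w (dir x.2))))
  (fun x => enorm x.1 = 1 /\ W x.2)
  (fun x => enorm x.2 ^+ 2) c _ _ _ (p, w p) => //.
- by move=> x _; rewrite sqr_ge0.
- move=> [q s] [/= q1 Ws] _.
  exists (dir s, gilbert_update s (s - w (dir s))) => //=; split; last first.
    by move=> /(hc _ Ws)[].
  split; first by rewrite enorm_dir// body_neq0.
  have [l l01 ->] := gilbert_update_conv (gap_ge0 Ws).
  have [Ww' _ _] := sW (dir_neq0 (body_neq0 Ws)).
  exact: bW.2.
by exists p' => //; exists s'.
Qed.

Lemma GJKstar_terminates J p : johnson_spec J -> enorm p = 1 ->
  exists2 p', GJKstar Q G J alpha t p p' &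
    enorm p' = 1 /\ ~ da_guard Q G alpha t p'.
Proof.
move=> hJ p1; have [Ww _ _] := sW (unit_neq0 p1).
have [c c0 hc] := guard_drop (ex_intro _ _ Ww).
have [||| |[p' V'] wp' [[p'1 _] ngp']] := @while_terminates R _
  (fun x => da_guard Q G alpha t x.1)
  (fun x y => let sV := J x.2 in
         y = (dir sV.1, (wpoint Q G t (dir sV.1) |` sV.2)%fset))
  (fun x => enorm x.1 = 1 /\ [/\ forall v, v \in x.2 -> W v, x.2 != fset0 &
     (#|` x.2| <= n.+1)%N])
  (fun x => enorm (J x.2).1 ^+ 2) c _ _ _ (p, [fset w p]%fset) => //.
- by move=> x _; rewrite sqr_ge0.
- move=> [q V] [/= q1 [VW V0 cV]] _.
  have [h1 h2 h3 h4 h5] := hJ _ V0 cV.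
  set s := (J V).1 in h1 h2 h4 h5 *; set V2 := (J V).2 in h3 h4 h5 *.
  have Ws : W s by exact: (conv_hull_sub bW VW).
  have [Wd _ _] := sW (dir_neq0 (body_neq0 Ws)).
  have cV2 : (#|` V2| <= n)%N by apply: h5 => /(conv_hull_sub bW VW).
  have cV3 : (#|` (w (dir s) |` V2)%fset| <= n.+1)%N.
    by rewrite cardfsU1 (leq_trans (leq_add (leq_b1 _) cV2)).
  exists (dir s, (w (dir s) |` V2)%fset) => //=; split.
    split; first by rewrite enorm_dir// body_neq0.
    split=> // [v|].
      by rewrite in_fset1U => /orP[/eqP ->//|/(fsubsetP h3)/VW].
    by apply/fset0Pn; exists (w (dir s)); rewrite fset1U1.
  move=> /(hc _ Ws)[a0]; apply: le_trans; rewrite lerD2r.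
  rewrite ler_pXn2r ?nnegrE ?enorm_ge0//.
  by apply: (johnson_drop hJ _ _ cV3 h4); rewrite ?fset1U1 ?fsubsetU1.
- split=> //; split=> [v||].
  + by rewrite inE => /eqP ->.
  + by apply/fset0Pn; exists (w p); rewrite inE.
  + by rewrite cardfs1.
by exists p' => //; exists V'.
Qed.

Lemma min_norm : W !=set0 -> exists2 d : R, 0 < d & forall s, W s -> d <= enorm s.
Proof.
move=> Wn0; have [p p1 [d d0 hd]] := separation bW Wn0 W0.
exists d => // s Ws; have := hd _ Ws; rewrite pairing0r.
by have := cauchy_schwarz_norm p s; rewrite p1 mul1r ler_norml => /andP[]; lra.
Qed.

(** The support function is convex with subgradient [w p] at [p], so its
    opposite lies below the tangent. *)
Lemma support_tangent p p' : p != 0 -> p' != 0 ->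
  - pairing p' (w p') <= - pairing p' (w p).
Proof.
move=> p0 p'0; rewrite lerN2; have [_ + _] := sW p'0; apply.
by have [] := sW p0.
Qed.

Section Ascent.
Variable p : 'rV[R]_n.
Hypotheses (p1 : enorm p = 1) (rp : 0 <= rho_lower Q G t p).
Local Notation q := (qdir Q G t p).
Local Notation dl := (delta Q G t p).

Lemma qdirE : q = - (p + (enorm (w p))^-1 *: (w p)^T).
Proof.
have dE : contact (G t) (- p) - contact (Q t) p = - w p by rewrite /wpoint opprB.
rewrite /qdir dE /= enormN; apply/matrixP => i j; rewrite !mxE; ring.
Qed.

Lemma w_neq0 : w p != 0.
Proof. by have [Ww _ _] := sW (unit_neq0 p1); exact: body_neq0. Qed.

Lemma qdir_le2 : enorm q <= 2.
Proof.
rewrite qdirE enormN (le_trans (enormD_row _ _))// p1.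
by rewrite -linearZ/= enorm_tr enorm_unit ?w_neq0// ler1n.
Qed.

(** The slope at [g = 0] of the concave function [g |-> - p_g (w p_g)] along the
    search ray [p_g = p + g q]; up to the normalization of [p_g], this function
    is [rho_lower]. *)
Lemma pairing_qdir : - pairing q (w p) = dl.
Proof.
rewrite qdirE /delta rho_upperE rho_lower_unit// pairingNl opprK pairingDl.
by rewrite pairingZl -enorm_sq expr2 mulKf ?enorm_eq0 ?w_neq0// opprK addrC.
Qed.

Lemma ray_pairing (g : R) :
  - pairing (p + g *: q) (w p) = rho_lower Q G t p + g * dl.
Proof. by rewrite rho_lower_unit// -pairing_qdir pairingDl pairingZl; ring. Qed.

Lemma ray_neq0 (g : R) : 0 < dl -> 0 < g -> p + g *: q != 0.
Proof.
move=> d0 g0; apply/eqP => pq; have := ray_pairing g.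
by rewrite pq pairing0l oppr0; have := mulr_gt0 g0 d0; have := rp; lra.
Qed.

Lemma ray_le1 (g : R) : 0 <= g <= 1 -> enorm (p + g *: q) <= 1.
Proof.
move=> /andP[g0 g1].
have -> : p + g *: q = (1 - g) *: p + g *: (- (enorm (w p))^-1 *: (w p)^T).
  by rewrite qdirE; apply/matrixP => i j; rewrite !mxE; ring.
rewrite (le_trans (enormD_row _ _))// !enormZ normrN !ger0_norm ?subr_ge0//.
  by rewrite p1 enorm_tr mulVf ?enorm_eq0 ?w_neq0//; lra.
by rewrite invr_ge0 enorm_ge0.
Qed.

Lemma xi'E (g : R) : xi' Q G g t p = - pairing q (w (p + g *: q)).
Proof. by rewrite /xi' -pairingNr opprB. Qed.

Lemma concave_gain (r a1 x y z g1 g c : R) : 0 < g1 -> g1 <= g -> c <= z ->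
  0 <= y -> a1 <= x + (g1 - g) * y -> r <= a1 - g1 * z -> r + g1 * c <= x.
Proof. nra. Qed.

(** Along the ray [p_g = p + g q], the tangents at the small step [g1] and at the
    accepted step [g] bound the concave function [g |-> - p_g (w p_g)]. Its value
    is nonnegative and [|p_g| <= 1], so that normalizing can only increase it. *)
Lemma ascent_gain (g1 g c : R) : 0 < dl -> 0 < g1 <= g -> g <= 1 -> 0 <= c ->
  c <= xi' Q G g1 t p -> 0 <= xi' Q G g t p ->
  rho_lower Q G t p + g1 * c <=
    rho_lower Q G t ((enorm (p + g *: q))^-1 *: (p + g *: q)).
Proof.
move=> d0 /andP[g10 g1g] g1' c0; rewrite !xi'E.
have g0 : 0 < g by exact: lt_le_trans g1g.
have := ray_le1 (_ : 0 <= g <= 1); rewrite ltW//= => /(_ g1').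
have := ray_neq0 d0 g10; have := ray_neq0 d0 g0.
move: (qdir Q G t p) => r; set p' := p + g *: r => p'0 p10 ep'1 cxi xi0.
have T1 := support_tangent p'0 p10.
have T2 := support_tangent p10 (unit_neq0 p1).
rewrite -(rho_lower_unit Q G t p1) in T2.
have e1 : - pairing (p + g1 *: r) (w p') =
    - pairing p' (w p') + (g1 - g) * - pairing r (w p').
  by rewrite /p' !(pairingDl p) !pairingZl; ring.
have e2 : - pairing p (w (p + g1 *: r)) =
    - pairing (p + g1 *: r) (w (p + g1 *: r)) - g1 * - pairing r (w (p + g1 *: r)).
  by rewrite (pairingDl p) pairingZl; ring.
rewrite e1 in T1; rewrite e2 in T2.
have x0 := concave_gain g10 g1g cxi xi0 T1 T2.
apply: (le_trans x0).
have ep' : 0 < enorm p' by rewrite enorm_gt0.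
have x1 : 0 <= - pairing p' (w p').
  by apply: (le_trans _ x0); rewrite addr_ge0 ?rp// mulr_ge0// ltW.
have p''1 : enorm ((enorm p')^-1 *: p') = 1 by exact: enorm_unit.
set p'' := _ *: p' in p''1 *.
rewrite (rho_lower_unit Q G t p''1); apply: (@le_trans _ _ (- pairing p'' (w p'))).
  by rewrite pairingZl -mulrN ler_peMl// invf_ge1.
rewrite lerN2 !pairingZl ler_pM2l ?invr_gt0//.
have [_ + _] := sW p'0; apply.
by have [] := sW (unit_neq0 p''1).
Qed.

End Ascent.

(** [rho_lower] is bounded and every pass increases it by a fixed amount. While
    the guard holds, [delta], the slope at the origin of the ray, is at least
    [c]: either [rho_lower] is at least half of a lower bound [d] of the distance
    and [delta > alpha * rho_lower], or [rho_upper - rho_lower] is itself at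
    least [d / 2]. By uniform continuity of the support map the slope is at least
    [c / 2] at all steps up to some [g0], so the halving never goes below
    [g0 / 2] and each pass gains at least [g0 / 2 * (c / 2)]. *)
Lemma SteepestAscent_terminates p : enorm p = 1 -> 0 <= rho_lower Q G t p ->
  exists2 p', SteepestAscent Q G alpha t 1 p p' &
    enorm p' = 1 /\ ~ da_guard Q G alpha t p'.
Proof.
move=> p1 rp; have a0 := alpha0.
have [Ww _ _] := sW (unit_neq0 p1).
have Wn0 : W !=set0 by exists (w p).
have [d d0 hd] := min_norm Wn0.
have [D D0 bD] := compact_enorm_bounded bW.1.
pose c := Num.min (d / 2) (alpha * (d / 2)).
have d2 : 0 < d / 2 by rewrite divr_gt0.
have c0 : 0 < c by rewrite lt_min d2 mulr_gt0.
have hc r : enorm r = 1 -> 0 <= rho_lower Q G t r -> da_guard Q G alpha t r ->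
    c <= delta Q G t r.
  move=> r1 rr; rewrite /da_guard => gr.
  have [rd|rd] := leP (d / 2) (rho_lower Q G t r).
    rewrite (le_trans _ (ltW gr))// (@le_trans _ _ (alpha * (d / 2)))//.
      by rewrite ge_min lexx orbT.
    by rewrite ler_pM2l.
  rewrite (@le_trans _ _ (d / 2))//; first by rewrite ge_min lexx.
  have [Wr _ _] := sW (unit_neq0 r1).
  by rewrite /delta rho_upperE; have := hd _ Wr; lra.
have c4 : 0 < c / 4 by rewrite divr_gt0.
have [dm dm0 hm] := support_uniform bW.1 sW c4.
pose g0 := Num.min 1 (dm / 4).
have g00 : 0 < g0 by rewrite lt_min ltr01 divr_gt0.
have g01 : g0 <= 1 by rewrite ge_min lexx.
have hxi r (g : R) : enorm r = 1 -> 0 <= rho_lower Q G t r ->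
    da_guard Q G alpha t r -> 0 < g <= g0 -> c / 2 <= xi' Q G g t r.
  move=> r1 rr gr /andP[gp gg]; have cr := hc _ r1 rr gr.
  have rq0 := ray_neq0 r1 rr (lt_le_trans c0 cr) gp.
  have near : enorm (r + g *: qdir Q G t r - r) < dm.
    rewrite addrAC subrr add0r enormZ gtr0_norm//.
    have : g <= dm / 4 by apply: le_trans gg _; rewrite ge_min lexx orbT.
    have := ler_wpM2l (ltW gp) (qdir_le2 r1); have := dm0; lra.
  have ww := hm _ _ r1 rq0 near; rewrite xi'E.
  set w' := w (r + _) in ww *.
  have -> : - pairing (qdir Q G t r) w' =
      delta Q G t r - pairing (qdir Q G t r) (w' - w r).
    by rewrite -pairing_qdir// pairingBr; ring.
  have := cauchy_schwarz (qdir Q G t r) (w' - w r).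
  have := ler_pM (enorm_ge0 _) (enorm_ge0 _) (qdir_le2 r1) (ltW ww); lra.
pose I (x : 'rV[R]_n * R) := [/\ enorm x.1 = 1, 0 <= rho_lower Q G t x.1 &
  g0 / 2 <= x.2 <= 1].
have [||| |[p' g'] wp' [[p'1 _ _] ngp']] := @while_terminates R _
  (fun x => da_guard Q G alpha t x.1)
  (fun x y =>
     while (fun c => xi' Q G c t x.1 < 0) (fun c c' => c' = c / 2) x.2 y.2 /\
     let p' := x.1 + y.2 *: qdir Q G t x.1 in
     y.1 = (enorm p')^-1 *: p') I
  (fun x => D - rho_lower Q G t x.1) (g0 / 2 * (c / 2)) _ _ _ (p, 1).
- by rewrite mulr_gt0 ?divr_gt0.
- move=> [r g] [/= r1 _ _]; rewrite subr_ge0.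
  by have [Wr _ _] := sW (unit_neq0 r1); rewrite (le_trans (rho_lower_le sW Wr (unit_neq0 r1)))// bD.
- move=> [r g] [/= r1 rr /andP[gl gu]] gr.
  have [||| |g' wg' [/andP[g'l g'u] ng']] := @while_terminates R _
    (fun c => xi' Q G c t r < 0) (fun c c' => c' = c / 2)
    (fun c => g0 / 2 <= c <= 1) id (g0 / 2) _ _ _ g.
  + by rewrite divr_gt0.
  + by move=> x /andP[+ _]; apply: le_trans; rewrite ltW// divr_gt0.
  + move=> x /andP[xl xu] xi0; exists (x / 2) => //.
    have x0 : 0 < x by rewrite (lt_le_trans _ xl)// divr_gt0.
    have xg0 : g0 < x.
      rewrite ltNge; apply/negP => xg; move: xi0; rewrite ltNge => /negP; apply.
      by rewrite (le_trans _ (hxi _ _ r1 rr gr _)) ?divr_ge0 ?(ltW c0)// x0.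
    by split; [apply/andP; split|move=> _]; lra.
  + by rewrite gl.
  have cd := lt_le_trans c0 (hc _ r1 rr gr).
  have g2 : 0 < g0 / 2 by rewrite divr_gt0.
  have g'0 : 0 < g' by exact: lt_le_trans g2 g'l.
  have gain : rho_lower Q G t r + g0 / 2 * (c / 2) <=
      rho_lower Q G t ((enorm (r + g' *: qdir Q G t r))^-1 *: (r + g' *: qdir Q G t r)).
    apply: ascent_gain => //.
    - by rewrite g2.
    - by rewrite divr_ge0// ltW.
    - by apply: hxi => //; rewrite g2/=; lra.
    - by rewrite leNgt; apply/negP.
  exists ((enorm (r + g' *: qdir Q G t r))^-1 *: (r + g' *: qdir Q G t r), g') => //=.
  split; last by move=> _; lra.
  split => /=; first by rewrite enorm_unit// ray_neq0.
  - by rewrite (le_trans _ gain)// addr_ge0// mulr_ge0// ltW// divr_gt0.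
  - by rewrite g'l.
- by split => //=; apply/andP; split=> //; lra.
by exists p' => //; exists g'.
Qed.

Lemma run_DA_terminates da J p : johnson_spec J -> enorm p = 1 ->
  0 <= rho_lower Q G t p ->
  exists2 p', run_DA da Q G J alpha t 1 p p' &
    enorm p' = 1 /\ ~ da_guard Q G alpha t p'.
Proof.
move=> hJ p1 rp; case: da.
- exact: GJKstar_terminates.
- exact: Gilbert_terminates.
- exact: SteepestAscent_terminates.
Qed.

End DistanceAlgorithms.

(** * Determinism of the algorithms *)

Section Determinism.
Context {R : realType} {n : nat}.
Variables (Q G : R -> set 'cV[R]_n).

Lemma run_DA_det da J alpha t gamma p p1 p2 :
  run_DA da Q G J alpha t gamma p p1 -> run_DA da Q G J alpha t gamma p p2 ->
  p1 = p2.
Proof.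
case: da => /= -[v1 h1] [v2 h2]; have [//] : (p1, v1) = (p2, v2).
- by apply: while_det h1 h2 => x y z -> ->.
- by apply: while_det h1 h2 => x y z -> ->.
- apply: while_det h1 h2 => x [y1 y2] [z1 z2] /= [wy ->] [wz ->].
  suff -> : y2 = z2 by [].
  by apply: while_det wy wz => a b c -> ->.
Qed.

Lemma semi_analytical_det da J vR vG eps alpha p out1 out2 :
  semi_analytical da Q G J vR vG eps alpha p out1 ->
  semi_analytical da Q G J vR vG eps alpha p out2 -> out1 = out2.
Proof.
move=> [s1 [V1 h1] k1] [s2 [V2 h2] k2].
have [s12 _] : (s1, V1) = (s2, V2) by apply: while_det h1 h2 => x y z -> ->.
move: k1 k2; rewrite s12; case: ifP => _; last by move=> -> ->.
apply: while_det => x [y1 y2] [z1 z2] /= [-> hy] [-> hz].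
by rewrite (run_DA_det hy hz).
Qed.

Lemma run_DA_stop da J alpha t gamma p :
  ~ da_guard Q G alpha t p -> run_DA da Q G J alpha t gamma p p.
Proof. by move=> ng; case: da => /=; eexists; apply: while_stop. Qed.

End Determinism.

(** * The outer loop and its limits *)

Section MovingBody.
Context {R : realType} {n : nat}.
Variables (Q G : R -> set 'cV[R]_n) (W : R -> set 'cV[R]_n) (vR vG T alpha : R).
Local Notation w := (wpoint Q G).
Local Notation L := (vG + vR).
Hypotheses (L0 : 0 < L) (T0 : 0 <= T) (alpha0 : 0 < alpha).
Hypothesis bW : forall t, 0 <= t -> convex_body (W t).
Hypothesis sW : forall t, 0 <= t -> support_map (W t) (w t).
Hypothesis lipW : forall t t' p, 0 <= t -> 0 <= t' -> enorm p = 1 ->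
  pairing p (w t p) <= pairing p (w t' p) + L * `|t - t'|.
Hypothesis WT : W T 0.
Hypothesis Wlt : forall t, 0 <= t -> t < T -> ~ W t 0.

Lemma rho_lower_lip t t' p : 0 <= t -> 0 <= t' -> enorm p = 1 ->
  rho_lower Q G t p - L * `|t - t'| <= rho_lower Q G t' p.
Proof.
move=> t0 t'0 p1; rewrite !rho_lower_unit//.
by have := lipW t'0 t0 p1; rewrite distrC; lra.
Qed.

Lemma rho_lower_le0 t p : 0 <= t -> W t 0 -> enorm p = 1 ->
  rho_lower Q G t p <= 0.
Proof.
by move=> t0 Wt p1; have := rho_lower_le (sW t0) Wt (unit_neq0 p1); rewrite enorm0.
Qed.

Lemma touching_w t p : 0 <= t -> W t 0 -> enorm p = 1 ->
  0 <= rho_lower Q G t p -> w t p = 0.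
Proof.
move=> t0 Wt p1 r0; have [_ maxp unip] := sW t0 (unit_neq0 p1).
apply/esym/unip => //; apply/eqP; rewrite eq_le maxp//= pairing0r.
by move: r0; rewrite rho_lower_unit// oppr_ge0.
Qed.

Lemma touching_delta t p : w t p = 0 -> enorm p = 1 ->
  delta Q G t p = 0 /\ rho_lower Q G t p = 0.
Proof.
move=> w0 p1; rewrite /delta rho_upperE rho_lower_unit// w0.
by rewrite enorm0 pairing0r oppr0 subr0.
Qed.

Lemma rho_lower_le_time t p : 0 <= t <= T -> enorm p = 1 ->
  rho_lower Q G t p <= L * (T - t).
Proof.
move=> /andP[t0 tT] p1; have := rho_lower_lip t0 T0 p1.
have := rho_lower_le0 T0 WT p1.
by rewrite distrC ger0_norm ?subr_ge0//; lra.
Qed.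

Lemma boostE t p : 0 <= rho_lower Q G t p ->
  boost Q G vR vG t p = t + rho_lower Q G t p / L.
Proof. by rewrite /boost => ->. Qed.

(** [rho_lower] is at most [0] at the time [T] and falls at speed at most [L]. *)
Lemma boost_le t p : 0 <= t <= T -> enorm p = 1 -> 0 <= rho_lower Q G t p ->
  0 <= boost Q G vR vG t p <= T.
Proof.
move=> tT p1 r0; rewrite boostE//; have /andP[t0 _] := tT.
rewrite addr_ge0 ?divr_ge0// ?(ltW L0)//= -lerBrDl ler_pdivrMr// mulrC.
exact: rho_lower_le_time.
Qed.

(** [rho_lower] needs at least the time [rho_lower / L] to fall to [0]; steepest
    ascent relies on the sign of its initial estimate. *)
Lemma boost_rho t p : 0 <= t <= T -> enorm p = 1 -> 0 <= rho_lower Q G t p ->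
  0 <= rho_lower Q G (boost Q G vR vG t p) p.
Proof.
move=> tT p1 r0; have /andP[b0 _] := boost_le tT p1 r0.
have /andP[t0 _] := tT; apply: le_trans (rho_lower_lip t0 b0 p1).
rewrite boostE// opprD addNKr normrN ger0_norm ?divr_ge0// ?(ltW L0)//.
by rewrite mulrC divfK ?gt_eqF// subrr.
Qed.

(** At the contact time the bodies already touch in direction [p], so that the
    distance algorithm, which need not terminate there, makes no pass. *)
Lemma run_DA_total da J t p : johnson_spec J -> 0 <= t <= T -> enorm p = 1 ->
  0 <= rho_lower Q G t p ->
  exists2 p', run_DA da Q G J alpha t 1 p p' &
    enorm p' = 1 /\ ~ da_guard Q G alpha t p'.
Proof.
move=> hJ /andP[t0]; rewrite le_eqVlt => /orP[/eqP tT|tT] p1 r0.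
  have w0 : w t p = 0 by apply: touching_w => //; rewrite tT.
  have ng : ~ da_guard Q G alpha t p.
    have [d0 r00] := touching_delta w0 p1.
    by rewrite /da_guard d0 r00 mulr0 ltxx.
  by exists p; [exact: run_DA_stop|].
exact: (run_DA_terminates (bW t0) (sW t0) (Wlt t0 tT)).
Qed.

Lemma guard_false t p : 0 <= t -> enorm p = 1 -> ~ da_guard Q G alpha t p ->
  0 <= rho_lower Q G t p /\ rho_upper Q G t p <= (1 + alpha) * rho_lower Q G t p.
Proof.
move=> t0 p1 /negP; rewrite -leNgt => ng.
have dp : 0 <= delta Q G t p.
  by rewrite subr_ge0 (rho_lower_le_upper (sW t0))// unit_neq0.
split; first by rewrite -(pmulr_rge0 _ alpha0) (le_trans dp).
by move: ng; rewrite /delta; lra.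
Qed.

(** While [rho_upper > eps], the false guard at the end of a distance
    computation gives [rho_lower >= eps / (1 + alpha)], so that a boost advances
    the time by a fixed amount; [T] bounds the time. The initial direction comes
    from no such computation, whence the other argument of the minimum [c]. *)
Lemma outer_loop da J eps p0 : johnson_spec J -> 0 < eps -> enorm p0 = 1 ->
  0 < rho_lower Q G 0 p0 ->
  exists2 out : R * 'rV[R]_n,
    while
        (fun x => rho_upper Q G x.1 x.2 > eps)
        (fun x y => y.1 = boost Q G vR vG x.1 x.2 /\
                    run_DA da Q G J alpha y.1 1 x.2 y.2)
        (0, p0) out &
    [/\ 0 <= out.1 <= T, enorm out.2 = 1 & rho_upper Q G out.1 out.2 <= eps].
Proof.
move=> hJ e0 p01 r0; have a0 := alpha0.
have a1 : 0 < 1 + alpha by lra.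
pose c := Num.min (rho_lower Q G 0 p0) (eps / (1 + alpha)).
have c0 : 0 < c by rewrite lt_min r0 divr_gt0.
have [||| |out wout [[out1 out2 ? ?] ng]] := @while_terminates R _
  (fun x => rho_upper Q G x.1 x.2 > eps)
  (fun x y => y.1 = boost Q G vR vG x.1 x.2 /\
                    run_DA da Q G J alpha y.1 1 x.2 y.2)
  (fun x => [/\ 0 <= x.1 <= T, enorm x.2 = 1, 0 <= rho_lower Q G x.1 x.2 &
      eps < rho_upper Q G x.1 x.2 -> c <= rho_lower Q G x.1 x.2])
  (fun x => T - x.1) (c / L) _ _ _ (0, p0).
- by rewrite divr_gt0.
- by move=> x [/andP[_ xT] _ _ _]; rewrite subr_ge0.
- move=> [t p] [/= tT p1 rp hc] /hc cr.
  have bT := boost_le tT p1 rp.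
  have [p' dp' [p'1 ng]] := run_DA_total da hJ bT p1 (boost_rho tT p1 rp).
  exists (boost Q G vR vG t p, p') => //=.
  have /andP[b0 _] := bT; have [rp' up'] := guard_false b0 p'1 ng.
  split; last first.
    move=> _; rewrite boostE//.
    have : c / L <= rho_lower Q G t p / L by rewrite ler_pM2r ?invr_gt0.
    by lra.
  split=> // eu; rewrite /c ge_min; apply/orP; right.
  by rewrite ler_pdivrMr// mulrC (le_trans (ltW eu)).
- split=> //=; first by rewrite lexx.
  + exact: ltW.
  + by move=> _; rewrite ge_min lexx.
exists out => //; split=> //; by rewrite leNgt; apply/negP.
Qed.

(** What is known of the output of a run; the second alternative is the output
    at time 0 without any pass of the outer loop. *)
Definition run_post (eps : R) (out : R * 'rV[R]_n) : Prop :=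
  [/\ 0 <= out.1 <= T, enorm out.2 = 1 &
    rho_upper Q G out.1 out.2 <= eps \/
    out.1 = 0 /\ exists2 s, W 0 s & enorm s <= eps].

Lemma support_scale t p (c : R) : 0 <= t -> p != 0 -> 0 < c -> w t (c *: p) = w t p.
Proof.
move=> t0 p0 c0; have cp0 : c *: p != 0 by rewrite scaler_eq0 negb_or gt_eqF.
have [Wp mp up] := sW t0 p0; have [Wc mc uc] := sW t0 cp0.
apply: up => //; apply/eqP; rewrite eq_le mp//=.
by have := mc _ Wp; rewrite !pairingZl ler_pM2l.
Qed.

(** The guard of GJK evaluates the estimate at [- s^T], whereas the outer loop
    starts with its normalization. *)
Lemma rho_lower_dir t s : 0 <= t -> s != 0 ->
  rho_lower Q G t (dir s) = rho_lower Q G t (- s^T).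
Proof.
move=> t0 s0; have es : 0 < enorm s by rewrite enorm_gt0.
have sT0 : - s^T != 0 by rewrite oppr_eq0 -enorm_eq0 enorm_tr enorm_eq0.
rewrite (rho_lowerE _ _ _ (dir s)) (rho_lowerE _ _ _ (- s^T)).
rewrite (enorm_dir s0) invr1 mul1r.
have -> : dir s = (enorm s)^-1 *: - s^T by rewrite /dir scalerN.
by rewrite support_scale ?invr_gt0// pairingZl enormN enorm_tr.
Qed.

Lemma semi_analytical_terminates da J eps p : johnson_spec J -> 0 < eps ->
  enorm p = 1 ->
  exists2 out, semi_analytical da Q G J vR vG eps alpha p out & run_post eps out.
Proof.
move=> hJ e0 p1.
have [s gs [Ws hs]] := GJK_terminates (bW (lexx 0)) (sW (lexx 0)) hJ e0 p1.
have [es|es] := ltP eps (enorm s); last first.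
  exists (0, p); first by exists s => //; rewrite ltNge es.
  by split=> //=; [rewrite lexx|right; split => //; exists s].
have s0 : s != 0 by rewrite -enorm_gt0 (lt_trans e0).
have r0 : 0 < rho_lower Q G 0 (dir s).
  by rewrite rho_lower_dir//; have := hs es; lra.
have [out wout [out1 out2 out3]] := outer_loop da hJ e0 (enorm_dir s0) r0.
exists out; first by exists s => //; rewrite es.
by split=> //; left.
Qed.

(** Before the contact time the distance is positive, hence bounded below on
    each [[0, T - e]] by compactness. *)
Lemma distance_lower_bound (p0 : 'rV[R]_n) (e : R) : enorm p0 = 1 -> 0 < e ->
  exists2 c : R, 0 < c & forall t, 0 <= t <= T - e ->
    forall s, W t s -> c < enorm s.
Proof.
move=> p01 e0.
have := @segment_compact R 0 (T - e).
rewrite compact_near_coveringP => /(_ R 0^'+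
  (fun c t => 0 <= t -> forall s, W t s -> c < enorm s)) [].
  move=> t; rewrite /= in_itv/= => /andP[t0 tT].
  have tT' : t < T by have := e0; lra.
  have Wn0 : W t !=set0.
    by exists (w t p0); have [] := sW t0 (unit_neq0 p01).
  have [p p1 [c c0 hc]] := separation (bW t0) Wn0 (Wlt t0 tT').
  have c2 : 0 < c / 2 by rewrite divr_gt0.
  have d0 : 0 < c / 2 / L by rewrite divr_gt0.
  near=> t' c' => t'0 s' Ws'.
  have tt' : `|t - t'| < c / 2 / L.
    near: t'; exact: cvgr_dist_lt.
  have c'c : c' < c / 2 by near: c'; exact: nbhs_right_lt.
  apply: (lt_le_trans c'c).
  apply: le_trans (rho_lower_le (sW t'0) Ws' (unit_neq0 p1)).
  apply: le_trans (rho_lower_lip t0 t'0 p1).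
  have cr : c <= rho_lower Q G t p.
    have [Ww _ _] := sW t0 (unit_neq0 p1).
    by have := hc _ Ww; rewrite rho_lower_unit// pairing0r; lra.
  have : L * `|t - t'| <= c / 2 by rewrite mulrC -ler_pdivlMr// ltW.
  by lra.
move=> d /= dp h; exists (d / 2); first by rewrite divr_gt0.
move=> t /andP[t0 tT]; apply: (h (d / 2)) => //=.
- by rewrite sub0r normrN gtr0_norm; lra.
- by rewrite divr_gt0.
- by rewrite in_itv/= t0.
Unshelve. all: by end_near. Qed.

(** At the contact time [rho_lower] is nonpositive, and where it vanishes the
    contact points coincide and [delta] vanishes too; so it is negative on the
    sphere except at [pstar], and compactness makes the bound uniform. *)
Lemma nonseparating_bound (pstar : 'rV[R]_n) (e : R) : 0 < e ->
  unique (fun p' => delta Q G T p' = 0 /\ enorm p' = 1) pstar ->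
  exists2 c : R, 0 < c & forall p, enorm p = 1 -> e <= enorm (p - pstar) ->
    rho_lower Q G T p < - c.
Proof.
move=> e0 [_ uni].
have [D D0 bD] := compact_enorm_bounded (bW T0).1.
have := @sphere_compact R n; rewrite compact_near_coveringP => /(_ R 0^'+
  (fun c p => enorm p = 1 -> e <= enorm (p - pstar) ->
    rho_lower Q G T p < - c)) [].
  move=> p /= p1; have [pe|pe] := ltP (enorm (p - pstar)) e.
    near=> q c => q1 qe; exfalso.
    have pq : enorm (q - p) < e - enorm (p - pstar).
      by near: q; apply/nbhs_enormP; exists (e - enorm (p - pstar)); rewrite ?subr_gt0.
    have := enormD_row (q - p) (p - pstar); rewrite addrA subrK => tri.
    by move: (le_lt_trans tri (ltr_leD pq (lexx _))); rewrite subrK ltNge qe.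
  have rn : rho_lower Q G T p < 0.
    rewrite lt_neqAle rho_lower_le0// andbT; apply/eqP => r0.
    have w0 : w T p = 0 by apply: touching_w => //; rewrite r0.
    have [d0 _] := touching_delta w0 p1.
    by move: pe; rewrite -(uni _ (conj d0 p1)) subrr enorm0 leNgt e0.
  pose c := - rho_lower Q G T p; have c0 : 0 < c by rewrite oppr_gt0.
  have c2 : 0 < c / 2 by rewrite divr_gt0.
  have d0 : 0 < c / 2 / D by rewrite divr_gt0.
  near=> q c' => q1 qe.
  have pq : enorm (q - p) < c / 2 / D.
    by near: q; apply/nbhs_enormP; exists (c / 2 / D).
  have c'c : c' < c / 2 by near: c'; exact: nbhs_right_lt.
  have [Ww _ _] := sW T0 (unit_neq0 p1).
  have [_ mq _] := sW T0 (unit_neq0 q1).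
  have h1 := mq _ Ww.
  have h2 := cauchy_schwarz_norm (q - p) (w T p).
  have h3 : enorm (q - p) * enorm (w T p) < c / 2.
    rewrite (le_lt_trans (ler_wpM2l (enorm_ge0 _) (bD _ Ww)))//.
    by rewrite -ltr_pdivlMr.
  move: h2; rewrite pairingBl ler_norml => /andP[h2 _].
  have h4 : pairing p (w T p) = c by rewrite /c rho_lower_unit// opprK.
  rewrite rho_lower_unit// ltrN2.
  apply: (lt_le_trans c'c); apply: le_trans h1.
  move: h2 h3; rewrite h4.
  by set x := enorm _ * _; set y := pairing _ _; lra.
move=> d /= dp h; exists (d / 2); first by rewrite divr_gt0.
move=> p p1; apply: (h (d / 2)) => //=.
- by rewrite sub0r normrN gtr0_norm; lra.
- by rewrite divr_gt0.
Unshelve. all: by end_near. Qed.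

(** The distance at the final time is at most [eps], hence below its minimum over
    [[0, T - e]] when [eps] is small. *)
Lemma run_post_time (p : 'rV[R]_n) (e : R) : enorm p = 1 -> 0 < e -> 0 < T ->
  \forall eps \near (0 : R)^'+, forall out : R * 'rV[R]_n, run_post eps out ->
    T - e <= out.1 /\ rho_upper Q G out.1 out.2 <= eps.
Proof.
move=> p1 e0 Tp; pose e' := Num.min e T.
have e'0 : 0 < e' by rewrite lt_min e0.
have [c c0 hc] := distance_lower_bound p1 e'0.
near=> eps => out [/andP[t0 tT] o1 ho].
have ec : eps < c by near: eps; exact: nbhs_right_lt.
have up : rho_upper Q G out.1 out.2 <= eps.
  case: ho => // -[_ [s Ws es]]; exfalso.
  have := hc 0 _ s Ws; rewrite lexx/= subr_ge0 ge_min lexx orbT => /(_ isT).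
  by rewrite ltNge (le_trans es)// ltW.
split=> //; rewrite leNgt; apply/negP => te.
have [Ww _ _] := sW t0 (unit_neq0 o1).
have := hc out.1 _ _ Ww; rewrite -rho_upperE ltNge (le_trans up (ltW ec))/=.
suff -> : 0 <= out.1 <= T - e' by move=> /(_ isT).
rewrite t0/= (le_trans (ltW te))// lerB// ge_min lexx.
Unshelve. all: by end_near. Qed.

(** At the final time [rho_lower >= - rho_upper >= - eps]; as this time is close
    to [T], the same holds at [T] up to a small error, which excludes directions
    far from [pstar]. *)
Lemma run_post_direction (p pstar : 'rV[R]_n) (e : R) : enorm p = 1 -> 0 < e -> 0 < T ->
  unique (fun p' => delta Q G T p' = 0 /\ enorm p' = 1) pstar ->
  \forall eps \near (0 : R)^'+, forall out : R * 'rV[R]_n, run_post eps out ->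
    enorm (out.2 - pstar) < e.
Proof.
move=> p1 e0 Tp uni; have [c c0 hc] := nonseparating_bound e0 uni.
have c2 : 0 < c / 2 by rewrite divr_gt0.
have cL : 0 < c / 2 / L by rewrite divr_gt0.
near=> eps => out pout.
have ec : eps < c / 2 by near: eps; exact: nbhs_right_lt.
have [tT up] : T - c / 2 / L <= out.1 /\ rho_upper Q G out.1 out.2 <= eps.
  by move: out pout; near: eps; exact: (run_post_time p1).
have [/andP[t0 tT'] o1 _] := pout.
rewrite ltNge; apply/negP => /(hc _ o1); rewrite ltNge => /negP; apply.
apply: le_trans (rho_lower_lip t0 T0 o1).
have h1 : L * `|out.1 - T| <= c / 2.
  rewrite mulrC -ler_pdivlMr// distrC ger0_norm ?subr_ge0//; lra.
have h2 : - eps <= rho_lower Q G out.1 out.2.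
  rewrite rho_lower_unit// lerN2; have := cauchy_schwarz out.2 (w out.1 out.2).
  by rewrite o1 mul1r -rho_upperE => h; exact: le_trans h up.
move: h1 h2 ec; set x := L * _; set y := rho_lower _ _ _ _; lra.
Unshelve. all: by end_near. Qed.

Lemma semi_analytical_limit da J p : johnson_spec J -> enorm p = 1 ->
  exists (Tout : R -> R) (pout : R -> 'rV[R]_n),
    [/\ forall eps : R, 0 < eps -> forall out : R * 'rV[R]_n,
          semi_analytical da Q G J vR vG eps alpha p out <->
          out = (Tout eps, pout eps),
        Tout eps @[eps --> 0^'+] --> T &
        forall pstar : 'rV[R]_n, 0 < T ->
          unique (fun p' : 'rV[R]_n => delta Q G T p' = 0 /\ enorm p' = 1) pstar ->
          pout eps @[eps --> 0^'+] --> pstar].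
Proof.
move=> hJ p1.
have F (eps : R) : exists out : R * 'rV[R]_n, 0 < eps ->
    semi_analytical da Q G J vR vG eps alpha p out /\ run_post eps out.
  have [e0|e0] := ltP 0 eps; last by exists (0, p).
  by have [out h1 h2] := semi_analytical_terminates da hJ e0 p1; exists out.
pose f (eps : R) := projT1 (cid (F eps)).
have hf (eps : R) : 0 < eps ->
    semi_analytical da Q G J vR vG eps alpha p (f eps) /\ run_post eps (f eps).
  by rewrite /f; case: cid.
exists (fun eps => (f eps).1), (fun eps => (f eps).2); split.
- move=> eps e0 out; rewrite -surjective_pairing; have [h _] := hf _ e0.
  by split=> [h'|->//]; exact: semi_analytical_det h' h.
- have [T00|Tp] := leP T 0.
    have TE : T = 0 by apply/eqP; rewrite eq_le T00.
    apply/cvgrPdist_lt => e e0; near=> eps.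
    have eps0 : 0 < eps by near: eps; exact: nbhs_right_gt.
    have [_ [t0T _ _]] := hf _ eps0.
    by move: t0T; rewrite TE -eq_le => /eqP <-; rewrite subrr normr0.
  apply/cvgrPdist_le => e e0; near=> eps.
  have eps0 : 0 < eps by near: eps; exact: nbhs_right_gt.
  have [_ hp] := hf _ eps0.
  have [te _] : T - e <= (f eps).1 /\ rho_upper Q G (f eps).1 (f eps).2 <= eps.
    by move: (f eps) hp; near: eps; exact: (run_post_time p1).
  have [/andP[t0 tT] _ _] := hp.
  by rewrite ger0_norm ?subr_ge0//; lra.
- move=> pstar Tp uni P /nbhs_enormP[e e0 eP].
  suff : \forall eps \near (0 : R)^'+, P (f eps).2 by [].
  near=> eps.
  have eps0 : 0 < eps by near: eps; exact: nbhs_right_gt.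
  have [_ hp] := hf _ eps0; apply: eP.
  by move: (f eps) hp; near: eps; exact: (run_post_direction p1).
Unshelve. all: by end_near. Qed.

End MovingBody.

(** * Integrals of bounded measurable functions *)

Section BoundedIntegrals.
Context {R : realType}.
Local Notation mu := (@lebesgue_measure R).
Local Notation RT := (measurableTypeR R).
Implicit Types (A B D : set RT) (f g : RT -> R).

(** Measurable and bounded on [D]: the integrands below all come from controls
    with values in a compact set over a bounded time interval. *)
Definition bounded_measurable D f : Prop :=
  measurable_fun D f /\ exists M : R, forall x, D x -> `|f x| <= M.

Definition fin_measurable A : Prop := measurable A /\ (mu A < +oo)%E.

Lemma fin_measurableS A B : fin_measurable B -> measurable A -> A `<=` B ->
  fin_measurable A.
Proof.
move=> [mB fB] mA AB; split=> //; apply: le_lt_trans fB.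
by apply: le_measure => //; rewrite inE.
Qed.

Lemma bounded_measurableS D A f : measurable D -> A `<=` D ->
  bounded_measurable D f -> bounded_measurable A f.
Proof.
move=> mD AD [mf [M fM]]; split; first exact: measurable_funS mf.
by exists M => x /AD/fM.
Qed.

Lemma bm_integrable D f : fin_measurable D -> bounded_measurable D f ->
  mu.-integrable D (EFin \o f).
Proof.
move=> [mD fD] [mf [M fM]]; apply: measurable_bounded_integrable => //.
exists M; split; first exact: num_real.
by move=> y My x Dx /=; rewrite (le_trans (fM _ Dx))// ltW.
Qed.

Lemma bmD D f g : bounded_measurable D f -> bounded_measurable D g ->
  bounded_measurable D (fun x => f x + g x).
Proof.
move=> [mf [M fM]] [mg [N gN]]; split; first exact: measurable_funD.
by exists (M + N) => x Dx; rewrite (le_trans (ler_normD _ _))// lerD ?fM ?gN.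
Qed.

Lemma bmM D f g : bounded_measurable D f -> bounded_measurable D g ->
  bounded_measurable D (fun x => f x * g x).
Proof.
move=> [mf [M fM]] [mg [N gN]]; split; first exact: measurable_funM.
by exists (M * N) => x Dx; rewrite normrM ler_pM ?fM ?gN.
Qed.

Lemma bm_cst D (c : R) : bounded_measurable D (fun=> c).
Proof. by split; [exact: measurable_cst|exists `|c|]. Qed.

Lemma bmN D f : bounded_measurable D f -> bounded_measurable D (fun x => - f x).
Proof.
move=> [mf [M fM]]; split; first exact: measurableT_comp.
by exists M => x Dx; rewrite normrN fM.
Qed.

Lemma bmB D f g : bounded_measurable D f -> bounded_measurable D g ->
  bounded_measurable D (fun x => f x - g x).
Proof. by move=> hf hg; apply: bmD => //; exact: bmN. Qed.

Lemma bm_sum D (J : Type) (r : seq J) (F : J -> RT -> R) :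
  (forall j, bounded_measurable D (F j)) ->
  bounded_measurable D (fun x => \sum_(j <- r) F j x).
Proof.
move=> hF; elim: r => [|j r IH].
  under eq_fun do rewrite big_nil; exact: bm_cst.
by under eq_fun do rewrite big_cons; exact: bmD.
Qed.

Lemma bint_bound D f (M : R) : fin_measurable D -> bounded_measurable D f ->
  (forall x, D x -> `|f x| <= M) ->
  `|\int[mu]_(x in D) f x| <= M * fine (mu D).
Proof.
move=> fD bf fM; have [mD _] := fD.
have h := le_normr_Rintegral mD (bm_integrable fD bf); apply: (le_trans h).
rewrite -Rintegral_cst//; apply: le_Rintegral => //.
- have : mu.-integrable D (EFin \o (fun x => `|f x|)).
    apply: bm_integrable => //; split; first by apply: measurableT_comp => //; have [] := bf.
    by exists M => x Dx; rewrite normr_id fM.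
  by [].
- by apply: (bm_integrable fD (bm_cst D M)).
Qed.

Lemma bint_setD D A f : fin_measurable D -> bounded_measurable D f ->
  measurable A -> A `<=` D ->
  \int[mu]_(x in D `\` A) f x = \int[mu]_(x in D) f x - \int[mu]_(x in A) f x.
Proof.
move=> fD bf mA AD; have [mD _] := fD.
have mDA : measurable (D `\` A) by exact: measurableD.
rewrite -[X in _ = \int[_]_(x in X) _ - _](setDUK AD) Rintegral_setU//.
- by rewrite addrC addKr.
- by rewrite setDUK//; exact: bm_integrable.
- by apply/disj_setPS => x [Ax [_]].
Qed.

Lemma bint_setU D A B f : fin_measurable D -> bounded_measurable D f ->
  measurable A -> A `<=` D -> measurable B -> B `<=` D -> A `&` B = set0 ->
  \int[mu]_(x in A `|` B) f x = \int[mu]_(x in A) f x + \int[mu]_(x in B) f x.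
Proof.
move=> fD bf mA AD mB BD AB; have [mD _] := fD.
apply: Rintegral_setU => //.
- have AUBD : A `|` B `<=` D by rewrite subUset.
  apply: bm_integrable; first by apply: fin_measurableS AUBD => //; exact: measurableU.
  exact: bounded_measurableS bf.
- by apply/disj_setPS; rewrite AB.
Qed.

Lemma fine_mu1 A : fin_measurable A -> \int[mu]_(x in A) (1 : R) = fine (mu A).
Proof. by move=> [mA _]; rewrite Rintegral_cst// mul1r. Qed.

(** The sets [C m] fill the union up to a part of [X m], whose measure tends to
    0: identities that hold up to integrals over parts of [X m] pass to the
    limit for all integrands at once. *)
Lemma nested_union D (C X : nat -> set RT) (K : R) : fin_measurable D ->
  (forall m, measurable (C m)) -> (forall m, measurable (X m)) ->
  (forall m, C m `<=` D) -> (forall m, X m `<=` D) ->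
  (forall m, C m `<=` C m.+1) -> (forall m, C m.+1 `<=` C m `|` X m) ->
  (forall m, X m.+1 `<=` X m) ->
  (forall m, fine (mu (X m)) <= K / 2 ^+ m) ->
  forall f (e : R), bounded_measurable D f -> 0 < e ->
  exists m, `|\int[mu]_(x in \bigcup_i C i) f x - \int[mu]_(x in C m) f x| < e /\
    forall A, measurable A -> A `<=` X m -> `|\int[mu]_(x in A) f x| < e.
Proof.
move=> fD mC mX CD XD CS CX XS hX f e bf e0; have [mD _] := fD.
have [_ [M fM]] := bf.
have M1 : 0 < `|M| + 1 by rewrite ltr_wpDl.
have [m hm] : exists m, (`|M| + 1) * (K / 2 ^+ m) < e.
  pose m := Num.bound ((`|M| + 1) * `|K| / e); exists m.
  apply: (@le_lt_trans _ _ ((`|M| + 1) * `|K| / 2 ^+ m)).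
    rewrite mulrA ler_pM2r ?invr_gt0 ?exprn_gt0// ler_pM2l//; exact: ler_norm.
  rewrite ltr_pdivrMr ?exprn_gt0// -ltr_pdivrMl// mulrC.
  apply: lt_le_trans (archi_boundP _) _; last first.
    by rewrite -natrX ler_nat ltnW// ltn_expl.
  by rewrite divr_ge0 ?mulr_ge0// ltW.
have small A : measurable A -> A `<=` X m -> `|\int[mu]_(x in A) f x| < e.
  move=> mA AX; have AD : A `<=` D by exact: subset_trans AX (XD m).
  have fX : fin_measurable (X m) by exact: fin_measurableS (XD m).
  have fA : fin_measurable A by exact: fin_measurableS AX.
  apply: le_lt_trans hm.
  apply: (le_trans (bint_bound fA (bounded_measurableS mD AD bf) (_ : forall x, A x -> _ <= `|M| + 1))).
    move=> x Ax; rewrite (le_trans (fM _ (AD _ Ax)))// (le_trans (ler_norm M))//.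
    by rewrite lerDl.
  rewrite ler_pM2l// (le_trans _ (hX m))// fine_le//.
  - by rewrite ge0_fin_numE//; have [] := fA.
  - by rewrite ge0_fin_numE//; have [] := fX.
  - by apply: le_measure => //; rewrite inE.
exists m; split=> //.
have mU : measurable (\bigcup_i C i) by exact: bigcupT_measurable.
have UD : \bigcup_i C i `<=` D by move=> x [i _ /CD].
have CU : C m `<=` \bigcup_i C i by move=> x Cx; exists m.
rewrite -(bint_setD (fin_measurableS fD mU UD) (bounded_measurableS mD UD bf) (mC m) CU).
apply: small; first exact: measurableD.
have XSn k : X (m + k)%N `<=` X m.
  elim: k => [|k IH]; first by rewrite addn0.
  by rewrite addnS; exact: subset_trans (XS _) IH.
have Cmk k : C (m + k)%N `<=` C m `|` X m.
  elim: k => [|k IH]; first by rewrite addn0; left.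
  rewrite addnS => x /CX[/IH//|/XSn]; by right.
move=> x [[i _ Ci] nC].
have : C (m + i)%N x.
  elim: m {hm CU XSn Cmk nC} => [//|j IH]; by rewrite addSn; exact: CS.
by move=> /Cmk[].
Qed.

End BoundedIntegrals.

(** * Lyapunov's convexity theorem *)

Section Halving.
Context {R : realType}.
Local Notation mu := (@lebesgue_measure R).
Local Notation RT := (measurableTypeR R).
Variable (t : R).
Local Notation I := (`[0, t]%classic : set RT).

Lemma fin_segment : fin_measurable I.
Proof.
split; first exact: measurable_itv.
by rewrite lebesgue_measure_itv/=; case: ifP => _ //; rewrite -EFinB ltry.
Qed.

(** By the intermediate value theorem: the measure of [D] below the level [x] is a
    1-Lipschitz function of [x]. *)
Lemma half_measure (D : set RT) : measurable D -> D `<=` I ->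
  exists E : set RT, [/\ measurable E, E `<=` D & fine (mu E) = fine (mu D) / 2].
Proof.
move=> mD DI; have fD := fin_measurableS fin_segment mD DI.
have [t0|t0] := leP 0 t; last first.
  have D0 : D = set0.
    apply/seteqP; split=> // x /DI; rewrite /= in_itv/= => /andP[x0 xt].
    by have := le_lt_trans (le_trans x0 xt) t0; rewrite ltxx.
  by exists set0; rewrite D0; split=> //; rewrite measure0/= mul0r.
pose P (x : R) : set RT := D `&` `[0, x]%classic.
have mP x : measurable (P x) by apply: measurableI => //; exact: measurable_itv.
have PD x : P x `<=` D by move=> y [].
have fP x : fin_measurable (P x) := fin_measurableS fD (mP x) (PD x).
pose phi (x : R) : R := fine (mu (P x)).
have lip x y : x <= y -> 0 <= phi y - phi x <= y - x.
  move=> xy; have Pxy : P x `<=` P y.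
    move=> z [Dz]; rewrite /= !in_itv/= => /andP[z0 zx]; split=> //=.
    by rewrite in_itv/= z0 (le_trans zx).
  have : \int[mu]_(z in P y `\` P x) (1 : R) =
      \int[mu]_(z in P y) 1 - \int[mu]_(z in P x) 1.
    by apply: bint_setD => //; exact: bm_cst.
  have mPD : measurable (P y `\` P x) by exact: measurableD.
  have fPD : fin_measurable (P y `\` P x).
    by apply: (fin_measurableS fD mPD) => z [/PD].
  rewrite (fine_mu1 fPD) (fine_mu1 (fP y)) (fine_mu1 (fP x)).
  rewrite -/(phi x) -/(phi y) => <-.
  have sub : P y `\` P x `<=` (`]x, y]%classic : set RT).
    move=> z [[Dz]]; rewrite /= !in_itv/= => /andP[z0 zy] nP; rewrite zy andbT.
    rewrite ltNge; apply/negP => zx; apply: nP; split=> //=.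
    by rewrite in_itv/= z0.
  rewrite fine_ge0//=.
  have [_ fxy] : fin_measurable (`]x, y]%classic : set RT).
    split; first exact: measurable_itv.
    by rewrite lebesgue_measure_itv/=; case: ifP => _ //; rewrite -EFinB ltry.
  apply: (@le_trans _ _ (fine (mu (`]x, y]%classic : set RT)))).
    rewrite fine_le//.
    - rewrite ge0_fin_numE//; apply: le_lt_trans fxy.
      by apply: le_measure; rewrite ?inE//; exact: measurable_itv.
    - by rewrite ge0_fin_numE.
    - by apply: le_measure; rewrite ?inE//; exact: measurable_itv.
  rewrite lebesgue_measure_itv/= lte_fin.
  by case: ltP => [_|yx]; rewrite /= ?subr_ge0.
have cphi : continuous phi.
  move=> x; apply/cvgrPdist_lt => e e0; near=> y.
  have xy : `|x - y| < e by near: y; exact: cvgr_dist_lt.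
  apply: le_lt_trans xy; have [xy|/ltW yx] := leP x y.
    have := lip _ _ xy; rewrite distrC ger0_norm; last by case/andP: (lip _ _ xy).
    by move=> /andP[_]; rewrite distrC ger0_norm// subr_ge0.
  have /andP[h1 h2] := lip _ _ yx.
  by rewrite ger0_norm// ger0_norm// subr_ge0.
have phi0 : phi 0 = 0.
  apply/eqP; rewrite eq_le fine_ge0//= andbT.
  have e0 : fine (mu ([set 0] : set RT)) = 0 by rewrite lebesgue_measure_set1.
  rewrite -[leRHS]e0; apply: fine_le.
  - by have [_ fP0] := fP 0; rewrite ge0_fin_numE.
  - by rewrite lebesgue_measure_set1.
  - apply: le_measure; rewrite ?inE//.
    by move=> z [_]; rewrite /= in_itv/= -eq_le eq_sym => /eqP.
have phit : phi t = fine (mu D).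
  by rewrite /phi; congr (fine (mu _)); apply/seteqP; split=> [z []//|z Dz]; split=> //; exact: DI.
have [||x _ hx] := @IVT _ phi 0 t (fine (mu D) / 2) t0.
- exact: continuous_subspaceT.
- have D0 : 0 <= fine (mu D) by exact: fine_ge0.
  rewrite phi0 phit min_l// max_r// divr_ge0//=.
  by rewrite ler_pdivrMr// ler_peMr// ler1n.
by exists (P x).
Unshelve. all: by end_near. Qed.

(** Lyapunov's theorem on the range of a vector measure, by induction on the
    number of integrands. Halve [D] for the first [k] of them into [E] and [F].
    Exchanging ever smaller pieces of [E] and [F] with equal integrals keeps the
    first [k] integrals halved, and a bisection on the exchanged amount halves
    the last one. *)
Lemma halving (g : nat -> RT -> R) : g 0 = (fun=> 1) ->
  (forall i, bounded_measurable I (g i)) ->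
  forall k (D : set RT), measurable D -> D `<=` I ->
  exists E : set RT, [/\ measurable E, E `<=` D & forall i, (i <= k)%N ->
    \int[mu]_(x in E) g i x = (\int[mu]_(x in D) g i x) / 2].
Proof.
move=> g0 bg; elim=> [D mD DI|k IH D0 mD0 D0I].
  have [E [mE ED hE]] := half_measure mD DI.
  exists E; split=> // i; rewrite leqn0 => /eqP ->; rewrite g0.
  have fD := fin_measurableS fin_segment mD DI.
  by rewrite !fine_mu1//; exact: fin_measurableS ED.
pose G i (A : set RT) : R := \int[mu]_(x in A) g i x.
have bgA i A : A `<=` I -> bounded_measurable A (g i).
  by move=> AI; apply: bounded_measurableS (bg i) => //; have [] := fin_segment.
have [h hP] : {h : set RT -> set RT & forall D, measurable D -> D `<=` I ->
    [/\ measurable (h D), h D `<=` D & forall i, (i <= k)%N ->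
      G i (h D) = G i D / 2]}.
  apply: (@choice _ _ (fun D E => measurable D -> D `<=` I ->
    [/\ measurable E, E `<=` D & forall i, (i <= k)%N -> G i E = G i D / 2])).
  move=> D; have [mD|nmD] := pselect (measurable D); last by exists set0.
  have [DI|nDI] := pselect (D `<=` I); last by exists set0.
  by have [E hE] := IH D mD DI; exists E.

have mI : measurable I by have [] := fin_segment.
have GB i A B : (A `<=` I) -> measurable A -> measurable B -> B `<=` A ->
    G i (A `\` B) = G i A - G i B.
  move=> AI mA mB BA; apply: bint_setD => //; last exact: bgA.
  exact: fin_measurableS fin_segment mA AI.
have GU i A B : measurable A -> A `<=` I -> measurable B -> B `<=` I ->
    A `&` B = set0 -> G i (A `|` B) = G i A + G i B.
  by move=> mA AI mB BI AB; apply: (bint_setU fin_segment).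
(* In a state [(C, E, F)] the part [C] is kept for good. Both [C + E] and
   [C + F] have half of the first integrals; the last integral is at
   least half with [E] and at most half with [F]. *)
pose St := (set RT * set RT * set RT)%type.
pose inv (x : St) := let: (C, E, F) := x in
  [/\ [/\ measurable C, measurable E & measurable F],
      [/\ C `<=` D0, E `<=` D0 & F `<=` D0],
      [/\ C `&` E = set0, C `&` F = set0 & E `&` F = set0],
      (forall i, (i <= k)%N -> G i E = G i F /\ G i C + G i E = G i D0 / 2) &
      G k.+1 C + G k.+1 F <= G k.+1 D0 / 2 <= G k.+1 C + G k.+1 E].
pose step (x : St) : St := let: (C, E, F) := x in
  if G k.+1 D0 / 2 <= G k.+1 C + G k.+1 (h F) + G k.+1 (E `\` h E)
  then (C `|` h F, E `\` h E, F `\` h F)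
  else (C `|` (E `\` h E), h E, h F).
have invS x : inv x -> inv (step x).
  case: x => [[C E] F] [[mC mE mF] [CD ED FD] [CE CF EF] hk herr].
  have EI : E `<=` I := subset_trans ED D0I.
  have FI : F `<=` I := subset_trans FD D0I.
  have CI : C `<=` I := subset_trans CD D0I.
  have [mhE hEE hE] := hP _ mE EI; have [mhF hFF hF] := hP _ mF FI.
  have mE1 : measurable (E `\` h E) by exact: measurableD.
  have mF1 : measurable (F `\` h F) by exact: measurableD.
  have E1E : E `\` h E `<=` E by move=> y [].
  have F1F : F `\` h F `<=` F by move=> y [].
  have E1G i : G i (E `\` h E) = G i E - G i (h E) by exact: GB.
  have F1G i : G i (F `\` h F) = G i F - G i (h F) by exact: GB.
  have disj (A B A' B' : set RT) : A `&` B = set0 -> A' `<=` A -> B' `<=` B -> A' `&` B' = set0.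
    by move=> AB AA BB; apply/seteqP; split=> // y [/AA Ay /BB By]; rewrite -AB.
  rewrite /inv /step; case: ifP => hs.
    have CU i : G i (C `|` h F) = G i C + G i (h F).
      apply: GU => //; first exact: subset_trans FI.
      exact: (disj C F).
    split.
    - by split=> //; exact: measurableU.
    - split; last exact: subset_trans FD.
      + by rewrite subUset; split=> //; exact: subset_trans FD.
      + exact: subset_trans ED.
    - split.
      + rewrite setIUl (disj C E) ?set0U//.
        by rewrite setIC; apply: (disj E F).
      + rewrite setIUl (disj C F) ?set0U//.
        by apply/seteqP; split=> // y [hy [_]].
      + exact: (disj E F).
    - move=> i ik; have [e1 e2] := hk i ik.
      rewrite CU E1G F1G (hE i ik) (hF i ik); split; lra.
    - have /andP[h1 h2] := herr.
      rewrite CU hs andbT F1G; lra.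
  have CU i : G i (C `|` (E `\` h E)) = G i C + G i (E `\` h E).
    apply: GU => //; first exact: subset_trans EI.
    exact: (disj C E).
  split.
  - by split=> //; exact: measurableU.
  - split; [|exact: subset_trans ED|exact: subset_trans FD].
    by rewrite subUset; split=> //; exact: subset_trans ED.
  - split.
    + rewrite setIUl (disj C E) ?set0U//.
      by apply/seteqP; split=> // y [[_ ny] /ny].
    + rewrite setIUl (disj C F) ?set0U//.
      exact: (disj E F).
    + exact: (disj E F).
  - move=> i ik; have [e1 e2] := hk i ik.
    rewrite CU E1G (hE i ik) (hF i ik); split; lra.
  - have /andP[h1 h2] := herr; move/negbT: hs; rewrite -ltNge => hs.
    apply/andP; split; rewrite CU; [by move: hs; lra|rewrite E1G; lra].
have [x0 x0inv] : exists x, inv x.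
  have [mh hD hh] := hP _ mD0 D0I.
  have mE : measurable (D0 `\` h D0) by exact: measurableD.
  have ED : D0 `\` h D0 `<=` D0 by move=> y [].
  have E1 i : G i (D0 `\` h D0) = G i D0 - G i (h D0) by exact: GB.
  have G0 i : G i set0 = 0 by rewrite /G Rintegral_set0.
  have [le|le] := leP (G k.+1 D0 / 2) (G k.+1 (h D0)).
    exists (set0, h D0, D0 `\` h D0); split.
    - by split.
    - by split.
    - by rewrite !set0I; split=> //; apply/seteqP; split=> // y [hy [_]].
    - by move=> i ik; rewrite E1 G0 (hh i ik); split; lra.
    - by rewrite G0 E1; apply/andP; split; lra.
  exists (set0, D0 `\` h D0, h D0); split.
  - by split.
  - by split.
  - by rewrite !set0I; split=> //; apply/seteqP; split=> // y [[_ ny] /ny].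
  - by move=> i ik; rewrite E1 G0 (hh i ik); split; lra.
  - by rewrite G0 E1; apply/andP; split; lra.
pose s m := iter m step x0.
have sinv m : inv (s m) by elim: m => //= m; exact: invS.
pose C m := (s m).1.1; pose E m := (s m).1.2; pose F m := (s m).2.
have sE m : s m = (C m, E m, F m) by rewrite /C /E /F; case: (s m) => [[]].
pose X m := E m `|` F m.
have step_sub m : [/\ C m `<=` C m.+1, C m.+1 `<=` C m `|` X m &
    E m.+1 `<=` E m /\ F m.+1 `<=` F m /\
    (G 0 (E m.+1) = G 0 (E m) / 2 /\ G 0 (F m.+1) = G 0 (F m) / 2)].
  have := sinv m; rewrite sE => -[[mC mE mF] [CD ED FD] _ _ _].
  have EI : E m `<=` I := subset_trans ED D0I.
  have FI : F m `<=` I := subset_trans FD D0I.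
  have [mhE hEE hE] := hP _ mE EI; have [mhF hFF hF] := hP _ mF FI.
  have E1G : G 0 (E m `\` h (E m)) = G 0 (E m) / 2.
    by rewrite GB// (hE 0)//; lra.
  have F1G : G 0 (F m `\` h (F m)) = G 0 (F m) / 2.
    by rewrite GB// (hF 0)//; lra.
  have := sE m.+1; rewrite /s iterS -/(s m) sE /step.
  case: ifP => _ [<- <- <-]; split.
  - by move=> y; left.
  - by move=> y [|/hFF]; [left|right; right].
  - by split; [move=> y []|split; [move=> y []|]].
  - by move=> y; left.
  - by move=> y [|[Ey _]]; [left|right; left].
  - by split=> //; split=> //; split; [exact: hE|exact: hF].
have GE m : G 0 (E m) = G 0 (E 0) / 2 ^+ m /\ G 0 (F m) = G 0 (F 0) / 2 ^+ m.
  elim: m => [|m [e1 e2]]; first by rewrite expr0 !divr1.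
  have [_ _ [_ [_ [-> ->]]]] := step_sub m.
  by rewrite e1 e2 exprS invfM; split; rewrite -mulrA [_^-1 * _]mulrC.
have mX m : measurable (X m).
  by have := sinv m; rewrite sE => -[[_ mE mF] _ _ _ _]; exact: measurableU.
have XI m : X m `<=` I.
  have := sinv m; rewrite sE => -[_ [_ ED FD] _ _ _].
  by rewrite subUset; split; [exact: subset_trans ED D0I|exact: subset_trans FD D0I].
have hC m : measurable (C m) /\ C m `<=` I.
  have := sinv m; rewrite sE => -[[mC _ _] [CD _ _] _ _ _]; split=> //.
  exact: subset_trans D0I.
have key := @nested_union R I C X (G 0 (E 0) + G 0 (F 0)) fin_segment
  (fun m => (hC m).1) mX (fun m => (hC m).2) XI
  (fun m => let: And3 a _ _ := step_sub m in a)
  (fun m => let: And3 _ a _ := step_sub m in a) _ _.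
exists (\bigcup_i C i); split.
- by apply: bigcupT_measurable => m; exact: (hC m).1.
- move=> y [m _]; have := sinv m; rewrite sE => -[_ [CD _ _] _ _ _]; exact: CD.
move=> i ik; apply/eqP; rewrite -subr_eq0 -normr_le0; apply/ler_addgt0Pr => e e0; rewrite add0r.
have e2 : 0 < e / 2 by rewrite divr_gt0.
have [||m [small1 small2]] := key _ _ (g i) (e / 2) (bg i) e2.
- move=> m; have [_ _ [h1 [h2 _]]] := step_sub m.
  by move=> y [/h1|/h2]; [left|right].
- move=> m; have [e1 e2'] := GE m.
  have := sinv m; rewrite sE => -[[mC mE mF] [CD ED FD] [_ _ EF] _ _].
  have EI : E m `<=` I := subset_trans ED D0I.
  have FI : F m `<=` I := subset_trans FD D0I.
  rewrite -fine_mu1; last exact: fin_measurableS fin_segment (mX m) (XI m).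
  have : G 0 (X m) = G 0 (E m) + G 0 (F m) by apply: GU.
  by rewrite e1 e2' -mulrDl {1}/G g0 => ->.
have := sinv m; rewrite sE => -[[mC mE mF] [CD ED FD] [_ _ EF] hk /andP[h1 h2]].
have sE' := small2 _ mE (@subsetUl _ _ _); have sF' := small2 _ mF (@subsetUr _ _ _).
rewrite -/(G i _) -/(G i (E m)) in sE'; rewrite -/(G i (F m)) in sF'.
rewrite -/(G i _) -/(G i (C m)) in small1.
rewrite -/(G i D0) -/(G i _).
move: small1 sE' sF'; rewrite !ltr_norml => /andP[a1 a2] /andP[b1 b2] /andP[c1 c2].
rewrite ler_norml; move: ik; rewrite leq_eqVlt => /orP[/eqP ik|ik].
  by rewrite ik in a1 a2 b1 b2 c1 c2 *; apply/andP; split; lra.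
by have [_ e3] := hk i ik; apply/andP; split; lra.
Qed.

(** The binary digits of [l] decide which halves are kept. *)
Lemma lyapunov_fraction (g : nat -> RT -> R) : g 0 = (fun=> 1) ->
  (forall i, bounded_measurable I (g i)) ->
  forall k (D : set RT) (l : R), measurable D -> D `<=` I -> 0 <= l <= 1 ->
  exists E : set RT, [/\ measurable E, E `<=` D & forall i, (i <= k)%N ->
    \int[mu]_(x in E) g i x = l * \int[mu]_(x in D) g i x].
Proof.
move=> g0 bg k D0 l0 mD0 D0I l01.
pose G i (A : set RT) : R := \int[mu]_(x in A) g i x.
have bgA i A : A `<=` I -> bounded_measurable A (g i).
  by move=> AI; apply: bounded_measurableS (bg i) => //; have [] := fin_segment.
have [h hP] : {h : set RT -> set RT & forall D, measurable D -> D `<=` I ->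
    [/\ measurable (h D), h D `<=` D & forall i, (i <= k)%N ->
      G i (h D) = G i D / 2]}.
  apply: (@choice _ _ (fun D E => measurable D -> D `<=` I ->
    [/\ measurable E, E `<=` D & forall i, (i <= k)%N -> G i E = G i D / 2])).
  move=> D; have [mD|nmD] := pselect (measurable D); last by exists set0.
  have [DI|nDI] := pselect (D `<=` I); last by exists set0.
  by have [E hE] := halving g0 bg k mD DI; exists E.
have GB i A B : (A `<=` I) -> measurable A -> measurable B -> B `<=` A ->
    G i (A `\` B) = G i A - G i B.
  move=> AI mA mB BA; apply: bint_setD => //; last exact: bgA.
  exact: fin_measurableS fin_segment mA AI.
have GU i A B : measurable A -> A `<=` I -> measurable B -> B `<=` I ->
    A `&` B = set0 -> G i (A `|` B) = G i A + G i B.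
  by move=> mA AI mB BI AB; apply: (bint_setU fin_segment).
(* In a state [(C, E, l)] the part [C] is kept for good, and a part of [E] with
   the fraction [l] of its integrals remains to be found. *)
pose St := (set RT * set RT * R)%type.
pose inv (x : St) := let: (C, E, l) := x in
  [/\ [/\ measurable C, measurable E & C `&` E = set0],
      [/\ C `<=` D0 & E `<=` D0], 0 <= l <= 1 &
      forall i, (i <= k)%N -> G i C + l * G i E = l0 * G i D0].
pose step (x : St) : St := let: (C, E, l) := x in
  if 1 <= 2 * l then (C `|` h E, E `\` h E, 2 * l - 1) else (C, h E, 2 * l).
have invS x : inv x -> inv (step x).
  case: x => [[C E] l] [[mC mE CE] [CD ED] /andP[lge lle] hk].
  have EI : E `<=` I := subset_trans ED D0I.
  have CI : C `<=` I := subset_trans CD D0I.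
  have [mhE hEE hE] := hP _ mE EI.
  have ChE : C `&` h E = set0.
    by apply/seteqP; split=> // y [Cy /hEE Ey]; rewrite -CE.
  rewrite /inv /step; case: ifP => hs.
    split.
    - split; [exact: measurableU|exact: measurableD|].
      by apply/seteqP; split=> // y [[Cy|hy] [Ey ny]]; [rewrite -CE|case: ny].
    - split; first by rewrite subUset; split=> //; exact: subset_trans ED.
      by move=> y [/ED].
    - by apply/andP; split; lra.
    - move=> i ik; rewrite GU//; last exact: subset_trans EI.
      by rewrite GB// (hE i ik) -(hk i ik); field.
  move/negbT: hs; rewrite -ltNge => hs; split => //.
  - by split=> //; exact: subset_trans ED.
  - by apply/andP; split; lra.
  - by move=> i ik; rewrite (hE i ik) -(hk i ik); field.
pose s m := iter m step (set0, D0, l0).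
have sinv m : inv (s m).
  elim: m => [|m]; last exact: invS.
  split; [by rewrite set0I; split|by split|by []|].
  by move=> i ik; rewrite /G Rintegral_set0 add0r.
pose C m := (s m).1.1; pose X m := (s m).1.2; pose l m := (s m).2.
have sE m : s m = (C m, X m, l m) by rewrite /C /X /l; case: (s m) => [[]].
have hC m : measurable (C m) /\ C m `<=` I.
  by have := sinv m; rewrite sE => -[[mC _ _] [CD _] _ _]; split=> //; exact: subset_trans D0I.
have hX m : measurable (X m) /\ X m `<=` I.
  by have := sinv m; rewrite sE => -[[_ mE _] [_ ED] _ _]; split=> //; exact: subset_trans D0I.
have step_sub m : [/\ C m `<=` C m.+1, C m.+1 `<=` C m `|` X m, X m.+1 `<=` X m &
    G 0 (X m.+1) = G 0 (X m) / 2].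
  have [mX XI] := hX m; have [mhE hEE hE] := hP _ mX XI.
  have := sE m.+1; rewrite /s iterS -/(s m) sE /step.
  case: ifP => _ [<- <- _]; split.
  - by move=> y; left.
  - by move=> y [|/hEE]; [left|right].
  - by move=> y [].
  - by rewrite GB// (hE 0)//; lra.
  - by [].
  - by move=> y; left.
  - exact: hEE.
  - exact: hE.
have GE m : G 0 (X m) = G 0 (X 0) / 2 ^+ m.
  elim: m => [|m e1]; first by rewrite expr0 divr1.
  by have [_ _ _ ->] := step_sub m; rewrite e1 exprS invfM -mulrA [_^-1 * _]mulrC.
have key := @nested_union R I C X (G 0 (X 0)) fin_segment
  (fun m => (hC m).1) (fun m => (hX m).1) (fun m => (hC m).2) (fun m => (hX m).2)
  (fun m => let: And4 a _ _ _ := step_sub m in a)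
  (fun m => let: And4 _ a _ _ := step_sub m in a)
  (fun m => let: And4 _ _ a _ := step_sub m in a) _.
exists (\bigcup_i C i); split.
- by apply: bigcupT_measurable => m; exact: (hC m).1.
- move=> y [m _]; have := sinv m; rewrite sE => -[_ [CD _] _ _]; exact: CD.
move=> i ik; apply/eqP; rewrite -subr_eq0 -normr_le0; apply/ler_addgt0Pr => e e0.
rewrite add0r; have e2 : 0 < e / 2 by rewrite divr_gt0.
have [|m [small1 small2]] := key _ (g i) (e / 2) (bg i) e2.
  move=> m; have [mX XI] := hX m.
  rewrite -fine_mu1; last exact: fin_measurableS fin_segment mX XI.
  by have := GE m; rewrite {1}/G g0 => ->.
have := sinv m; rewrite sE => -[[mC mE _] _ /andP[lm0 lm1] hk].
have := small2 _ mE (@subset_refl _ _); rewrite -/(G i _) => sX.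
have := hk i ik; rewrite -/(G i (C m)) in small1.
have lX : `|l m * G i (X m)| <= `|G i (X m)|.
  by rewrite normrM (ger0_norm lm0) ler_piMl.
rewrite -/(G i D0) => <-; rewrite -/(G i (\bigcup_i C i)) in small1 *.
set a := G i (\bigcup_i C i) in small1 *; set b := G i (C m) in small1 *.
have -> : a - (b + l m * G i (X m)) = (a - b) - l m * G i (X m) by ring.
apply: (le_trans (ler_normB _ _)); rewrite (splitr e) lerD// ?(ltW small1)//.
by rewrite (le_trans lX)// ltW.
Qed.

End Halving.

(** * Measurable selections *)

Section Selection.
Context {R : realType} {n : nat}.
Local Notation RT := (measurableTypeR R).
Variable D : set RT.
Hypothesis mD : measurable D.
Implicit Types (A : RT -> set 'cV[R]_n) (K : set 'cV[R]_n).

Definition hits A K : set RT := D `&` [set x | A x `&` K !=set0].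

(** Closed test sets make the notion stable under [argmax_map]: superlevel sets
    of continuous functions are closed. *)
Definition measurable_multimap A : Prop :=
  (forall x, D x -> compact (A x) /\ A x !=set0) /\
  forall K, closed K -> measurable (hits A K).

Definition argmax_map (phi : RT -> 'cV[R]_n -> R) A (x : RT) : set 'cV[R]_n :=
  [set v | A x v /\ forall v', A x v' -> phi x v' <= phi x v].

(** [A x] has a maximizer in [K] iff, for every rational [q], it reaches the
    level [q] inside [K] as soon as it reaches it at all. *)
Lemma argmax_measurable phi A : measurable_multimap A ->
  (forall x, D x -> continuous (phi x)) ->
  (forall K (q : R), closed K ->
    measurable (D `&` [set x | exists2 v, (A x `&` K) v & q <= phi x v])) ->
  measurable_multimap (argmax_map phi A).
Proof.
move=> [cA mA] cphi mphi; split.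
  move=> x Dx; have [cAx A0] := cA x Dx.
  have cp : {within A x, continuous (phi x)} := continuous_subspaceT (cphi x Dx).
  have [v0 /set_mem Av0 max0] := compact_EVT_max A0 cAx cp.
  have E : argmax_map phi A x = A x `&` [set v | phi x v0 <= phi x v].
    apply/seteqP; split=> v [Av hv]; split=> //=; first exact: hv.
    by move=> v' Av'; apply: le_trans hv; exact/max0/mem_set.
  rewrite E; split; last by exists v0; split=> /=.
  apply: compact_closedI => //.
  rewrite [X in closed X](_ : _ = (phi x) @^-1` [set y | phi x v0 <= y])//.
  by apply: closed_comp => [y _|]; [exact: cphi|exact: closed_ge].
move=> K cK.
pose S K (q : rat) : set RT :=
  D `&` [set x | exists2 v, (A x `&` K) v & ratr q <= phi x v].
rewrite (_ : hits _ _ = D `\` \bigcup_q (S setT q `\` S K q)); last first.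
  apply/seteqP; split=> x [Dx].
    move=> [v [[Av maxv] Kv]]; split=> // -[q _ [[_ [v' [Av' _] qv']]]]; apply.
    by split=> //; exists v => //; apply: le_trans qv' _; exact: maxv.
  move=> nS; split=> //=; have [cAx [v0 Av0]] := cA x Dx.
  have reach (q : rat) v : A x v -> ratr q <= phi x v ->
      exists2 u, (A x `&` K) u & ratr q <= phi x u.
    move=> Av qv; apply: contrapT => nu; apply: nS; exists q => //; split.
      by split=> //; exists v.
    by move=> [_].
  have cAK : compact (A x `&` K) by exact: compact_closedI.
  have AK0 : A x `&` K !=set0.
    have lt1 : phi x v0 - 1 < phi x v0 by rewrite gtrBl.
    have [q] := rat_in_itvoo lt1.
    rewrite in_itv/= => /andP[_ /ltW qv].
    by have [u AKu _] := reach q v0 Av0 qv; exists u.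
  have cp : {within A x `&` K, continuous (phi x)} := continuous_subspaceT (cphi x Dx).
  have [v1 /set_mem [Av1 Kv1] max1] := compact_EVT_max AK0 cAK cp.
  exists v1; split=> //; split=> // v' Av'; rewrite leNgt; apply/negP => lt.
  have [q] := rat_in_itvoo lt; rewrite in_itv/= => /andP[q1 /ltW q2].
  have [u AKu qu] := reach q v' Av' q2.
  by have := max1 u (mem_set AKu); rewrite leNgt (lt_le_trans q1).
apply: measurableD => //; apply: bigcupT_measurable_rat => q.
by apply: measurableD; apply: mphi => //; exact: closedT.
Qed.

Lemma argmax_measurable_cst (phi : 'cV[R]_n -> R) A : measurable_multimap A ->
  continuous phi -> measurable_multimap (argmax_map (fun=> phi) A).
Proof.
move=> hA cphi; apply: argmax_measurable => // K q cK.
rewrite [X in measurable X](_ : _ = hits A (K `&` phi @^-1` [set y | q <= y])).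
  apply: hA.2; apply: closedI => //.
  by apply: closed_comp => [y _|]; [exact: cphi|exact: closed_ge].
apply/seteqP; split=> x [Dx] /=.
  by move=> [v [Av Kv] qv]; split=> //; exists v.
by move=> [v [Av [Kv qv]]]; split=> //; exists v.
Qed.

(** A selection is found by maximizing one coordinate after the other: what is
    left at the end is a single point. *)
Lemma measurable_selection A : measurable_multimap A ->
  exists u : RT -> 'cV[R]_n, (forall x, D x -> A x (u x)) /\
    forall i, measurable_fun D (fun x => u x i 0).
Proof.
move=> hA.
have [B [hB BA Bi]] : exists B, [/\ measurable_multimap B,
    forall x, D x -> B x `<=` A x &
    forall x i v v', D x -> i \in enum 'I_n -> B x v -> B x v' -> v i 0 = v' i 0].
  elim: (enum 'I_n) => [|i s [B [hB BA Bi]]]; first by exists A; split=> [//|x _ v //|x i v v' _]; rewrite in_nil.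
  pose phi (v : 'cV[R]_n) := v i 0.
  have cphi : continuous phi by move=> v; exact: (@coord_continuous R n 1 i 0).
  exists (argmax_map (fun=> phi) B); split.
  - exact: argmax_measurable_cst.
  - by move=> x Dx v [/(BA _ Dx)].
  - move=> x j v v' Dx; rewrite inE => /orP[/eqP ->|js] [Bv mv] [Bv' mv'].
      by apply/eqP; rewrite eq_le [X in X && _]mv'// [X in _ && X]mv.
    exact: (Bi x).
have [u hu] : {u : RT -> 'cV[R]_n & forall x, D x -> B x (u x)}.
  apply: (@choice _ _ (fun x v => D x -> B x v)) => x.
  have [Dx|nDx] := pselect (D x); last by exists 0.
  by have [_ [v Bv]] := hB.1 _ Dx; exists v.
exists u; split=> [x Dx|i]; first exact/(BA _ Dx)/hu.
move=> _; apply: (measurability _ (RGenCInfty.measurableE R)) => //.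
move=> /= _ [_ [c ->] <-].
rewrite [X in measurable X](_ : _ = hits B [set v | c <= v i 0]).
  apply: hB.2.
  rewrite [X in closed X](_ : _ = (fun v : 'cV[R]_n => v i 0) @^-1` [set y | c <= y])//.
  by apply: closed_comp => [y _|]; [exact: coord_continuous|exact: closed_ge].
apply/seteqP; split=> x [Dx] /=.
  by rewrite in_itv/= andbT => cu; split=> //; exists (u x); split=> //; exact: hu.
move=> [v [Bv cv]]; split=> //; rewrite in_itv/= andbT.
by rewrite (Bi x i _ v)// ?mem_enum//; exact: hu.
Qed.

End Selection.

(** * The fundamental matrix and the integrands of trajectories *)

Section MatrixLimits.
Context {R : realType} {T : Type} {F : set_system T} {FF : Filter F}.

Lemma cvg_sum_fin (J : Type) (r : seq J) (f : J -> T -> R) (l : J -> R) :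
  (forall j, f j x @[x --> F] --> l j) ->
  (\sum_(j <- r) f j x) @[x --> F] --> \sum_(j <- r) l j.
Proof.
by move=> fl; apply: cvg_big => //; exact: add_continuous.
Qed.

Lemma cvg_prod_fin (J : Type) (r : seq J) (f : J -> T -> R) (l : J -> R) :
  (forall j, f j x @[x --> F] --> l j) ->
  (\prod_(j <- r) f j x) @[x --> F] --> \prod_(j <- r) l j.
Proof.
by move=> fl; apply: cvg_big => //; exact: mul_continuous.
Qed.

Lemma cvg_mx m n (f : T -> 'M[R]_(m, n)) (M : 'M[R]_(m, n)) :
  (forall i j, f x i j @[x --> F] --> M i j) -> f x @[x --> F] --> M.
Proof.
move=> hf; apply/cvg_ballP => d d0.
have : \forall x \near F, forall i j, ball (M i j) d (f x i j).
  apply: filter_forall => i; apply: filter_forall => j.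
  by have /cvg_ballP/(_ d d0) := hf i j.
by apply: filterS => x hx; split.
Qed.

Lemma cvg_det n (f : T -> 'M[R]_n) (M : 'M[R]_n) :
  (forall i j, f x i j @[x --> F] --> M i j) -> \det (f x) @[x --> F] --> \det M.
Proof.
move=> fM; apply: cvg_sum_fin => s; apply: cvgM; first exact: cvg_cst.
exact: cvg_prod_fin.
Qed.

Lemma cvg_invmx n (f : T -> 'M[R]_n) (M : 'M[R]_n) :
  (forall i j, f x i j @[x --> F] --> M i j) -> M \in unitmx ->
  (\forall x \near F, f x \in unitmx) ->
  forall i j, invmx (f x) i j @[x --> F] --> invmx M i j.
Proof.
move=> fM uM uf i j.
have -> : invmx M i j = (\det M)^-1 * cofactor M j i.
  by rewrite /invmx uM !mxE.
apply: (@cvg_trans _ ((\det (f x))^-1 * cofactor (f x) j i @[x --> F])).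
  apply: near_eq_cvg; near=> x; rewrite /invmx.
  have -> : f x \in unitmx by near: x.
  by rewrite !mxE.
apply: cvgM.
  apply: cvgV; last exact: cvg_det.
  by move: uM; rewrite unitmxE unitfE.
apply: cvgM; first exact: cvg_cst.
apply: cvg_det => k l; under eq_fun do rewrite !mxE.
rewrite !mxE; exact: fM.
Unshelve. all: by end_near. Qed.

End MatrixLimits.

Lemma enorm_mulmx {R : realType} (n : nat) (q : 'rV[R]_n) (M : 'M[R]_n) :
  enorm (q *m M) <= enorm q * enorm M.
Proof.
rewrite -(ler_pXn2r (_ : 0 < 2)%N) ?nnegrE ?mulr_ge0 ?enorm_ge0//.
rewrite exprMn [X in X <= _]enorm_sqE big_ord1 [enorm M ^+ 2]enorm_sqE exchange_big/=.
rewrite mulr_sumr; apply: ler_sum => j _.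
have -> : (q *m M) 0 j = pairing q (col j M).
  by rewrite pairingE mxE; apply: eq_bigr => i _; rewrite mxE.
have -> : \sum_i M i j ^+ 2 = enorm (col j M) ^+ 2.
  by rewrite enorm_sqE; apply: eq_bigr => i _; rewrite big_ord1 mxE.
rewrite -exprMn -[leLHS]real_normK ?num_real//.
by rewrite ler_pXn2r ?nnegrE ?mulr_ge0 ?enorm_ge0// cauchy_schwarz_norm.
Qed.

Section Trajectories.
Context {R : realType} {n : nat}.
Local Notation mu := (@lebesgue_measure R).
Local Notation RT := (measurableTypeR R).
Variables (A Phi : R -> 'M[R]_n) (s0 : 'cV[R]_n) (U : set 'cV[R]_n).
Hypotheses (hPhi : fundamental_matrix A Phi) (cU : compact U).
Local Notation traj := (trajectory Phi s0).
Local Notation Psi := (fun tau => invmx (Phi tau)).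
Local Notation D := (`[0, +oo[%classic : set RT).

Lemma Phi_unit (t : R) : 0 <= t -> Phi t \in unitmx.
Proof. by move=> t0; have [_ _ _ _ ->] := hPhi. Qed.

Lemma Phi_cvg (t : R) i j : 0 <= t ->
  Phi x i j @[x --> within `[0, +oo[%classic (nbhs t)] --> Phi t i j.
Proof.
move=> t0; have [_ cPhi _ _ _] := hPhi.
have /(_ t) := (subspace_continuousP _ _).1 cPhi.
rewrite /= in_itv/= andbT => /(_ t0) ct.
exact: (@cvg_comp _ _ _ Phi (fun M : 'M[R]_n => M i j) _ _ _ ct
  (@coord_continuous R n n i j (Phi t))).
Qed.

Lemma Psi_cvg (t : R) i j : 0 <= t ->
  Psi x i j @[x --> within `[0, +oo[%classic (nbhs t)] --> Psi t i j.
Proof.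
move=> t0; apply: cvg_invmx.
- by move=> k l; exact: Phi_cvg.
- exact: Phi_unit.
- rewrite near_withinE; apply: nearW => x; rewrite /= in_itv/= andbT; exact: Phi_unit.
Qed.

Lemma Psi_continuous i j : {within `[0, +oo[, continuous (fun t => Psi t i j)}.
Proof.
apply/subspace_continuousP => t; rewrite /= in_itv/= andbT => t0.
exact: Psi_cvg.
Qed.

Lemma within_bm (f : R -> R) (t : R) : {within `[0, +oo[, continuous f} ->
  bounded_measurable (`[0, t]%classic : set RT) f.
Proof.
move=> cf; have st : (`[0, t]%classic : set R) `<=` `[0, +oo[%classic.
  by move=> x /=; rewrite !in_itv/= andbT => /andP[].
have cft := continuous_subspaceW st cf; split.
  by apply: subspace_continuous_measurable_fun => //; exact: measurable_itv.
have [t0|t0] := leP 0 t; last first.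
  exists 0 => x; rewrite /= in_itv/= => /andP[x0 xt].
  by have := le_lt_trans (le_trans x0 xt) t0; rewrite ltxx.
have cn : {within `[0, t], continuous (fun x => `|f x|)}.
  move=> x; apply: continuous_comp; first exact: cft.
  exact: norm_continuous.
have [c _ hc] := EVT_max t0 cn; exists `|f c| => x xt.
by apply: hc.
Qed.

Lemma Psi_bm t i j : bounded_measurable (`[0, t]%classic : set RT) (fun x => Psi x i j).
Proof. exact/within_bm/Psi_continuous. Qed.

Lemma control_bm u t i : controls U u ->
  bounded_measurable (`[0, t]%classic : set RT) (fun x => u x i 0).
Proof.
move=> [mu_ Uu]; split.
  apply: measurable_funS (mu_ i); first exact: measurable_itv.
  by move=> x /=; rewrite !in_itv/= andbT => /andP[].
have [B B0 bB] := compact_enorm_bounded cU; exists B => x.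
rewrite /= in_itv/= => /andP[x0 _].
by rewrite (le_trans (coord_le_enorm _ _ _))// bB//; exact: Uu.
Qed.

Lemma integrand_bm u t i : controls U u ->
  bounded_measurable (`[0, t]%classic : set RT) (fun x => (Psi x *m u x) i 0).
Proof.
move=> cu.
have -> : (fun x : RT => (Psi x *m u x) i 0) =
    (fun x => \sum_j Psi x i j * u x j 0) by apply/funext => x; rewrite mxE.
by apply: bm_sum => j; apply: bmM; [exact: Psi_bm|exact: control_bm].
Qed.

End Trajectories.

(** * Exchange of controls *)

Lemma ae_sub {R : realType} (P Q : set (measurableTypeR R)) : P `<=` Q ->
  almost_everywhere (@lebesgue_measure R) P ->
  almost_everywhere (@lebesgue_measure R) Q.
Proof. by move=> PQ; apply: (@filterS _ _ (ae_filter_ringOfSetsType lebesgue_measure)). Qed.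

Section Splicing.
Context {R : realType} {n : nat}.
Local Notation mu := (@lebesgue_measure R).
Local Notation RT := (measurableTypeR R).
Variables (A Phi : R -> 'M[R]_n) (s0 : 'cV[R]_n) (U : set 'cV[R]_n).
Hypotheses (hPhi : fundamental_matrix A Phi) (cU : compact U).
Local Notation traj := (trajectory Phi s0).
Local Notation Psi := (fun tau => invmx (Phi tau)).
Local Notation D := (`[0, +oo[%classic : set RT).
Local Notation I t := (`[0, t]%classic : set RT).

Lemma bint_sum (E : set RT) (J : Type) (r : seq J) (F : J -> RT -> R) :
  fin_measurable E -> (forall j, bounded_measurable E (F j)) ->
  \int[mu]_(x in E) (\sum_(j <- r) F j x) = \sum_(j <- r) \int[mu]_(x in E) F j x.
Proof.
move=> fE bF; have [mE _] := fE; elim: r => [|j r IH].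
  rewrite big_nil (_ : (fun x => _) = (fun=> 0)).
    by rewrite Rintegral_cst// mul0r.
  by apply/funext => x; rewrite big_nil.
rewrite big_cons -IH -RintegralD//.
- by apply: eq_Rintegral => x _; rewrite big_cons.
- exact: bm_integrable.
- by apply: bm_integrable => //; exact: bm_sum.
Qed.

Lemma bint_Zl (E : set RT) (c : R) (f : RT -> R) :
  fin_measurable E -> bounded_measurable E f ->
  \int[mu]_(x in E) (c * f x) = c * \int[mu]_(x in E) f x.
Proof. by move=> fE bf; have [mE _] := fE; apply: RintegralZl => //; exact: bm_integrable. Qed.

Lemma bint_B (E : set RT) (f g : RT -> R) :
  fin_measurable E -> bounded_measurable E f -> bounded_measurable E g ->
  \int[mu]_(x in E) (f x - g x) = \int[mu]_(x in E) f x - \int[mu]_(x in E) g x.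
Proof. by move=> fE bf bg; have [mE _] := fE; apply: RintegralB => //; exact: bm_integrable. Qed.

Lemma pairing_traj p u t : controls U u ->
  pairing p (traj u t) = pairing p (Phi t *m s0) +
    \int[mu]_(x in I t) pairing (p *m Phi t *m Psi x) (u x).
Proof.
move=> cu; rewrite /trajectory pairingDr; congr (_ + _).
have bg i := integrand_bm hPhi cU t i cu.
have E (M : 'M[R]_n) (s : 'cV[R]_n) : pairing p (M *m s) = pairing (p *m M) s.
  by rewrite /pairing mulmxA.
rewrite E pairingE.
rewrite (eq_bigr (fun i => \int[mu]_(x in I t) ((p *m Phi t) 0 i * (Psi x *m u x) i 0))).
  rewrite -bint_sum; last 2 first.
  - exact: fin_segment.
  - by move=> i; apply: bmM; [exact: bm_cst|exact: bg].
  apply: eq_Rintegral => x _; rewrite -pairingE /pairing.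
  by rewrite !mulmxA.
by move=> i _; rewrite [X in _ * X]mxE; apply/esym/bint_Zl; [exact: fin_segment|exact: bg].
Qed.

Definition splice (E : set RT) (u1 u2 : R -> 'cV[R]_n) (x : R) : 'cV[R]_n :=
  if x \in E then u1 x else u2 x.

Lemma splice_control E u1 u2 : measurable E -> controls U u1 -> controls U u2 ->
  controls U (splice E u1 u2).
Proof.
move=> mE [m1 U1] [m2 U2]; split=> [i|t t0]; last first.
  by rewrite /splice; case: ifP => _; [exact: U1|exact: U2].
rewrite (_ : (fun t => _) = (fun t : RT => if t \in E then u1 t i 0 else u2 t i 0)).
  move=> _ Y mY.
  rewrite (_ : _ `&` _ = (E `&` (D `&` (fun t : RT => u1 t i 0) @^-1` Y)) `|`
      (D `&` (fun t : RT => u2 t i 0) @^-1` Y) `\` E).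
    have mD : measurable D by exact: measurable_itv.
    apply: measurableU; first by apply: measurableI => //; exact: m1.
    by apply: measurableD => //; exact: m2.
  apply/seteqP; split=> x /=.
    move=> [Dx]; case: ifP => [/set_mem xE|/negbT]; first by left.
    by rewrite notin_setE; right.
  move=> [[xE [Dx Yx]]|[[Dx Yx] nE]]; split=> //.
    by rewrite mem_set.
  by rewrite memNset.
by apply/funext => t; rewrite /splice; case: ifP.
Qed.

Lemma splice_integral E u1 u2 t i : measurable E -> E `<=` I t ->
  controls U u1 -> controls U u2 ->
  \int[mu]_(x in I t) (Psi x *m splice E u1 u2 x) i 0 =
  \int[mu]_(x in I t) (Psi x *m u2 x) i 0 +
  \int[mu]_(x in E) ((Psi x *m u1 x) i 0 - (Psi x *m u2 x) i 0).
Proof.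
move=> mE EI c1 c2; have [mI _] := fin_segment t.
have b1 := integrand_bm hPhi cU t i c1; have b2 := integrand_bm hPhi cU t i c2.
have b12 := integrand_bm hPhi cU t i (splice_control mE c1 c2).
have fE := fin_measurableS (fin_segment t) mE EI.
have h1 := bint_setD (fin_segment t) b12 mE EI.
have h2 := bint_setD (fin_segment t) b2 mE EI.
have e1 : \int[mu]_(x in E) (Psi x *m splice E u1 u2 x) i 0 =
    \int[mu]_(x in E) (Psi x *m u1 x) i 0.
  by apply: eq_Rintegral => x xE; rewrite /splice xE.
have e2 : \int[mu]_(x in I t `\` E) (Psi x *m splice E u1 u2 x) i 0 =
    \int[mu]_(x in I t `\` E) (Psi x *m u2 x) i 0.
  apply: eq_Rintegral => x /set_mem[_ nE].
  by rewrite /splice memNset.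
rewrite bint_B//; [|exact: bounded_measurableS b1|exact: bounded_measurableS b2].
move: h1; rewrite e2 h2 e1; lra.
Qed.

(** On every part of [[0, t]] each of the two spliced controls uses one of [u1]
    and [u2], and never the same, so that their endpoints add up to the sum of
    those of [u1] and [u2]. *)
Lemma splice_compl E u1 u2 t : measurable E -> E `<=` I t ->
  controls U u1 -> controls U u2 ->
  traj (splice (I t `\` E) u1 u2) t = traj u1 t + traj u2 t - traj (splice E u1 u2) t.
Proof.
move=> mE EI c1 c2; have [mI _] := fin_segment t.
have mIE : measurable (I t `\` E) by exact: measurableD.
have alg (a b c d : 'cV[R]_n) : (a + b) + (a + c) - (a + d) = a + (b + c - d).
  by apply/matrixP => i j; rewrite !mxE; ring.
rewrite /trajectory alg; congr (_ + _); rewrite -mulmxN -!mulmxDr.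
congr (_ *m _); apply/matrixP => i j; rewrite !mxE.
rewrite splice_integral//.
rewrite splice_integral//.
have b1 := integrand_bm hPhi cU t i c1; have b2 := integrand_bm hPhi cU t i c2.
have h := bint_setD (fin_segment t) (bmB b1 b2) mE EI.
have hB := bint_B (fin_segment t) b1 b2.
by move: h; rewrite hB => ->; ring.
Qed.

(** Lyapunov's theorem for the coordinates of the difference of the two
    integrands; the constant 1 is put at index 0 to control the measure. *)
Lemma splice_fraction u1 u2 t (l : R) : 0 <= l <= 1 ->
  controls U u1 -> controls U u2 ->
  exists E : set RT, [/\ measurable E, E `<=` I t &
    traj (splice E u1 u2) t = l *: traj u1 t + (1 - l) *: traj u2 t].
Proof.
move=> l01 c1 c2; have [mI _] := fin_segment t.
have b1 i := integrand_bm hPhi cU t i c1; have b2 i := integrand_bm hPhi cU t i c2.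
pose g (k : nat) : RT -> R := if k is j.+1 then
  if insub j is Some i then
    fun x => (Psi x *m u1 x) (i : 'I_n) 0 - (Psi x *m u2 x) i 0 else fun=> 0
  else fun=> 1.
have bg k : bounded_measurable (I t) (g k).
  case: k => [|j]; first exact: bm_cst.
  by rewrite /g; case: insubP => [i _ _|_]; [exact: bmB|exact: bm_cst].
have [E [mE EI hE]] := lyapunov_fraction (erefl : g 0 = _) bg n mI (@subset_refl _ _) l01.
exists E; split=> //.
have -> : l *: traj u1 t + (1 - l) *: traj u2 t =
    traj u2 t + l *: (traj u1 t - traj u2 t).
  by apply/matrixP => i j; rewrite !mxE; ring.
rewrite /trajectory -addrA; congr (_ + _).
rewrite opprD addrACA subrr add0r -mulmxN -mulmxDr scalemxAr -mulmxDr.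
congr (_ *m _); apply/matrixP => i j; rewrite !mxE splice_integral//.
have gi : g i.+1 = (fun x => (Psi x *m u1 x) i 0 - (Psi x *m u2 x) i 0).
  by rewrite /g; case: insubP => [k _ /val_inj -> //|]; rewrite ltn_ord.
have := hE i.+1 (ltn_ord i); rewrite gi => ->.
by rewrite bint_B//; exact: fin_segment.
Qed.

Lemma reachable_convex t x y (l : R) : reachable Phi s0 U t x ->
  reachable Phi s0 U t y -> 0 <= l <= 1 ->
  reachable Phi s0 U t (l *: x + (1 - l) *: y).
Proof.
move=> [u1 c1 <-] [u2 c2 <-] l01.
have [E [mE _ <-]] := splice_fraction t l01 c1 c2.
by exists (splice E u1 u2) => //; exact: splice_control.
Qed.

Lemma maximizer_boundary (V : set 'cV[R]_n) (p : 'rV[R]_n) x : p != 0 -> V x ->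
  (forall y, V y -> pairing p y <= pairing p x) ->
  (closure V `\` interior V) x.
Proof.
move=> p0 Vx maxx; split; first exact: subset_closure.
move=> /nbhs_enormP[e e0 eV].
have pp : 0 < enorm p by rewrite enorm_gt0.
pose y := x + (e / 2 / enorm p) *: p^T.
have := maxx y (eV _ _); rewrite /y pairingDr pairingZr -enorm_sq_row.
rewrite leNgt ltrDl mulr_gt0 ?divr_gt0 ?exprn_gt0//.
rewrite addrC addKr enormZ enorm_tr ger0_norm ?divr_ge0 ?(ltW e0)//; last exact: enorm_ge0.
by rewrite divfK ?gt_eqF// ltr_pdivrMr// ltr_pMr// ltr1n => /(_ isT).
Qed.

(** If the two controls differed, exchanging them on a set that moves the endpoint
    half of the way, or on its complement, would give two different controls that
    reach the same midpoint, again a maximizer and thus a boundary point, against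
    normality. *)
Lemma maximizing_control_unique (p : 'rV[R]_n) u1 u2 (t : R) : RP1 Phi s0 U -> 0 <= t ->
  p != 0 -> controls U u1 -> controls U u2 ->
  (forall u, controls U u -> pairing p (traj u t) <= pairing p (traj u1 t)) ->
  (forall u, controls U u -> pairing p (traj u t) <= pairing p (traj u2 t)) ->
  {ae mu, forall x : R, `[0, t]%classic x -> u1 x = u2 x}.
Proof.
move=> hRP1 t0 p0 c1 c2 max1 max2; have [mI _] := fin_segment t.
have l01 : is_true (0 <= (2^-1 : R) <= 1).
  by rewrite invr_ge0 ler0n /= invf_le1 ?ler1n ?ltr0n.
have [E [mE EI hE]] := splice_fraction t l01 c1 c2.
have mIE : measurable (I t `\` E) by exact: measurableD.
have ca := splice_control mE c1 c2; have cb := splice_control mIE c1 c2.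
have ab : traj (splice E u1 u2) t = traj (splice (I t `\` E) u1 u2) t.
  rewrite splice_compl// hE; apply/matrixP => i j; rewrite !mxE; lra.
have e12 : pairing p (traj u1 t) = pairing p (traj u2 t).
  by apply/le_anti/andP; split; [exact: max2|exact: max1].
have bnd : (closure (reachable Phi s0 U t) `\` interior (reachable Phi s0 U t))
    (traj (splice E u1 u2) t).
  refine (maximizer_boundary p0 (ex_intro2 _ _ (splice E u1 u2) ca erefl) _).
  move=> y [u cu <-]; rewrite hE (pairingDr p (_ *: _)) !pairingZr -e12 -mulrDl.
  rewrite addrCA subrr addr0 mul1r; exact: max1.
have := hRP1 t _ _ t0 ca cb ab bnd.
clear hE ab e12 bnd max1 max2 hRP1.
apply: ae_sub => x hx xI; have := hx xI; rewrite /splice.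
have [/set_mem xE|xE] := boolP (x \in E); first by rewrite memNset// => -[].
by rewrite mem_set//; split=> //; move: xE; rewrite notin_setE.
Qed.

End Splicing.

(** * Extremal controls *)

Section Maximizers.
Context {R : realType} {n : nat}.
Local Notation mu := (@lebesgue_measure R).
Local Notation RT := (measurableTypeR R).
Variables (A Phi : R -> 'M[R]_n) (s0 : 'cV[R]_n) (U : set 'cV[R]_n).
Hypotheses (hPhi : fundamental_matrix A Phi) (cU : compact U) (U0 : U !=set0).
Hypothesis hRP1 : RP1 Phi s0 U.
Local Notation traj := (trajectory Phi s0).
Local Notation Psi := (fun tau => invmx (Phi tau)).
Local Notation D := (`[0, +oo[%classic : set RT).
Local Notation I t := (`[0, t]%classic : set RT).

(** The row that pairs with the control in the Pontryagin maximum principle. *)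
Definition costate (p : 'rV[R]_n) (t x : R) : 'rV[R]_n :=
  p *m Phi t *m invmx (Phi x).

Lemma D_ge0 x : D x -> 0 <= x.
Proof. by rewrite /= in_itv/= andbT. Qed.

Lemma ge0_D x : 0 <= x -> D x.
Proof. by rewrite /= in_itv/= andbT. Qed.

Lemma costate_near p (t x e : R) : 0 <= x -> 0 < e ->
  \forall y \near within `[0, +oo[%classic (nbhs x),
    enorm (costate p t y - costate p t x) < e.
Proof.
move=> x0 e0.
have cpsi : Psi y @[y --> within `[0, +oo[%classic (nbhs x)] --> Psi x.
  by apply: cvg_mx => i j; exact: (Psi_cvg hPhi).
have [B B0 hB] : exists2 B : R, 0 < B &
    forall y, enorm (costate p t y - costate p t x) <= B * enorm (Psi y - Psi x).
  exists (enorm (p *m Phi t) + 1); first by rewrite ltr_wpDl ?enorm_ge0.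
  move=> y; rewrite /costate -mulmxBr (le_trans (enorm_mulmx _ _))//.
  by rewrite ler_wpM2r ?enorm_ge0// lerDl.
have nM : nbhs (Psi x) [set M | enorm (M - Psi x) < e / B].
  by apply/nbhs_enormP; exists (e / B); rewrite ?divr_gt0.
have : \forall y \near within `[0, +oo[%classic (nbhs x), enorm (Psi y - Psi x) < e / B.
  exact: (cpsi _ nM).
apply: filterS => y; rewrite ltr_pdivlMr// mulrC => h.
exact: le_lt_trans (hB y) h.
Qed.

Lemma compact_maximizer (C : set 'cV[R]_n) q : compact C -> C !=set0 ->
  C (contact C q) /\ forall v, C v -> pairing q v <= pairing q (contact C q).
Proof.
move=> cC C0; rewrite /contact; case: xgetP => [v _ [Cv hv]//|nv].
have cq : {within C, continuous (pairing q)}.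
  by apply: continuous_subspaceT; exact: pairing_continuous.
have [v /set_mem Cv hv] := compact_EVT_max C0 cC cq.
by case: (nv v); split=> // v' Cv'; exact/hv/mem_set.
Qed.

(** Measurable because continuous: the support function of a compact set is
    Lipschitz and the costate is continuous. *)
Lemma max_value_measurable (C : set 'cV[R]_n) p t : compact C -> C !=set0 ->
  measurable_fun D (fun x : RT => pairing (costate p t x) (contact C (costate p t x))).
Proof.
move=> cC C0; have [B B0 bB] := compact_enorm_bounded cC.
apply: subspace_continuous_measurable_fun; first exact: measurable_itv.
apply/subspace_continuousP => x /D_ge0 x0.
apply/cvgrPdist_lt => e e0.
have eB : 0 < e / B by rewrite divr_gt0.
near=> y.
have hxy : enorm (costate p t y - costate p t x) < e / B.
  by near: y; exact: costate_near.
have [Cx hx] := compact_maximizer (costate p t x) cC C0.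
have [Cy hy] := compact_maximizer (costate p t y) cC C0.
set vx := contact C (costate p t x) in Cx hx *.
set vy := contact C (costate p t y) in Cy hy *.
have small v : C v -> `|pairing (costate p t y) v - pairing (costate p t x) v| < e.
  move=> Cv; rewrite -pairingBl (le_lt_trans (cauchy_schwarz_norm _ _))//.
  rewrite (le_lt_trans (ler_wpM2l _ (bB _ Cv))) ?enorm_ge0//.
  by rewrite -ltr_pdivlMr.
have := small _ Cx; have := small _ Cy; have := hx _ Cy; have := hy _ Cx.
rewrite !ltr_norml => h1 h2 /andP[h3 h4] /andP[h5 h6].
by apply/andP; split; lra.
Unshelve. all: by end_near. Qed.

Definition max_controls (p : 'rV[R]_n) (t : R) : RT -> set 'cV[R]_n :=
  argmax_map (fun x v => pairing (costate p t x) v) (fun=> U).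

Lemma max_controls_measurable p t : measurable_multimap D (max_controls p t).
Proof.
have mD : measurable D by exact: measurable_itv.
apply: argmax_measurable => //.
- split=> [x _|K cK]; first by [].
  have [UK|UK] := pselect (U `&` K !=set0).
    by rewrite (_ : hits _ _ _ = D)//; apply/seteqP; split=> x [].
  by rewrite (_ : hits _ _ _ = set0)//; apply/seteqP; split=> x [].
- by move=> x _; exact: pairing_continuous.
- move=> K q cK; have [UK|UK] := pselect (U `&` K !=set0); last first.
    rewrite (_ : _ `&` _ = set0)//; apply/seteqP; split=> x // [_ [v UKv _]].
    by case: UK; exists v.
  have cUK : compact (U `&` K) by exact: compact_closedI.
  have mv := max_value_measurable p t cUK UK.
  rewrite [X in measurable X](_ : _ = D `&` (fun x : RT => pairing (costate p t x)
      (contact (U `&` K) (costate p t x))) @^-1` `[q, +oo[%classic).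
    by apply: mv => //; exact: measurable_itv.
  apply/seteqP; split=> x [Dx].
    move=> [v UKv qv]; split=> //; rewrite /= in_itv/= andbT.
    apply: (le_trans qv).
    by have [_] := compact_maximizer (costate p t x) cUK UK; exact.
  rewrite /= in_itv/= andbT => qv; split=> //.
  have [h _] := compact_maximizer (costate p t x) cUK UK.
  by exists (contact (U `&` K) (costate p t x)).
Qed.

Definition extremal (p : 'rV[R]_n) (t : R) (u : R -> 'cV[R]_n) : Prop :=
  controls U u /\ forall x, 0 <= x -> max_controls p t x (u x).

Lemma selection_extremal p t B : measurable_multimap D B ->
  (forall x, 0 <= x -> B x `<=` max_controls p t x) ->
  exists2 u, extremal p t u & forall x, 0 <= x -> B x (u x).
Proof.
move=> hB BA; have [u [uB mu_]] := measurable_selection (measurable_itv _) hB.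
have uB' x : 0 <= x -> B x (u x) by move=> /ge0_D; exact: uB.
exists u => //; split=> [|x x0]; last exact/(BA x x0)/uB'.
by split=> // x x0; have [] := BA x x0 _ (uB' x x0).
Qed.

Lemma extremal_exists p t : exists u, extremal p t u.
Proof.
have sub x : 0 <= x -> max_controls p t x `<=` max_controls p t x by move=> _ v.
by have [u hu _] := selection_extremal (max_controls_measurable p t) sub; exists u.
Qed.

(** Along a control, [p s(t)] is up to a constant the integral of the costate
    paired with the control, and an extremal control maximizes this integrand at
    every time. *)
Lemma extremal_max p t u u' : 0 <= t -> extremal p t u -> controls U u' ->
  pairing p (traj u' t) <= pairing p (traj u t).
Proof.
move=> t0 [cu hu] cu'; rewrite !(pairing_traj s0 hPhi cU)// lerD2l.
have [mI _] := fin_segment t.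
have bm v : controls U v ->
    bounded_measurable (I t) (fun x => pairing (costate p t x) (v x)).
  move=> cv; have -> : (fun x : RT => pairing (costate p t x) (v x)) =
      (fun x => \sum_i (p *m Phi t) 0 i * (Psi x *m v x) i 0).
    by apply/funext => x; rewrite -pairingE /pairing /costate !mulmxA.
  apply: bm_sum => i; apply: bmM; first exact: bm_cst.
  exact: (integrand_bm hPhi cU).
apply: le_Rintegral => //; [exact/bm_integrable/bm/cu'/fin_segment|
  exact/bm_integrable/bm/cu/fin_segment|].
move=> x; rewrite /= in_itv/= => /andP[x0 _].
by have [_] := hu x x0; apply; exact: cu'.2.
Qed.

(** Selections that maximize and minimize each coordinate of the control must
    coincide almost everywhere, so that a single control value is extremal. *)
Lemma extremal_ae p t u : 0 <= t -> p != 0 -> extremal p t u ->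
  {ae mu, forall x : R, `[0, t]%classic x ->
    forall v, max_controls p t x v -> v = u x}.
Proof.
move=> t0 p0 hu.
have key i : almost_everywhere mu ([set x : RT | I t x ->
    forall v, max_controls p t x v -> v i 0 = u x i 0]).
  have cp : continuous (fun v : 'cV[R]_n => v i 0).
    by move=> v; exact: (@coord_continuous R n 1 i 0).
  have cm : continuous (fun v : 'cV[R]_n => - v i 0).
    apply: (@continuous_lip _ _ _ _ 1) => x y; rewrite mul1r -opprD normrN.
    by have := coord_le_enorm (x - y) i 0; rewrite !mxE.
  have mD : measurable D by exact: measurable_itv.
  have hA := max_controls_measurable p t.
  have sub phi x : 0 <= x -> argmax_map (fun=> phi) (max_controls p t) x `<=`
    max_controls p t x by move=> _ v [].
  have [u1 e1 h1] := selection_extremal (argmax_measurable_cst mD hA cp) (@sub _).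
  have [u2 e2 h2] := selection_extremal (argmax_measurable_cst mD hA cm) (@sub _).
  have ae12 := maximizing_control_unique hPhi cU hRP1 t0 p0 e1.1 e2.1
    (fun u' => extremal_max t0 e1) (fun u' => extremal_max t0 e2).
  apply: ae_sub ae12 => x hx xI; have x0 : 0 <= x.
    by move: xI; rewrite /= in_itv/= => /andP[].
  have sq v : max_controls p t x v -> v i 0 = u1 x i 0.
    move=> Av; have [_ max1] := h1 x x0; have [_ max2] := h2 x x0.
    apply/eqP; rewrite eq_le max1//= -lerN2 (hx xI); exact: max2.
  by move=> v Av; rewrite (sq _ Av) -(sq (u x))//; exact: hu.2.
have : almost_everywhere mu (fun x : RT => forall i : 'I_n, I t x ->
    forall v, max_controls p t x v -> v i 0 = u x i 0).
  apply: (@filter_forall _ _ _ _ (ae_filter_ringOfSetsType mu)) => i; exact: key.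
apply: ae_sub => x hx xI v Av; apply/matrixP => i j; rewrite ord1.
exact: hx.
Qed.

End Maximizers.

(** * Speed of trajectories *)

Section Speed.
Context {R : realType}.

(** For [e > 0], the function [f x - (L + e) x] decreases along a suitable step to
    the right of any point, so that its minimum on [[a, b]] is at [b]; then [e]
    tends to 0. *)
Lemma dini_growth (f : R -> R) (a b L : R) : a <= b ->
  {within `[a, b], continuous f} ->
  (forall x e : R, a <= x < b -> 0 < e ->
    exists2 y : R, x < y <= b & f y - f x <= (L + e) * (y - x)) ->
  f b - f a <= L * (b - a).
Proof.
move=> ab cf loc; apply/ler_addgt0Pr => e0 e00.
have ba : 0 < b - a + 1 by lra.
pose e := e0 / (b - a + 1); have ep : 0 < e by rewrite divr_gt0.
pose g x := f x - (L + e) * x.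
have cg : {within `[a, b], continuous g}.
  have cm : {within `[a, b], continuous (fun x : R => (L + e) * x)}.
    by apply: continuous_subspaceT => x; exact: mulrl_continuous.
  by move=> x; apply: continuousB; [exact: cf|exact: cm].
have [c cab minc] := EVT_min ab cg.
have e2 : 0 < e / 2 by rewrite divr_gt0.
have cb : c = b.
  apply/eqP; rewrite eq_le; move: cab; rewrite in_itv/= => /andP[ac cb].
  rewrite cb/= leNgt; apply/negP => cb'.
  have [|y /andP[cy yb] hy] := loc c (e / 2) _ e2; first by rewrite ac.
  have := minc y; rewrite in_itv/= yb (le_trans ac (ltW cy)) => /(_ isT).
  rewrite /g leNgt => /negP; apply.
  have : 0 < e / 2 * (y - c) by rewrite mulr_gt0// subr_gt0.
  by move: hy; lra.
have := minc a; rewrite in_itv/= lexx ab => /(_ isT); rewrite cb /g => h.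
have he : e * (b - a) <= e0.
  rewrite /e mulrAC ler_pdivrMr//; rewrite ler_wpM2l ?(ltW e00)//; lra.
by lra.
Qed.

(** The fundamental matrix is differentiable at positive times only, so that the
    growth bound reaches the time 0 by continuity. *)
Lemma growth_at_0 (f : R -> R) (b L : R) : 0 < b ->
  {within `[0, b], continuous f} -> 0 <= L ->
  (forall c, 0 < c <= b -> f b - f c <= L * (b - c)) ->
  f b - f 0 <= L * (b - 0).
Proof.
move=> b0 ct L0 pos; apply/ler_addgt0Pr => e e0.
have b00 : (`[0, b]%classic : set R) 0 by rewrite /= in_itv/= lexx ltW.
have /cvgrPdist_lt/(_ e e0) := (subspace_continuousP _ _).1 ct 0 b00.
rewrite near_withinE => /nbhs_ballP[d /= d0 hd].
pose c := Num.min b (d / 2).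
have c0 : 0 < c by rewrite lt_min b0 divr_gt0.
have cb : c <= b by rewrite ge_min lexx.
have cd : c < d.
  by rewrite gt_min; apply/orP; right; rewrite ltr_pdivrMr// ltr_pMr// ltr1n.
have := hd c _ _; rewrite /ball/= sub0r normrN gtr0_norm// in_itv/= (ltW c0) cb cd.
move=> /(_ isT isT); rewrite ltr_norml => /andP[h1 _].
have := pos c; rewrite c0 cb => /(_ isT) h2.
have Lc : 0 <= L * c by rewrite mulr_ge0// ltW.
by move: h1 h2 Lc; rewrite /from_subspace !mulrBr; lra.
Qed.

End Speed.

Section TrajectorySpeed.
Context {R : realType} {n : nat}.
Local Notation mu := (@lebesgue_measure R).
Local Notation RT := (measurableTypeR R).
Variables (A Phi : R -> 'M[R]_n) (s0 : 'cV[R]_n) (U : set 'cV[R]_n) (vR : R).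
Hypotheses (hPhi : fundamental_matrix A Phi) (cU : compact U).
Hypothesis hRP2 : RP2 A Phi s0 U vR.
Local Notation traj := (trajectory Phi s0).
Local Notation Psi := (fun tau => invmx (Phi tau)).
Local Notation I t := (`[0, t]%classic : set RT).

Definition forced (u : R -> 'cV[R]_n) (t : R) : 'cV[R]_n :=
  \col_i \int[mu]_(x in I t) (Psi x *m u x) i 0.

Lemma trajE u t : traj u t = Phi t *m (s0 + forced u t).
Proof. by rewrite /trajectory mulmxDr. Qed.

Lemma costate_bm r u t : controls U u ->
  bounded_measurable (I t) (fun x => pairing (r *m Psi x) (u x)).
Proof.
move=> cu; have -> : (fun x : RT => pairing (r *m Psi x) (u x)) =
    (fun x => \sum_i r 0 i * (Psi x *m u x) i 0).
  by apply/funext => x; rewrite -pairingE /pairing !mulmxA.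
apply: bm_sum => i; apply: bmM; first exact: bm_cst.
exact: (integrand_bm hPhi cU).
Qed.

Lemma pairing_forced r u t : controls U u ->
  pairing r (forced u t) = \int[mu]_(x in I t) pairing (r *m Psi x) (u x).
Proof.
move=> cu; rewrite pairingE.
rewrite (eq_bigr (fun i => \int[mu]_(x in I t) (r 0 i * (Psi x *m u x) i 0))).
  rewrite -bint_sum; last 2 first.
  - exact: fin_segment.
  - move=> i; apply: bmM; first exact: bm_cst.
    exact: (integrand_bm hPhi cU).
  by apply: eq_Rintegral => x _; rewrite -pairingE /pairing !mulmxA.
move=> i _; rewrite [X in _ * X]mxE; apply/esym/bint_Zl; first exact: fin_segment.
exact: (integrand_bm hPhi cU).
Qed.

Lemma measure_diff (a b : R) : 0 <= a <= b ->
  fine (mu (I b `\` I a)) = b - a.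
Proof.
move=> /andP[a0 ab].
have mIa : measurable (I a) by exact: measurable_itv.
have Iab : I a `<=` I b.
  by move=> x /=; rewrite !in_itv/= => /andP[-> xa]; exact: le_trans ab.
have := bint_setD (fin_segment b) (bm_cst _ 1) mIa Iab.
have fD : fin_measurable (I b `\` I a).
  apply: (fin_measurableS (fin_segment b)) => [|x []//].
  by apply: measurableD => //; exact: measurable_itv.
rewrite !fine_mu1//; try exact: fin_segment.
rewrite !lebesgue_measure_itv/= !lte_fin => ->.
have [a0'|] := ltP 0 a; have [b0'|] := ltP 0 b; rewrite /= ?oppr0 ?addr0 //; lra.
Qed.

Lemma near_right (x : R) (P : R -> Prop) : 0 <= x ->
  (\forall y \near within `[0, +oo[%classic (nbhs x), P y) ->
  exists2 d : R, 0 < d & forall y, x <= y < x + d -> P y.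
Proof.
move=> x0; rewrite near_withinE => /nbhs_ballP[d /= d0 hd]; exists d => // y /andP[xy yd].
apply: hd; last by rewrite /= in_itv/= andbT (le_trans x0).
by rewrite /ball/= distrC ger0_norm ?subr_ge0//; lra.
Qed.

Lemma mx_near_right (M : R -> 'M[R]_n) (x e : R) : 0 <= x -> 0 < e ->
  (forall i j, M y i j @[y --> within `[0, +oo[%classic (nbhs x)] --> M x i j) ->
  exists2 d : R, 0 < d & forall y, x <= y < x + d -> enorm (M y - M x) < e.
Proof.
move=> x0 e0 /cvg_mx hM; apply: (near_right x0).
have nM : nbhs (M x) [set N | enorm (N - M x) < e] by apply/nbhs_enormP; exists e.
exact: (hM _ nM).
Qed.

(** A control may be changed at the single time [t], so that the speed limit
    holds for each value in [U] separately. *)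
Lemma speed_limit u t v : controls U u -> 0 <= t -> U v ->
  enorm (A t *m traj u t + v) <= vR.
Proof.
move=> cu t0 Uv; pose E : set RT := [set t].
have mE : measurable E by exact: measurable_set1.
have EI : E `<=` I t by move=> x ->; rewrite /= in_itv/= t0 lexx.
have cv : controls U (fun=> v) by split=> // i; exact: measurable_cst.
have cs := splice_control mE cv cu.
have sE : splice E (fun=> v) u t = v by rewrite /splice mem_set.
have tE : traj (splice E (fun=> v) u) t = traj u t.
  rewrite !trajE; congr (_ *m (_ + _)); apply/matrixP => i j; rewrite !mxE.
  by rewrite (splice_integral hPhi cU)// Rintegral_set1 addr0.
by have [_ h] := hRP2; have := h _ _ cs t0; rewrite tE sE.
Qed.

Lemma pairing_mulmx (q : 'rV[R]_n) (M : 'M[R]_n) (z : 'cV[R]_n) :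
  pairing q (M *m z) = pairing (q *m M) z.
Proof. by rewrite /pairing mulmxA. Qed.

Lemma Phi_right_derivative (q : 'rV[R]_n) (z : 'cV[R]_n) (x e : R) : 0 < x -> 0 < e ->
  exists2 d : R, 0 < d & forall y, x < y < x + d ->
    pairing q (Phi y *m z) - pairing q (Phi x *m z) <=
    (pairing q (A x *m Phi x *m z) + e) * (y - x).
Proof.
move=> x0 e0; have [_ _ _ /(_ x x0) dPhi _] := hPhi.
pose phi (M : 'M[R]_n) := pairing q (M *m z).
have cphi : continuous phi.
  apply: (@continuous_lip _ _ _ _ (enorm q * enorm z)) => M N.
  rewrite /phi -pairingBr -mulmxBl pairing_mulmx.
  apply: le_trans (cauchy_schwarz_norm _ _) _; rewrite mulrAC.
  by rewrite ler_wpM2r ?enorm_ge0// enorm_mulmx.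
have : (fun h => h^-1 *: (Phi (h *: (1 : R) + x) - Phi x)) @ 0^' --> A x *m Phi x.
  by have [/cvg_ex[l hl] <-] := dPhi; rewrite /derive (cvg_lim _ hl).
move=> hcv.
have := @cvg_comp _ _ _ _ phi _ _ _ hcv (cphi (A x *m Phi x)).
move=> /cvgrPdist_lt/(_ e e0)/nbhs_ballP[d /= d0 hd].
exists d => // y /andP[xy yd].
have h0 : 0 < y - x by rewrite subr_gt0.
have := hd (y - x) _ _; rewrite /ball/= sub0r normrN gtr0_norm//.
have -> : y - x < d by lra.
move=> /(_ isT); rewrite gt_eqF// => /(_ isT).
rewrite /phi [(y - x) *: 1]mulr1 subrK -scalemxAl mulmxBl pairingZr pairingBr.
set P := pairing q (A x *m Phi x *m z); set F := pairing q _; set F' := pairing q _.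
rewrite ltr_norml => /andP[h1 _].
rewrite -ler_pdivrMr// mulrC; lra.
Qed.

(** To first order the growth is the sum of the derivative of the fundamental
    matrix and of the integral of [q u]. At each time [tau] of the small
    interval, the speed limit at time [x] for the control value [u tau] bounds
    the sum of the two integrands by [|q| vR]. *)
Lemma speed_local q u (x e : R) : controls U u -> 0 < x -> 0 < e ->
  exists2 d : R, 0 < d & forall y, x < y < x + d ->
    pairing q (traj u y) - pairing q (traj u x) <=
    (enorm q * vR + e) * (y - x).
Proof.
move=> cu xp e0; have x0 := ltW xp.
have [B B0 bB] := compact_enorm_bounded cU.
pose e1 := e / 4 / B; have e10 : 0 < e1 by rewrite !divr_gt0.
have e20 : 0 < e / 2 by rewrite divr_gt0.
have [d1 d10 h1] := Phi_right_derivative q (s0 + forced u x) xp e20.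
have [d2 d20 h2] := near_right x0 (costate_near hPhi q x x0 e10).
have [d3 d30 h3] := mx_near_right x0 ltr01 (fun i j => @Psi_cvg _ _ _ _ hPhi x i j x0).
pose K := enorm (Psi x) + 1; have K0 : 0 < K by rewrite ltr_wpDl// enorm_ge0.
have q1 : 0 < enorm q + 1 by rewrite ltr_wpDl// enorm_ge0.
have e30 : 0 < e1 / K / (enorm q + 1) by rewrite !divr_gt0.
have [d4 d40 h4] := mx_near_right x0 e30 (fun i j => @Phi_cvg _ _ _ _ hPhi x i j x0).
pose d := Num.min (Num.min d1 d2) (Num.min d3 d4).
exists d => [|y /andP[xy]]; first by rewrite !lt_min d10 d20 d30.
rewrite -ltrBlDl !lt_min !ltrBlDl => /andP[/andP[y1 y2] /andP[y3 y4]].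
have cx : costate Phi q x x = q by rewrite /costate mulmxK// (Phi_unit hPhi).
have near_q tau : x <= tau <= y -> enorm (costate Phi q y tau - q) <= e / 2 / B.
  move=> /andP[xt ty].
  have -> : costate Phi q y tau - q = (q *m (Phi y - Phi x) *m Psi x +
      q *m (Phi y - Phi x) *m (Psi tau - Psi x)) + (costate Phi q x tau - costate Phi q x x).
    by rewrite cx /costate !(mulmxBr, mulmxBl); apply/matrixP => i j; rewrite !mxE; ring.
  have eP : enorm (q *m (Phi y - Phi x)) <= e1 / K.
    apply: le_trans (enorm_mulmx _ _) _.
    have hy : enorm (Phi y - Phi x) <= e1 / K / (enorm q + 1).
      by apply/ltW/h4; rewrite (ltW xy).
    apply: le_trans (ler_wpM2l (enorm_ge0 _) hy) _.
    have eK : 0 <= e1 / K by rewrite divr_ge0 ?(ltW e10) ?(ltW K0).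
    move: eK; set a := e1 / K => eK.
    by rewrite mulrA ler_pdivrMr// mulrC ler_wpM2l// lerDl.
  have b1 : enorm (costate Phi q x tau - costate Phi q x x) <= e1.
    by apply/ltW/h2; rewrite xt (le_lt_trans ty).
  have b2 : enorm (q *m (Phi y - Phi x) *m Psi x) <= e1 / K * enorm (Psi x).
    apply: le_trans (enorm_mulmx _ _) _; exact: ler_wpM2r (enorm_ge0 _) _ _ eP.
  have b3 : enorm (q *m (Phi y - Phi x) *m (Psi tau - Psi x)) <= e1 / K * 1.
    apply: le_trans (enorm_mulmx _ _) _; apply: ler_pM => //; rewrite ?enorm_ge0//.
    by apply/ltW/h3; rewrite xt (le_lt_trans ty).
  have b4 : e1 / K * enorm (Psi x) + e1 / K * 1 = e1.
    by rewrite -mulrDr divfK// gt_eqF.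
  have b5 : e / 2 / B = e1 + e1 by rewrite /e1; field; rewrite gt_eqF.
  rewrite b5 (le_trans (enormD_row _ _))// lerD// (le_trans (enormD_row _ _))//.
  by rewrite -b4 lerD.
pose z := s0 + forced u x.
have split_f : pairing q (traj u y) - pairing q (traj u x) =
    (pairing q (Phi y *m z) - pairing q (Phi x *m z)) +
    (pairing (q *m Phi y) (forced u y) - pairing (q *m Phi y) (forced u x)).
  rewrite !trajE /z !pairing_mulmx !(pairingDr (_ *m _)).
  move: (pairing _ _) (pairing _ _) (pairing _ _) (pairing _ _) => X1 X2 X3 X4; ring.
have y0 : 0 <= y := le_trans x0 (ltW xy).
have Ixy : I x `<=` I y.
  by move=> tau /=; rewrite !in_itv/= => /andP[-> tx]; exact: le_trans (ltW xy).
have mIx : measurable (I x) by exact: measurable_itv.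
have mE : measurable (I y `\` I x) by apply: measurableD => //; exact: measurable_itv.
have fE : fin_measurable (I y `\` I x).
  by apply: (fin_measurableS (fin_segment y)) => // tau [].
have bcy := costate_bm (q *m Phi y) y cu.
have bcE : bounded_measurable (I y `\` I x) (fun tau => pairing (q *m Phi y *m Psi tau) (u tau)).
  by apply: bounded_measurableS bcy => [|tau []//]; exact: measurable_itv.
pose Dq := pairing q (A x *m Phi x *m z).
pose c := enorm q * vR - Dq + e / 2.
have int_le : pairing (q *m Phi y) (forced u y) - pairing (q *m Phi y) (forced u x)
    <= c * (y - x).
  rewrite !pairing_forced// -(bint_setD (fin_segment y) bcy mIx Ixy).
  have xyb : 0 <= x <= y by rewrite x0 ltW.
  rewrite -(measure_diff xyb) -Rintegral_cst//.
  apply: le_Rintegral => //; [exact: bm_integrable|exact/bm_integrable/bm_cst|].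
  move=> tau [Iy nIx]; move: Iy; rewrite /= in_itv/= => /andP[t0 ty].
  have xt : x <= tau.
    by rewrite leNgt; apply/negP => tx; apply: nIx; rewrite /= in_itv/= t0 ltW.
  have Uu : U (u tau) by exact: cu.2.
  have ht := near_q tau; rewrite xt ty in ht; have {}ht := ht isT.
  have h5 : pairing (costate Phi q y tau - q) (u tau) <= e / 2.
    apply: le_trans (cauchy_schwarz _ _) _.
    apply: le_trans (ler_pM (enorm_ge0 _) (enorm_ge0 _) ht (bB _ Uu)) _.
    by rewrite divfK// gt_eqF.
  have h6 : pairing q (A x *m traj u x + u tau) <= enorm q * vR.
    apply: le_trans (cauchy_schwarz _ _) _.
    by rewrite ler_wpM2l ?enorm_ge0//; exact: speed_limit.
  move: h5 h6; rewrite pairingBl pairingDr trajE mulmxA -/z -/Dq /c.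
  rewrite -[q *m Phi y *m Psi tau]/(costate Phi q y tau).
  clear; move: (pairing (costate _ _ _ _) _) (pairing q (u tau)).
  move=> X Y; lra.
rewrite split_f.
have h7 : pairing q (Phi y *m z) - pairing q (Phi x *m z) <= (Dq + e / 2) * (y - x).
  by apply: h1; rewrite xy.
apply: (le_trans (lerD h7 int_le)); rewrite -mulrDl /c.
by rewrite le_eqVlt; apply/orP; left; apply/eqP; congr (_ * _); field.
Qed.

Lemma forced_continuous u b i : 0 <= b -> controls U u ->
  {within `[0, b], continuous (fun t => forced u t i 0)}.
Proof.
move=> b0 cu; have bi := integrand_bm hPhi cU b i cu.
have := parameterized_integral_continuous b0 (bm_integrable (fin_segment b) bi).
by under [X in _ -> {within _, continuous X}]eq_fun do rewrite mxE.
Qed.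

Lemma traj_continuous q u (b : R) : 0 <= b -> controls U u ->
  {within `[0, b], continuous (fun t => pairing q (traj u t))}.
Proof.
move=> b0 cu; have sub : (`[0, b]%classic : set R) `<=` `[0, +oo[%classic.
  by move=> x /=; rewrite !in_itv/= andbT => /andP[].
have cPhi i j : {within `[0, b], continuous (fun t => Phi t i j)}.
  apply: (continuous_subspaceW sub); apply/subspace_continuousP => t.
  by rewrite /= in_itv/= andbT => t0; exact: (Phi_cvg hPhi).
have -> : (fun t => pairing q (traj u t)) = (fun t => \sum_i \sum_j
    q 0 i * (Phi t i j * (s0 j 0 + forced u t j 0))).
  apply/funext => t; rewrite trajE pairingE; apply: eq_bigr => i _.
  by rewrite mxE mulr_sumr; apply: eq_bigr => j _; rewrite mxE.
move=> x; apply: cvg_sum_fin => i; apply: cvg_sum_fin => j.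
apply: cvgM; first exact: cvg_cst.
apply: cvgM; first exact: cPhi.
apply: cvgD; first exact: cvg_cst.
exact: forced_continuous.
Qed.

Lemma traj_growth q u (a b : R) : controls U u -> 0 <= a <= b ->
  pairing q (traj u b) - pairing q (traj u a) <= enorm q * vR * (b - a).
Proof.
move=> cu.
have pos c : 0 < c <= b -> pairing q (traj u b) - pairing q (traj u c) <= enorm q * vR * (b - c).
  move=> /andP[c0 cb]; apply: (@dini_growth R (fun t => pairing q (traj u t))) => //.
    have sub : (`[c, b]%classic : set R) `<=` `[0, b]%classic.
      by move=> x /=; rewrite !in_itv/= => /andP[cx ->]; rewrite (le_trans (ltW c0)).
    apply: (continuous_subspaceW sub); apply: traj_continuous => //.
    exact: le_trans (ltW c0) cb.
  move=> x e /andP[cx xb] e0; have x0 := lt_le_trans c0 cx.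
  have [d d0 hd] := speed_local q cu x0 e0.
  exists (Num.min b (x + d / 2)).
    by rewrite lt_min xb ltrDl divr_gt0//= ge_min lexx.
  apply: hd; rewrite lt_min xb ltrDl divr_gt0//=.
  by rewrite gt_min; apply/orP; right; rewrite ltrD2l ltr_pdivrMr// ltr_pMr// ltr1n.
move=> /andP[]; rewrite le_eqVlt => /orP[/eqP <-{a}|a0] ab; last first.
  by apply: pos; rewrite a0.
move: ab; rewrite le_eqVlt => /orP[/eqP <-|b0]; first by rewrite !subrr mulr0.
apply: (@growth_at_0 R (fun t => pairing q (traj u t))) => //.
- exact: traj_continuous (ltW b0) cu.
- by rewrite mulr_ge0 ?enorm_ge0// ltW//; exact: hRP2.1.
Qed.

Lemma traj_lipschitz u (a b : R) : controls U u -> 0 <= a <= b ->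
  enorm (traj u b - traj u a) <= vR * (b - a).
Proof.
move=> cu ab; set v := _ - _.
have [->|v0] := eqVneq v 0.
  by rewrite enorm0 mulr_ge0 ?(ltW hRP2.1)// subr_ge0; case/andP: ab.
have := traj_growth v^T cu ab; rewrite -pairingBr -/v -enorm_sq enorm_tr -mulrA expr2.
by rewrite ler_pM2l// enorm_gt0.
Qed.

Lemma traj0 u : traj u 0 = s0.
Proof.
have [P0 _ _ _ _] := hPhi; rewrite trajE P0 mul1mx.
apply/matrixP => i j; rewrite !mxE set_itv1 Rintegral_set1 addr0.
by rewrite (ord1 j).
Qed.

End TrajectorySpeed.

(** * Contact points and closedness of the reachable set *)

Section ReachableBody.
Context {R : realType} {n : nat}.
Local Notation mu := (@lebesgue_measure R).
Local Notation RT := (measurableTypeR R).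
Variables (A Phi : R -> 'M[R]_n) (s0 : 'cV[R]_n) (U : set 'cV[R]_n) (vR : R).
Hypotheses (hPhi : fundamental_matrix A Phi) (cU : compact U) (U0 : U !=set0).
Hypothesis hRP1 : RP1 Phi s0 U.
Hypothesis hRP2 : RP2 A Phi s0 U vR.
Local Notation traj := (trajectory Phi s0).
Local Notation Psi := (fun tau => invmx (Phi tau)).
Local Notation D := (`[0, +oo[%classic : set RT).
Local Notation I t := (`[0, t]%classic : set RT).
Local Notation extremal := (extremal Phi U).

(** At a time where the maximizer for [p] is unique, it is stable under
    perturbation of the direction. *)
Lemma extremal_pointwise (q : nat -> 'rV[R]_n) (p : 'rV[R]_n) (t : R) u v (x : R) :
  (forall e : R, 0 < e -> \forall k \near \oo, enorm (q k - p) < e) ->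
  extremal p t u -> (forall k, extremal (q k) t (v k)) -> 0 <= x ->
  (forall z, max_controls Phi U p t x z -> z = u x) ->
  forall e : R, 0 < e -> \forall k \near \oo, enorm (v k x - u x) < e.
Proof.
move=> hq hu hv x0 uni e e0.
have [Uu maxu] := hu.2 x x0.
have uni' s : U s -> pairing (costate Phi p t x) s = pairing (costate Phi p t x) (u x) ->
    s = u x.
  by move=> Us es; apply: uni; split=> // s' Us'; rewrite es; exact: maxu.
have [d d0 hd] := maximizer_stable cU Uu maxu uni' e0.
pose K := enorm (Phi t *m Psi x) + 1.
have K0 : 0 < K by rewrite ltr_wpDl// enorm_ge0.
have dK : 0 < d / K by rewrite divr_gt0.
apply: filterS (hq _ dK) => k hk; have [Uv maxv] := (hv k).2 x x0.
apply: (hd _ _ Uv maxv).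
have -> : costate Phi (q k) t x - costate Phi p t x = (q k - p) *m (Phi t *m Psi x).
  by rewrite /costate !mulmxBl !mulmxA.
apply: le_lt_trans (enorm_mulmx _ _) _; rewrite ltr_pdivlMr// in hk.
by apply: le_lt_trans hk; rewrite ler_wpM2l ?enorm_ge0// lerDl.
Qed.

(** By dominated convergence, since the controls converge almost everywhere. *)
Lemma extremal_continuous (q : nat -> 'rV[R]_n) (p : 'rV[R]_n) (t : R) u v r :
  (forall e : R, 0 < e -> \forall k \near \oo, enorm (q k - p) < e) ->
  0 <= t -> p != 0 -> extremal p t u -> (forall k, extremal (q k) t (v k)) ->
  pairing r (traj (v k) t) @[k --> \oo] --> pairing r (traj u t).
Proof.
move=> hq t0 p0 hu hv.
rewrite (pairing_traj s0 hPhi cU r t hu.1).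
under eq_fun do rewrite (pairing_traj s0 hPhi cU r t (hv _).1).
apply: cvgD; first exact: cvg_cst.
have [B B0 bB] := compact_enorm_bounded cU.
have mI := (fin_segment t).1.
have bm w : controls U w -> bounded_measurable (I t) (fun x => pairing (costate Phi r t x) (w x)).
  by move=> cw; exact: (costate_bm hPhi cU).
have hae : {ae mu, forall x : RT, I t x ->
    (fun k => (pairing (costate Phi r t x) (v k x))%:E) @ \oo -->
    (pairing (costate Phi r t x) (u x))%:E}.
  have := extremal_ae hPhi cU U0 hRP1 t0 p0 hu; apply: ae_sub => x hx xI.
  have x0 : 0 <= x by move: xI; rewrite /= in_itv/= => /andP[].
  apply: cvg_EFin; first by apply: nearW.
  apply/cvgrPdist_lt => e e0; pose K := enorm (costate Phi r t x) + 1.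
  have K0 : 0 < K by rewrite ltr_wpDl// enorm_ge0.
  have eK : 0 < e / K by rewrite divr_gt0.
  apply: filterS (extremal_pointwise hq hu hv x0 (hx xI) eK) => k hk /=.
  rewrite -pairingBr (le_lt_trans (cauchy_schwarz_norm _ _))// enormBC.
  rewrite ltr_pdivlMr// in hk; rewrite mulrC; apply: le_lt_trans hk.
  by rewrite ler_wpM2l ?enorm_ge0// lerDl.
pose g x := \sum_i `|costate Phi r t x 0 i| * B.
have bg : bounded_measurable (I t) g.
  apply: bm_sum => i; apply: bmM; last exact: bm_cst.
  have [mc [M hM]] : bounded_measurable (I t) (fun x => costate Phi r t x 0 i).
    have -> : (fun x : RT => costate Phi r t x 0 i) =
        (fun x => \sum_j (r *m Phi t) 0 j * Psi x j i).
      by apply/funext => x; rewrite mxE.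
    apply: bm_sum => j; apply: bmM; [exact: bm_cst|exact: (Psi_bm hPhi)].
  split; first exact: measurableT_comp.
  by exists M => x xI; rewrite normr_id hM.
have [] := @dominated_convergence _ _ _ mu (I t) mI
  (fun k x => (pairing (costate Phi r t x) (v k x))%:E)
  (fun x => (pairing (costate Phi r t x) (u x))%:E) (EFin \o g) _ _ hae _ _.
- by move=> k; apply/measurable_EFinP; exact: (bm _ (hv k).1).1.
- by apply/measurable_EFinP; exact: (bm _ hu.1).1.
- exact: bm_integrable (fin_segment t) bg.
- apply: aeW => x k; rewrite /= in_itv/= lee_fin => /andP[x0 _].
  rewrite pairingE (le_trans (ler_norm_sum _ _ _))//; apply: ler_sum => i _.
  rewrite normrM ler_wpM2l// (le_trans (coord_le_enorm _ _ _))// bB//.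
  exact: (hv k).1.2.
move=> iu _ hcv; apply: fine_cvg.
rewrite fineK; first exact: hcv.
exact: integrable_fin_num.
Qed.

Lemma extremal_reachable p t u : extremal p t u -> reachable Phi s0 U t (traj u t).
Proof. by move=> hu; exists u => //; exact: hu.1. Qed.

Lemma reachable_extremal p t u x : 0 <= t -> extremal p t u ->
  reachable Phi s0 U t x -> pairing p x <= pairing p (traj u t).
Proof. by move=> t0 hu [w cw <-]; exact: (extremal_max s0 hPhi cU t0 hu). Qed.

Lemma closed_halfspace (q : 'rV[R]_n) (c : R) : closed [set z | pairing q z <= c].
Proof.
rewrite [X in closed X](_ : _ = pairing q @^-1` [set y | y <= c])//.
by apply: closed_comp => [y _|]; [exact: pairing_continuous|exact: closed_le].
Qed.

Lemma closure_extremal p t u x : 0 <= t -> extremal p t u ->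
  closure (reachable Phi s0 U t) x -> pairing p x <= pairing p (traj u t).
Proof.
move=> t0 hu; pose H := [set z | pairing p z <= pairing p (traj u t)].
suff : closure (reachable Phi s0 U t) `<=` H by exact.
rewrite [H](closure_id _).1; last exact: closed_halfspace.
by apply: closureS => y; exact: reachable_extremal.
Qed.

(** If [p] is moved slightly towards [r], the maximizers of the perturbed
    directions beat [x] in direction [r], for [x] does as well as any point in
    direction [p]; they converge to the maximizer of [p]. As [r] is arbitrary,
    [x] is this maximizer. *)
Lemma face_singleton (p : 'rV[R]_n) (t : R) u x : 0 <= t -> p != 0 ->
  extremal p t u -> closure (reachable Phi s0 U t) x ->
  pairing p (traj u t) <= pairing p x -> x = traj u t.
Proof.
move=> t0 p0 hu cx px.
suff h r : pairing r x <= pairing r (traj u t).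
  apply/eqP; rewrite -subr_eq0 -enorm_eq0 -sqrf_eq0 eq_le sqr_ge0 andbT enorm_sq.
  by rewrite pairingBr subr_le0.
pose q (k : nat) := p + k.+1%:R^-1 *: r.
have hq (e : R) : 0 < e -> \forall k \near \oo, enorm (q k - p) < e.
  move=> e0; pose K := enorm r + 1.
  have K0 : 0 < K by rewrite ltr_wpDl// enorm_ge0.
  have eK : 0 < e / K by rewrite divr_gt0.
  have := @near_infty_natSinv_lt R (PosNum eK); apply: filterS => k /= hk.
  rewrite /q addrAC subrr add0r enormZ ger0_norm ?invr_ge0 ?ler0n//.
  rewrite ltr_pdivlMr// in hk; apply: le_lt_trans hk.
  by rewrite ler_wpM2l ?invr_ge0 ?ler0n// lerDl.
pose v k := projT1 (cid (extremal_exists hPhi cU U0 (q k) t)).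
have hv k : extremal (q k) t (v k) by rewrite /v; case: cid.
have cv := @extremal_continuous q p t u v r hq t0 p0 hu hv.
rewrite leNgt; apply/negP => lt.
have [k hk] := filter_ex (cvgr_lt _ cv _ lt).
have h1 := closure_extremal t0 (hv k) cx.
have h2 := extremal_max s0 hPhi cU t0 hu (hv k).1.
have c0 : 0 < k.+1%:R^-1 :> R by rewrite invr_gt0 ltr0Sn.
move: h1; rewrite /q !(pairingDl p) !pairingZl.
rewrite leNgt => /negP; apply.
apply: ler_ltD; first exact: le_trans h2 px.
by rewrite ltr_pM2l.
Qed.

Lemma reachable_bounded t : 0 <= t ->
  exists B : R, forall x, reachable Phi s0 U t x -> enorm x <= B.
Proof.
move=> t0; exists (enorm s0 + vR * t) => x [u cu <-].
have := traj_lipschitz hPhi cU hRP2 cu (_ : 0 <= 0 <= t); rewrite lexx => /(_ t0).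
rewrite (traj0 _ hPhi) subr0 => h.
have -> : traj u t = s0 + (traj u t - s0) by rewrite addrC subrK.
by rewrite (le_trans (enormD_col _ _))// lerD2l.
Qed.

Lemma reachable_neq0 t : reachable Phi s0 U t !=set0.
Proof.
have [u0 Uu0] := U0; exists (traj (fun=> u0) t), (fun=> u0); last by [].
by split=> [i|_ _]; [exact: measurable_cst|].
Qed.

Lemma closure_reachable_convex t x y (l : R) : 
  closure (reachable Phi s0 U t) x -> closure (reachable Phi s0 U t) y ->
  0 <= l <= 1 -> closure (reachable Phi s0 U t) (l *: x + (1 - l) *: y).
Proof.
move=> cx cy l01 B /nbhs_enormP[e e0 eB].
have e2 : 0 < e / 2 by rewrite divr_gt0.
have near (z : 'cV[R]_n) : nbhs z [set z' | enorm (z' - z) < e / 2].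
  by apply/nbhs_enormP; exists (e / 2).
have [x' [Rx' hx']] := cx _ (near x); have [y' [Ry' hy']] := cy _ (near y).
exists (l *: x' + (1 - l) *: y'); split.
  exact: (reachable_convex hPhi cU).
apply: eB; have /andP[l0 l1] := l01.
have -> : l *: x' + (1 - l) *: y' - (l *: x + (1 - l) *: y) =
    l *: (x' - x) + (1 - l) *: (y' - y).
  by apply/matrixP => i j; rewrite !mxE; ring.
apply: (le_lt_trans (enormD_col _ _)); rewrite !enormZ !ger0_norm ?subr_ge0//.
move: hx' hy' => /= hx' hy'; rewrite (splitr e) ler_ltD//.
  by rewrite (le_trans _ (ltW hx'))// ler_piMl// enorm_ge0.
by rewrite (le_lt_trans _ hy')// ler_piMl ?enorm_ge0//; lra.
Qed.

Lemma closure_reachable_body t : 0 <= t ->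
  convex_body (closure (reachable Phi s0 U t)).
Proof.
move=> t0; split; last by move=> x y l; exact: closure_reachable_convex.
have [B hB] := reachable_bounded t0.
apply: (@compact_col _ _ _ B); first exact: closed_closure.
pose H := [set z : 'cV[R]_n | enorm z <= B].
have cH : closed H.
  rewrite [X in closed X](_ : _ = (@enorm R n 1) @^-1` [set y | y <= B])//.
  by apply: closed_comp => [y _|]; [exact: enorm_continuous_col|exact: closed_le].
suff : closure (reachable Phi s0 U t) `<=` H by move=> h s /h.
by rewrite [H](closure_id _).1//; apply: closureS => y; exact: hB.
Qed.

(** If [z] were a maximizer in no direction, the gap between the support function
    and [p z] would be positive and thus bounded below on the sphere, and a ball
    around [z] would be contained in the closure. *)
Lemma exit_point_reachable (t : R) z : 0 <= t -> closure (reachable Phi s0 U t) z ->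
  (forall e : R, 0 < e -> exists2 z', enorm (z' - z) < e &
     ~ closure (reachable Phi s0 U t) z') ->
  reachable Phi s0 U t z.
Proof.
move=> t0 cz out.
have bK := closure_reachable_body t0.
have K0 : closure (reachable Phi s0 U t) !=set0.
  by have [x Rx] := reachable_neq0 t; exists x; exact: subset_closure.
pose v p := projT1 (cid (extremal_exists hPhi cU U0 p t)).
have hv p : extremal p t (v p) by rewrite /v; case: cid.
pose gap p := pairing p (traj (v p) t) - pairing p z.
have [B B0 bB] := compact_enorm_bounded bK.1.
have gap_lip p q : `|gap p - gap q| <= 2 * B * enorm (p - q).
  have half p' q' : gap p' - gap q' <= 2 * B * enorm (p' - q').
    have h := closure_extremal t0 (hv q') (subset_closure (extremal_reachable (hv p'))).
    have h1 := cauchy_schwarz (p' - q') (traj (v p') t - z).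
    have h2 : enorm (traj (v p') t - z) <= 2 * B.
      rewrite (le_trans (enormB_col _ _))// mulr_natl mulr2n lerD// bB//.
      exact/subset_closure/extremal_reachable.
    have h3 := ler_wpM2l (enorm_ge0 (p' - q')) h2.
    rewrite mulrC; apply: le_trans (le_trans h1 h3).
    by rewrite /gap pairingBl !pairingBr lerD2l lerN2 lerD2r.
  by rewrite ler_norml half andbT lerNl opprB enormBC half.
have cgap : {within [set p : 'rV[R]_n | enorm p = 1], continuous gap}.
  by apply: continuous_subspaceT; exact: continuous_lip gap_lip.
have [z1 _ nz1] := out 1 ltr01.
have [p1 p11 _] := separation bK K0 nz1.
have [p /set_mem p1E minp] :=
  compact_EVT_min (ex_intro _ p1 p11 : [set p : 'rV[R]_n | enorm p = 1] !=set0)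
   (@sphere_compact R n) cgap.
have pn0 : p != 0 := unit_neq0 p1E.
have [gp|gp] := leP (gap p) 0.
  have -> : z = traj (v p) t.
    by apply: (face_singleton t0 pn0 (hv p) cz); rewrite -subr_le0.
  exact: extremal_reachable (hv p).
have [z' zz' nz'] := out _ gp.
have [r r1 [c c0 hc]] := separation bK K0 nz'.
have zt : pairing r z' < pairing r (traj (v r) t).
  have cs := cauchy_schwarz r (z' - z); rewrite r1 mul1r pairingBr in cs.
  rewrite -(ltrD2r (- pairing r z)); apply: (le_lt_trans cs).
  exact: lt_le_trans zz' (minp r (mem_set r1)).
have := hc _ (subset_closure (extremal_reachable (hv r))).
by rewrite leNgt (lt_le_trans zt)// lerDl ltW.
Qed.

(** The ray from a reachable point [r0] through [x] leaves the closure at a point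
    [ray m], which is reachable, and [x] lies between the two. *)
Lemma reachable_closed (t : R) : 0 <= t ->
  closure (reachable Phi s0 U t) `<=` reachable Phi s0 U t.
Proof.
move=> t0 x cx; have bK := closure_reachable_body t0.
have [r0 Rr0] := reachable_neq0 t.
have [->//|xr0] := eqVneq x r0.
have exr : 0 < enorm (x - r0) by rewrite enorm_gt0 subr_eq0.
have [B B0 bB] := compact_enorm_bounded bK.1.
pose ray (l : R) := r0 + l *: (x - r0).
have ray_lip l l' : enorm (ray l - ray l') = `|l - l'| * enorm (x - r0).
  by rewrite -enormZ; congr enorm; apply/matrixP => i j; rewrite !mxE; ring.
pose S := [set l : R | 0 <= l /\ closure (reachable Phi s0 U t) (ray l)].
have cr0 : closure (reachable Phi s0 U t) r0 by exact: subset_closure.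
have S1 : S 1 by split=> //; rewrite /ray scale1r addrC subrK.
have Sb l : S l -> l <= 2 * B / enorm (x - r0).
  move=> [l0 hl]; rewrite ler_pdivlMr// -[X in X * _](ger0_norm l0) -enormZ.
  have -> : l *: (x - r0) = ray l - r0 by rewrite /ray addrAC subrr add0r.
  by rewrite (le_trans (enormB_col _ _))// mulr_natl mulr2n lerD// bB.
have hS : has_sup S by split; [exists 1|exists (2 * B / enorm (x - r0)) => l /Sb].
pose m := sup S.
have m1 : 1 <= m by exact: sup_upper_bound.
have Sm : closure (reachable Phi s0 U t) (ray m).
  move=> V /nbhs_enormP[e e0 eV].
  have eE : 0 < e / enorm (x - r0) by rewrite divr_gt0.
  have [l Sl ml] := sup_adherent eE hS.
  have lm : l <= m by exact: sup_upper_bound.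
  have nV : nbhs (ray l) V.
    apply/nbhs_enormP; exists (e - enorm (ray l - ray m)).
      rewrite subr_gt0 ray_lip -ltr_pdivlMr// distrC ger0_norm ?subr_ge0//.
      by move: ml; rewrite -/m; lra.
    move=> y hy; apply: eV; have -> : y - ray m = (y - ray l) + (ray l - ray m).
      by rewrite addrA subrK.
    by rewrite (le_lt_trans (enormD_col _ _))//; move: hy; lra.
  exact: Sl.2 V nV.
have Rm : reachable Phi s0 U t (ray m).
  apply: exit_point_reachable => // e e0.
  have eE : 0 < e / 2 / enorm (x - r0) by rewrite !divr_gt0.
  exists (ray (m + e / 2 / enorm (x - r0))).
    rewrite ray_lip addrAC subrr add0r gtr0_norm// divfK ?gt_eqF//; lra.
  move=> cm; have : S (m + e / 2 / enorm (x - r0)).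
    by split=> //; rewrite addr_ge0 ?(ltW eE)// (le_trans ler01 m1).
  by move=> /(sup_upper_bound hS); rewrite -/m leNgt ltrDl eE.
have m0 : 0 < m by exact: lt_le_trans ltr01 m1.
have -> : x = m^-1 *: ray m + (1 - m^-1) *: r0.
  rewrite /ray; apply/matrixP => i j; rewrite !mxE; field; exact: lt0r_neq0.
apply: (reachable_convex hPhi cU) => //.
by rewrite invr_ge0 (ltW m0)/= invf_le1.
Qed.

Lemma reachable_body t : 0 <= t -> convex_body (reachable Phi s0 U t).
Proof.
move=> t0; have -> : reachable Phi s0 U t = closure (reachable Phi s0 U t).
  by apply/seteqP; split; [exact: subset_closure|exact: reachable_closed].
exact: closure_reachable_body.
Qed.

Lemma reachable_support t : 0 <= t ->
  support_map (reachable Phi s0 U t) (contact (reachable Phi s0 U t)).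
Proof.
move=> t0 p p0; have bR := reachable_body t0.
have [Rc maxc] := compact_maximizer p bR.1 (reachable_neq0 t).
have [u hu] := extremal_exists hPhi cU U0 p t.
have face x : reachable Phi s0 U t x -> pairing p (traj u t) <= pairing p x ->
    x = traj u t.
  by move=> Rx; apply: (face_singleton t0 p0 hu); exact: subset_closure.
have cE := face _ Rc (maxc _ (extremal_reachable hu)).
split=> // s Rs ps; rewrite cE; apply: face => //.
by rewrite ps maxc//; exact: extremal_reachable hu.
Qed.

End ReachableBody.

(** * Differences of convex bodies *)

Section Differences.
Context {R : realType} {n : nat}.
Implicit Types (X Y M : set 'cV[R]_n) (p : 'rV[R]_n).

Definition difference_body X Y : set 'cV[R]_n :=
  [set xy.1 - xy.2 | xy in X `*` Y].

Lemma difference_convex_body X Y : convex_body X -> convex_body Y ->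
  convex_body (difference_body X Y).
Proof.
move=> [cX vX] [cY vY]; split.
  apply: continuous_compact; last exact: compact_setX.
  apply: continuous_subspaceT => z; apply: cvgB; [exact: cvg_fst|exact: cvg_snd].
move=> _ _ l [[x y] [/= Xx Yy] <-] [[x' y'] [/= Xx' Yy'] <-] l01.
exists (l *: x + (1 - l) *: x', l *: y + (1 - l) *: y') => /=.
  by split; [exact: vX|exact: vY].
by rewrite !scalerBr opprD addrACA.
Qed.

Lemma difference_support X Y (wX wY : 'rV[R]_n -> 'cV[R]_n) :
  support_map X wX -> support_map Y wY ->
  support_map (difference_body X Y) (fun p => wX p - wY (- p)).
Proof.
move=> sX sY p p0; have [Xp maxX uX] := sX _ p0.
have [|Yp maxY uY] := sY (- p); first by rewrite oppr_eq0.
split; first by exists (wX p, wY (- p)).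
  move=> _ [[x y] [/= Xx Yy] <-]; rewrite !pairingBr lerB ?maxX//.
  by have := maxY _ Yy; rewrite !pairingNl lerN2.
move=> _ [[x y] [/= Xx Yy] <-]; rewrite !pairingBr => e.
have ex := maxX _ Xx; have ey := maxY _ Yy; rewrite !pairingNl lerN2 in ey.
by congr (_ - _); [apply: uX|apply: uY] => //; rewrite ?pairingNl; lra.
Qed.

Lemma strictly_convex_body M : compact M -> strictly_convex M -> convex_body M.
Proof.
move=> cM sM; split=> // x y l Mx My /andP[l0 l1].
have [->|xy] := pselect (x = y).
  by rewrite -scalerDl addrC subrK scale1r.
have [->|ln0] := eqVneq l 0; first by rewrite scale0r add0r subr0 scale1r.
have [->|ln1] := eqVneq l 1; first by rewrite subrr scale0r addr0 scale1r.
by apply: interior_subset; apply: sM => //; rewrite lt_neqAle ?l0 ?l1 ?(eq_sym 0) ?ln0 ?ln1.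
Qed.

(** The midpoint of two maximizers would be both interior and a maximizer. *)
Lemma strictly_convex_support M : compact M -> M !=set0 -> strictly_convex M ->
  support_map M (contact M).
Proof.
move=> cM M0 sM p p0; have [Mc maxc] := compact_maximizer p cM M0.
split=> // s Ms ps; apply: contrapT => sc.
have h2 : 0 < 2^-1 :> R by rewrite invr_gt0.
have h21 : 2^-1 < 1 :> R by rewrite invf_lt1// ltr1n.
have mid := sM _ _ Ms Mc sc _ h2 h21.
suff max_mid y : M y ->
    pairing p y <= pairing p (2^-1 *: s + (1 - 2^-1) *: contact M p).
  by have [_ []] := maximizer_boundary p0 (interior_subset mid) max_mid.
move=> My; rewrite pairingDr !pairingZr ps.
by rewrite -mulrDl addrC subrK mul1r maxc.
Qed.

End Differences.

(** * Speed of contact points *)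

Section SupportLipschitz.
Context {R : realType} {n : nat}.

Lemma pairing_is_derive (s : R -> 'cV[R]_n) (p : 'rV[R]_n) (t : R) :
  derivable s t 1 ->
  is_derive t (1 : R) (fun x => pairing p (s x)) (pairing p (derive1 s t)).
Proof.
move=> ds; rewrite derive1E.
have h : h^-1 *: (pairing p (s (h *: 1 + t)) - pairing p (s t)) @[h --> 0^']
    --> pairing p ('D_1 s t).
  under eq_fun do rewrite -pairingBr /GRing.scale /= -pairingZr.
  have c := @pairing_continuous R n p ('D_1 s t).
  have ds' : (fun h : R => h^-1 *: (s (h *: 1 + t) - s t)) @ 0^' --> 'D_1 s t by exact: ds.
  exact: cvg_comp ds' c.
by apply: DeriveDef; [apply/cvg_ex; eexists; exact: h|exact: cvg_lim h].
Qed.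

Lemma pairing_speed (s : R -> 'cV[R]_n) (p : 'rV[R]_n) (v a b : R) :
  (forall t, derivable s t 1) -> (forall t, enorm (derive1 s t) <= v) ->
  pairing p (s a) <= pairing p (s b) + enorm p * v * `|a - b|.
Proof.
move=> ds sv.
have der x : is_derive x (1 : R) (fun x => pairing p (s x)) (pairing p (derive1 s x)).
  exact: pairing_is_derive.
have lip c d : c <= d -> `|pairing p (s d) - pairing p (s c)| <= enorm p * v * (d - c).
  move=> cd.
  have cp : {within `[c, d], continuous (fun x => pairing p (s x))}.
    by apply: derivable_within_continuous => x _; have [] := der x.
  have [x _ ->] := MVT_segment cd (fun x _ => der x) cp.
  rewrite normrM (ger0_norm (_ : 0 <= d - c)) ?subr_ge0//.
  rewrite ler_wpM2r ?subr_ge0// (le_trans (cauchy_schwarz_norm _ _))//.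
  by rewrite ler_wpM2l ?enorm_ge0.
rewrite -lerBlDl (le_trans (ler_norm _))//.
have [ab|/ltW ba] := leP a b; last by rewrite (ger0_norm (_ : 0 <= a - b)) ?subr_ge0 ?lip.
by rewrite distrC (distrC a) (ger0_norm (_ : 0 <= b - a)) ?subr_ge0 ?lip.
Qed.

End SupportLipschitz.

(** * The optimal time *)

Section Hitting.
Context {R : realType} {n : nat}.
Variables (A Phi : R -> 'M[R]_n) (s0 : 'cV[R]_n) (U : set 'cV[R]_n).
Variables (G : R -> set 'cV[R]_n) (vR vG : R).
Hypotheses (hPhi : fundamental_matrix A Phi) (cU : compact U) (U0 : U !=set0).
Hypothesis hRP1 : RP1 Phi s0 U.
Hypothesis hRP2 : RP2 A Phi s0 U vR.
Hypothesis hRT4 : RT4 G vG.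
Local Notation reach := (reachable Phi s0 U).
Local Notation gap t := (difference_body (reach t) (G t)).

Lemma gap_body t : 0 <= t -> convex_body (gap t).
Proof.
move=> t0; apply: difference_convex_body.
  exact: (reachable_body hPhi cU U0 hRP1 hRP2 t0).
by have [/(_ t)[_ cG sG] _ _ _ _] := hRT4; exact: strictly_convex_body.
Qed.

Lemma gap_support t : 0 <= t -> support_map (gap t) (wpoint reach G t).
Proof.
move=> t0; apply: (difference_support (wX := contact (reach t)) (wY := contact (G t))).
  exact: (reachable_support hPhi cU U0 hRP1 hRP2 t0).
by have [/(_ t)[G0 cG sG] _ _ _ _] := hRT4; exact: strictly_convex_support.
Qed.

Lemma reachable_support_lip t t' (p : 'rV[R]_n) : 0 <= t -> 0 <= t' -> enorm p = 1 ->
  pairing p (contact (reach t) p) <= pairing p (contact (reach t') p) + vR * `|t - t'|.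
Proof.
move=> t0 t'0 p1; have p0 := unit_neq0 p1.
have [[u cu uE] _ _] := reachable_support hPhi cU U0 hRP1 hRP2 t0 p0.
have [_ maxt' _] := reachable_support hPhi cU U0 hRP1 hRP2 t'0 p0.
rewrite -uE; have Rt' : reach t' (trajectory Phi s0 u t') by exists u.
apply: le_trans (lerD (maxt' _ Rt') (lexx _)).
rewrite -lerBlDl -pairingBr (le_trans (cauchy_schwarz _ _))// p1 mul1r.
have [tt'|/ltW t't] := leP t t'.
  by rewrite enormBC distrC ger0_norm ?subr_ge0// (traj_lipschitz hPhi cU hRP2 cu)// t0.
by rewrite ger0_norm ?subr_ge0// (traj_lipschitz hPhi cU hRP2 cu)// t'0.
Qed.

(** The contact points of the target move at speed at most [vG] for a fixed
    direction, and a trajectory that reaches the contact point at time [t] is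
    at distance at most [vR |t - t'|] from it at time [t']. *)
Lemma gap_lip t t' (p : 'rV[R]_n) : 0 <= t -> 0 <= t' -> enorm p = 1 ->
  pairing p (wpoint reach G t p) <=
  pairing p (wpoint reach G t' p) + (vG + vR) * `|t - t'|.
Proof.
have alg (a b c d e f : R) : a <= c + f -> d <= b + e -> a - b <= c - d + (e + f).
  by lra.
move=> t0 t'0 p1; have hr := reachable_support_lip t0 t'0 p1.
have Np0 : - p <> 0 by apply/eqP; rewrite oppr_eq0 unit_neq0.
have [_ _ /(_ _ Np0)[_ ds] _ sv] := hRT4.
have hg := pairing_speed p t' t ds (fun x => sv _ x Np0).
rewrite p1 mul1r distrC in hg.
by rewrite /wpoint !pairingBr mulrDl; exact: alg hr hg.
Qed.

Lemma hit_gap u t : controls U u -> G t (trajectory Phi s0 u t) -> gap t 0.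
Proof.
move=> cu Gt; exists (trajectory Phi s0 u t, trajectory Phi s0 u t).
  by split=> //; exists u.
exact: subrr.
Qed.

Lemma gap_hit t : gap t 0 ->
  exists2 u, controls U u & G t (trajectory Phi s0 u t).
Proof.
move=> [[x y] [/= [u cu ux] Gy] /= /subr0_eq xy].
by exists u => //; rewrite ux xy.
Qed.

Local Notation ot := (optimal_time Phi s0 U G).

Lemma optimal_time_le t : 0 <= t -> gap t 0 -> (ot <= t%:E)%E.
Proof.
move=> t0 /gap_hit[u cu Gt]; apply: ge_ereal_inf; eexists; first by exists u.
by apply: ge_ereal_inf; exists t%:E => //; exists t.
Qed.

Lemma optimal_time_ge0 : (0 <= ot)%E.
Proof.
apply: le_ereal_inf_tmp => _ [u cu <-]; apply: le_ereal_inf_tmp => _ [t [t0 _] <-].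
by rewrite lee_fin.
Qed.

Lemma optimal_time_lt (b : \bar R) : (ot < b)%E ->
  exists t : R, [/\ 0 <= t, (t%:E < b)%E & gap t 0].
Proof.
move=> /ereal_inf_lt[_ [u cu <-]] /ereal_inf_lt[_ [t [t0 Gt] <-] tb].
by exists t; split=> //; exact: hit_gap Gt.
Qed.

(** If the two bodies were disjoint at the infimum [T] of the hitting times, the
    Lipschitz bound would keep them separated for a while after [T]. *)
Lemma optimal_time_gap : (ot < +oo)%E -> gap (fine ot) 0.
Proof.
have alg (a b c d : R) : 0 <= a -> d < c -> b + c <= 0 -> a <= b + d -> False by lra.
move=> hT; have T0 := optimal_time_ge0.
have fT : ot \is a fin_num by rewrite ge0_fin_numE.
have TE := fineK fT; set T := fine ot in TE *.
have T0' : 0 <= T by rewrite -lee_fin TE.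
apply: contrapT => nT.
have L0 : 0 < vG + vR by have [vR0 _] := hRP2; have [_ _ _ vG0 _] := hRT4; lra.
have [t1 [_ _ [xy [/= Rx Gy] _]]] := optimal_time_lt hT.
have WT0 : gap T !=set0.
  have [x Rx0] := reachable_neq0 Phi s0 U0 T.
  have [/(_ T)[[y Gy0] _ _] _ _ _ _] := hRT4.
  by exists (x - y), (x, y).
have [p p1 [c c0 hc]] := separation (gap_body T0') WT0 nT.
have p0 := unit_neq0 p1.
have cL : 0 < c / (vG + vR) by rewrite divr_gt0.
have [|t [t0 tb Wt]] := @optimal_time_lt (T + c / (vG + vR))%:E.
  by rewrite -TE lte_fin ltrDl.
have Tt : T <= t by rewrite -lee_fin TE optimal_time_le.
have [_ /(_ _ Wt) maxt _] := gap_support t0 p0.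
have [WT _ _] := gap_support T0' p0.
have := gap_lip t0 T0' p1; have := hc _ WT; rewrite !pairing0r in maxt *.
rewrite lte_fin -ltrBlDl ltr_pdivlMr// mulrC in tb.
rewrite (ger0_norm (_ : 0 <= t - T)) ?subr_ge0//.
exact: alg maxt tb.
Qed.

End Hitting.

Theorem theorem26 (R : realType) (n : nat)
    (A Phi : R -> 'M[R]_n) (s0 : 'cV[R]_n) (U : set 'cV[R]_n)
    (G : R -> set 'cV[R]_n) (vR vG : R)
    (J : {fset 'cV[R]_n} -> 'cV[R]_n * {fset 'cV[R]_n})
    (da : distance_algorithm) (alpha : R) (p : 'rV[R]_n)
    (hA : forall i j, measurable_fun setT (fun t : R => A t i j))
    (hPhi : fundamental_matrix A Phi)
    (hU0 : U !=set0) (hU : compact U)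
    (hRP1 : RP1 Phi s0 U)
    (hRP2 : RP2 A Phi s0 U vR)
    (hRT4 : RT4 G vG)
    (hJ : johnson_spec J)
    (halpha : 0 < alpha)
    (hp : enorm p = 1)
    (hT : (optimal_time Phi s0 U G < +oo)%E) :
  exists (Tout : R -> R) (pout : R -> 'rV[R]_n),
    [/\ forall eps : R, 0 < eps -> forall out : R * 'rV[R]_n,
          semi_analytical da (reachable Phi s0 U) G J vR vG eps alpha p out <->
          out = (Tout eps, pout eps),
        Tout eps @[eps --> 0^'+] --> fine (optimal_time Phi s0 U G) &
        forall pstar : 'rV[R]_n,
          (0 < optimal_time Phi s0 U G)%E ->
          unique (fun p' : 'rV[R]_n =>
                    delta (reachable Phi s0 U) G
                      (fine (optimal_time Phi s0 U G)) p' = 0 /\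
                    enorm p' = 1) pstar ->
          pout eps @[eps --> 0^'+] --> pstar].
Proof.
have [vR0 _] := hRP2; have [_ _ _ vG0 _] := hRT4.
have L0 : 0 < vG + vR by rewrite ltr_wpDl.
have fT : optimal_time Phi s0 U G \is a fin_num.
  by rewrite ge0_fin_numE// optimal_time_ge0.
have TE := fineK fT.
have T0 : 0 <= fine (optimal_time Phi s0 U G) by rewrite fine_ge0// optimal_time_ge0.
pose W t := difference_body (reachable Phi s0 U t) (G t).
have bW t : 0 <= t -> convex_body (W t).
  exact: (gap_body hPhi hU hU0 hRP1 hRP2 hRT4).
have sW t : 0 <= t -> support_map (W t) (wpoint (reachable Phi s0 U) G t).
  exact: (gap_support hPhi hU hU0 hRP1 hRP2 hRT4).
have WT : W (fine (optimal_time Phi s0 U G)) 0.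
  exact: (optimal_time_gap hPhi hU hU0 hRP1 hRP2 hRT4 hT).
have Wlt t : 0 <= t -> t < fine (optimal_time Phi s0 U G) -> ~ W t 0.
  move=> t0 tT /(optimal_time_le t0); rewrite -TE lee_fin.
  by rewrite leNgt tT.
have lipW := gap_lip hPhi hU hU0 hRP1 hRP2 hRT4.
have [Tout [pout [run cvT cvp]]] :=
  semi_analytical_limit L0 T0 halpha bW sW lipW WT Wlt da hJ hp.
exists Tout, pout; split=> // pstar Tpos uni.
by apply: cvp => //; rewrite -lte_fin TE.
Qed.
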